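(* There is an exact functor $\mathfrak{D}:\mathcal{M}\to\mathrm{Ch}(\mathcal{M})$, with values in $\mathbb{N}$-graded chain complexes of $\mathcal{A}$-modules, defined on an $\mathcal{A}$-module $M$ by $$\mathfrak{D}_sM=\Sigma R_s(\Sigma^{s-1}M)\quad(s\in\mathbb{N}),$$ with differential $$d_s=\Sigma d_{s,\Sigma^{s-1}M}:\mathfrak{D}_sM\to\mathfrak{D}_{s-1}M\quad(s\ge1).$$
   Context: $\mathbb{F}=\mathbb{F}_2$; $\mathcal{A}$ is the mod 2 Steenrod algebra; $\mathcal{M}$ is the category of ($\mathbb{Z}$-graded, left) $\mathcal{A}$-modules, with tensor product over $\mathbb{F}$ and action given by the Cartan formula; $\Sigma^n=\Sigma^n\mathbb{F}\otimes-$ for $n\in\mathbb{Z}$, $\Sigma^n\mathbb{F}$ being $\mathbb{F}$ in degree $n$. $\mathrm{Ch}(\mathcal{M})$ is the (abelian) category of chain complexes in $\mathcal{M}$. Singer functors. $\mathbb{F}[u^{\pm1}]$, $|u|=1$, is an $\mathcal{A}$-module by $Sq^i(u^n)=\binom{n}{i}u^{n+i}$, $n\in\mathbb{Z}$. For $M\in\mathcal{M}$, $\mathbb{F}[u^{\pm1}]\underline{\underline{\otimes}}M$ (large, i.e. half-completed, tensor product) has as degree $n$ part the formal sums $\sum_j u^{n-j}\otimes m_j$ with $m_j\in M^j$ and $m_j=0$ for $j\ll0$, with $\mathcal{A}$ acting by the Cartan formula. For homogeneous $x\in M$, $St_1(x)=\sum_{i\ge0}u^{|x|-i}\otimes Sq^ix$,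 and $R_1M$ is the sub $\mathbb{F}[u]$-module of $\mathbb{F}[u^{\pm1}]\underline{\underline{\otimes}}M$ generated by all $St_1(x)$; it is a sub $\mathcal{A}$-module. Iterating, $R_1^{\circ s}M\subset \mathbb{F}[u_1^{\pm1}]\underline{\underline{\otimes}}(\cdots(\mathbb{F}[u_s^{\pm1}]\underline{\underline{\otimes}}M))$ ($u_1$ is the variable of the outermost $R_1$), and $St_s(x)=St_1(St_{s-1}(x))\in R_1^{\circ s}M$. With $D(s)=\mathbb{F}[u_1,\dots,u_s]^{GL_s(\mathbb{F})}$ the Dickson algebra, $R_sM$ is the sub $D(s)$-module of $R_1^{\circ s}M$ generated by the elements $St_s(x)$, $x\in M$ ($R_0M=M$); it is stable under $\mathcal{A}$ and functorial in $M$. There is a natural inclusion $R_sM\hookrightarrow R_{s-1}R_1M$. The residue $\partial:\mathbb{F}[u^{\pm1}]\to\Sigma^{-1}\mathbb{F}$ is the unique non-trivial map of graded vector spaces; it is $\mathcal{A}$-linear. $d_M:R_1M\to\Sigma^{-1}M$ is the composite $R_1M\hookrightarrow\mathbb{F}[u^{\pm1}]\underline{\underline{\otimes}}M\to\Sigma^{-1}M$ of the inclusion with $\partial\underline{\underline{\otimes}}M$. For $s\ge1$, $d_{s,M}$ is the composite $R_sM\hookrightarrow R_{s-1}R_1M\xrightarrow{R_{s-1}d_M}R_{s-1}(\Sigma^{-1}M)$. *)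

(* Defs.v *)
From HB Require Import structures.
From mathcomp Require Import all_boot all_order all_algebra.
From mathcomp Require Import boolp.
From mathcomp Require Import mpoly.

Set Implicit Arguments.
Unset Strict Implicit.
Unset Printing Implicit Defensive.

Import Order.TTheory GRing.Theory Num.Theory.
Local Open Scope ring_scope.

(** * Graded vector spaces over F_2 *)

Definition gvs := int -> lmodType 'F_2.
Identity Coercion gvs_fun : gvs >-> Funclass.

(* Maps of graded vector spaces (of degree 0). *)
Definition gmap (V W : gvs) := forall n : int, {linear V n -> W n}.
Identity Coercion gmap_fun : gmap >-> Funclass.

Definition gsub (V : gvs) := forall n : int, V n -> Prop.

(* [transport V m n] is the canonical identification V^m = V^n when m = n;
   it is 0 when m <> n. *)
Section Transport.
Variables (V : gvs) (m n : int).

Definition transport_fun (x : V m) : V n :=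
  match m =P n with
  | ReflectT e => eq_rect m (fun k => V k : Type) x n e
  | ReflectF _ => 0
  end.

Lemma transport_linear : linear transport_fun.
Proof.
move=> a x y; rewrite /transport_fun; case: eqP => [e|_].
  by case: n / e.
by rewrite scaler0 addr0.
Qed.

HB.instance Definition _ :=
  GRing.isLinear.Build 'F_2 (V m) (V n) *:%R transport_fun transport_linear.

Definition transport : {linear V m -> V n} := transport_fun.
End Transport.

(** * Steenrod operations *)

(* A graded vector space with linear operations Sq^i, i >= 0, not yet subject
   to any relation.  To avoid casts, the operation Sq^i : M^m -> M^n, where
   n = m + i, is written [Sq m n]; [Sq m n] is 0 for n < m. *)
Record sqmod := SqMod {
  carrier :> gvs;
  Sq : forall m n : int, {linear carrier m -> carrier n};
  Sq_neg : forall (m n : int) (x : carrier m), n < m -> Sq m n x = 0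
}.

(* Sq^0 = 1 and, for 0 < a < 2b, the Adem relation
   Sq^a Sq^b = sum_(0 <= j <= a/2) C(b-1-j, a-2j) Sq^(a+b-j) Sq^j. *)
Definition steenrod_relations (M : sqmod) : Prop :=
  (forall (m : int) (x : M m), Sq M m m x = x) /\
  (forall (a b : nat) (m : int) (x : M m),
     (0 < a < b.*2)%N ->
     Sq M (m + b%:Z) (m + b%:Z + a%:Z) (Sq M m (m + b%:Z) x) =
     \sum_(j < a./2.+1)
       Sq M (m + j%:Z) (m + b%:Z + a%:Z) (Sq M m (m + j%:Z) x)
         *+ 'C(b - 1 - j, a - j.*2)).

(* The mod 2 Steenrod algebra is presented by the generators Sq^i and the
   relations above, so that this is the notion of a Z-graded left module
   over it; no instability condition is imposed. *)
Record amodule := AModule {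
  sqmod_of :> sqmod;
  amoduleP : steenrod_relations sqmod_of
}.

Definition sq_equivariant (M N : sqmod) (f : gmap M N) : Prop :=
  forall (m n : int) (x : M m), f n (Sq M m n x) = Sq N m n (f m x).

Record amod_hom (M N : amodule) := AmodHom {
  amod_hom_map :> gmap M N;
  amod_homP : sq_equivariant amod_hom_map
}.

Definition id_gmap (V : gvs) : gmap V V := fun n => idfun.

Definition comp_gmap (U V W : gvs) (g : gmap V W) (f : gmap U V) : gmap U W :=
  fun n => g n \o f n.

Definition amod_hom_id (M : amodule) : amod_hom M M :=
  @AmodHom M M (@id_gmap M) (fun _ _ _ => erefl).

Lemma amod_hom_compP (M N P : amodule)
    (g : amod_hom N P) (f : amod_hom M N) :
  sq_equivariant (comp_gmap g f).
Proof. by move=> m n x /=; rewrite !amod_homP. Qed.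

Definition amod_hom_comp (M N P : amodule)
    (g : amod_hom N P) (f : amod_hom M N) : amod_hom M P :=
  AmodHom (amod_hom_compP g f).

Definition short_exact (M N P : amodule)
    (f : amod_hom M N) (g : amod_hom N P) : Prop :=
  forall n : int,
    [/\ injective (f n),
        forall y : N n, g n y = 0 <-> exists x : M n, f n x = y
      & forall z : P n, exists y : N n, g n y = z].

(** * Chain complexes and exact functors *)

Record complex := Complex {
  chain :> nat -> amodule;
  diff : forall s : nat, amod_hom (chain s.+1) (chain s);
  diff_diff : forall (s : nat) (n : int) (x : chain s.+2 n),
    diff s n (diff s.+1 n x) = 0
}.

Record chain_map (C C' : complex) := ChainMap {
  chain_hom :> forall s : nat, amod_hom (C s) (C' s);
  chain_homP : forall (s : nat) (n : int) (x : C s.+1 n),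
    chain_hom s n (diff C s n x) = diff C' s n (chain_hom s.+1 n x)
}.

Record functor := Functor {
  fobj :> amodule -> complex;
  fmap : forall M N : amodule, amod_hom M N -> chain_map (fobj M) (fobj N);
  fmap_id : forall (M : amodule) (s : nat) (n : int) (x : fobj M s n),
    fmap (amod_hom_id M) s n x = x;
  fmap_comp : forall (M N P : amodule) (g : amod_hom N P) (f : amod_hom M N)
      (s : nat) (n : int) (x : fobj M s n),
    fmap (amod_hom_comp g f) s n x = fmap g s n (fmap f s n x)
}.

(* Additive, and preserving short exact sequences; those of complexes are the
   degreewise short exact ones. *)
Definition exact_functor (F : functor) : Prop :=
  (forall (M N : amodule) (f g h : amod_hom M N),
     (forall (n : int) (x : M n), h n x = f n x + g n x) ->
     forall (s : nat) (n : int) (x : F M s n),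
       fmap F h s n x = fmap F f s n x + fmap F g s n x) /\
  (forall (M N P : amodule) (f : amod_hom M N) (g : amod_hom N P),
     short_exact f g ->
     forall s : nat, short_exact (fmap F f s) (fmap F g s)).

(** * Suspension *)

(* (Sigma^k M)^n = M^(n-k). *)
Definition susp_gvs (k : int) (V : gvs) : gvs := fun n => V (n - k).

Definition susp_gmap (k : int) (V W : gvs) (f : gmap V W) :
  gmap (susp_gvs k V) (susp_gvs k W) := fun n => f (n - k).
Arguments susp_gmap k {V W} f.

Definition susp_gsub (k : int) (V : gvs) (S : gsub V) : gsub (susp_gvs k V) :=
  fun n => S (n - k).
Arguments susp_gsub k {V} S.

Lemma susp_Sq_neg (k : int) (M : sqmod) (m n : int) (x : susp_gvs k M m) :
  n < m -> Sq M (m - k) (n - k) x = 0.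
Proof. by move=> nm; apply: Sq_neg; rewrite ltrD2r. Qed.

Definition susp (k : int) (M : sqmod) : sqmod :=
  @SqMod (susp_gvs k M) (fun m n => Sq M (m - k) (n - k)) (@susp_Sq_neg k M).

(* The canonical isomorphism Sigma^a Sigma^b M = Sigma^c M for c = a + b. *)
Definition susp_susp (a b c : int) (V : gvs) :
  gmap (susp_gvs a (susp_gvs b V)) (susp_gvs c V) :=
  fun n => transport V (n - a - b) (n - c).
Arguments susp_susp : clear implicits.

(** * The large tensor product F[u^(+-1)] (x) M *)

(* A formal sum  sum_j u^(n-j) (x) m_j  of degree n is represented by the
   family (m_j)_j; hence the underlying type does not depend on n. *)
Record formal_sum (V : gvs) := FormalSum {
  coef :> forall j : int, V j;
  coefP : exists B : int, forall j : int, j < B -> coef j = 0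
}.

Section FormalSum.
Variable V : gvs.
Implicit Types c d : formal_sum V.

Lemma formal_sum_ext c d : (forall j, c j = d j) -> c = d.
Proof.
case: c d => [c cP] [d dP] /= cd.
have {}cd : c = d by apply: functional_extensionality_dep.
by case: d / cd dP => dP; congr FormalSum; apply: Prop_irrelevance.
Qed.

HB.instance Definition _ := gen_eqMixin (formal_sum V).
HB.instance Definition _ := gen_choiceMixin (formal_sum V).

Lemma fs_zeroP : exists B : int, forall j : int, j < B -> (0 : V j) = 0.
Proof. by exists 0. Qed.

Lemma fs_oppP c : exists B : int, forall j : int, j < B -> - c j = 0.
Proof. by have [B cB] := coefP c; exists B => j /cB ->; rewrite oppr0. Qed.

Lemma fs_addP c d : exists B : int, forall j : int, j < B -> c j + d j = 0.
Proof.
have [[B cB] [B' dB]] := (coefP c, coefP d).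
exists (Num.min B B') => j; rewrite lt_min => /andP[/cB-> /dB->].
by rewrite addr0.
Qed.

Lemma fs_scaleP (a : 'F_2) c :
  exists B : int, forall j : int, j < B -> a *: c j = 0.
Proof. by have [B cB] := coefP c; exists B => j /cB ->; rewrite scaler0. Qed.

Definition fs_zero := FormalSum fs_zeroP.
Definition fs_opp c := FormalSum (fs_oppP c).
Definition fs_add c d := FormalSum (fs_addP c d).
Definition fs_scale a c := FormalSum (fs_scaleP a c).

Lemma fs_addA : associative fs_add.
Proof. by move=> c d e; apply: formal_sum_ext => j /=; rewrite addrA. Qed.
Lemma fs_addC : commutative fs_add.
Proof. by move=> c d; apply: formal_sum_ext => j /=; rewrite addrC. Qed.
Lemma fs_add0 : left_id fs_zero fs_add.
Proof. by move=> c; apply: formal_sum_ext => j /=; rewrite add0r. Qed.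
Lemma fs_addN : left_inverse fs_zero fs_opp fs_add.
Proof. by move=> c; apply: formal_sum_ext => j /=; rewrite addNr. Qed.

HB.instance Definition _ :=
  GRing.isZmodule.Build (formal_sum V) fs_addA fs_addC fs_add0 fs_addN.

Lemma fs_scaleA a b c : fs_scale a (fs_scale b c) = fs_scale (a * b) c.
Proof. by apply: formal_sum_ext => j /=; rewrite scalerA. Qed.
Lemma fs_scale1 : left_id 1 fs_scale.
Proof. by move=> c; apply: formal_sum_ext => j /=; rewrite scale1r. Qed.
Lemma fs_scaleDr : right_distributive fs_scale +%R.
Proof. by move=> a c d; apply: formal_sum_ext => j /=; rewrite scalerDr. Qed.
Lemma fs_scaleDl c : {morph fs_scale^~ c : a b / a + b}.
Proof. by move=> a b; apply: formal_sum_ext => j /=; rewrite scalerDl. Qed.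

HB.instance Definition _ := GRing.Zmodule_isLmodule.Build 'F_2 (formal_sum V)
  fs_scaleA fs_scale1 fs_scaleDr fs_scaleDl.
End FormalSum.

Definition large_gvs (V : gvs) : gvs := fun _ => formal_sum V.

(* F[u^(+-1)] (x) f. *)
Section LargeMap.
Variables (V W : gvs) (f : gmap V W).

Lemma large_mapP (c : formal_sum V) :
  exists B : int, forall j : int, j < B -> f j (c j) = 0.
Proof. by have [B cB] := coefP c; exists B => j /cB ->; rewrite linear0. Qed.

Definition large_map_fun (c : formal_sum V) : formal_sum W :=
  FormalSum (large_mapP c).

Lemma large_map_linear : linear large_map_fun.
Proof. by move=> a c d; apply: formal_sum_ext => j /=; rewrite linearP. Qed.

HB.instance Definition _ := GRing.isLinear.Build 'F_2
  (formal_sum V) (formal_sum W) *:%R large_map_fun large_map_linear.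

Definition large_map : gmap (large_gvs V) (large_gvs W) :=
  fun _ => large_map_fun : {linear formal_sum V -> formal_sum W}.
End LargeMap.

(* C(n, i) for n in Z; note that Negz p = - (p + 1). *)
Definition zbin (n : int) (i : nat) : int :=
  match n with
  | Posz p => 'C(p, i)%:Z
  | Negz p => (-1) ^+ i * 'C(p + i, i)%:Z
  end.

(* The Cartan formula: for n = m + k, the coefficient of u^(n-l) in
   Sq^k (sum_j u^(m-j) (x) c_j) is the sum over 0 <= b <= k, with j = l - b, of
   C(m-j, k-b) Sq^b c_j. *)
Section LargeSq.
Variables (M : sqmod) (m n : int).

Definition cartan_coef (c : formal_sum M) (l : int) : M l :=
  match n - m with
  | Posz k => \sum_(b < k.+1)
                Sq M (l - b%:Z) l (c (l - b%:Z)) *~ zbin (m - (l - b%:Z)) (k - b)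
  | Negz _ => 0
  end.

Lemma cartan_coefP (c : formal_sum M) :
  exists B : int, forall l : int, l < B -> cartan_coef c l = 0.
Proof.
have [B cB] := coefP c; exists B => l lB; rewrite /cartan_coef.
case: (n - m) => // k; rewrite big1 // => b _.
by rewrite cB ?linear0 ?mul0rz //; apply: le_lt_trans lB; rewrite gerBl.
Qed.

Definition large_Sq_fun (c : formal_sum M) : formal_sum M :=
  FormalSum (cartan_coefP c).

Lemma large_Sq_linear : linear large_Sq_fun.
Proof.
move=> a c d; apply: formal_sum_ext => l /=; rewrite /cartan_coef.
case: (n - m) => [k|k]; last by rewrite scaler0 addr0.
rewrite scaler_sumr -big_split; apply: eq_bigr => b _ /=.
by rewrite linearP mulrzDl scalerMzr.
Qed.

HB.instance Definition _ := GRing.isLinear.Build 'F_2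
  (formal_sum M) (formal_sum M) *:%R large_Sq_fun large_Sq_linear.

Definition large_Sq : {linear large_gvs M m -> large_gvs M n} :=
  large_Sq_fun : {linear formal_sum M -> formal_sum M}.
End LargeSq.

Lemma large_Sq_neg (M : sqmod) (m n : int) (c : large_gvs M m) :
  n < m -> large_Sq M m n c = 0.
Proof.
move=> nm; apply: formal_sum_ext => l /=; rewrite /cartan_coef.
by move: nm; rewrite -subr_lt0; case: (n - m).
Qed.

Definition large (M : sqmod) : sqmod :=
  @SqMod (large_gvs M) (@large_Sq M) (@large_Sq_neg M).

(* F[u_1^(+-1)] (x) (... (F[u_s^(+-1)] (x) M)), with u_1 outermost. *)
Definition larges (s : nat) (M : sqmod) : sqmod := iter s large M.

Fixpoint larges_map (s : nat) (M N : sqmod) (f : gmap M N) :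
    gmap (larges s M) (larges s N) :=
  match s with
  | 0 => f
  | s'.+1 => large_map (larges_map s' f)
  end.

(** * Singer functors *)

(* For |x| = d, St_1(x) = sum_(i >= 0) u^(d-i) (x) Sq^i x has degree 2d; the
   coefficient of u^(2d-j) is Sq^(j-d) x. *)
Section St1.
Variables (M : sqmod) (d : int) (x : M d).

Lemma St1P : exists B : int, forall j : int, j < B -> Sq M d j x = 0.
Proof. by exists d => j; apply: Sq_neg. Qed.

Definition St1 : large M (2 * d) := FormalSum St1P.
End St1.

(* St_s(x) has degree 2^s |x|. *)
Definition St_deg (s : nat) (d : int) : int := iter s ( *%R 2) d.

Fixpoint St (s : nat) (M : sqmod) (d : int) (x : M d) :
    larges s M (St_deg s d) :=
  match s with
  | 0 => x
  | s'.+1 => St1 (St s' x)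
  end.

(* Given phi of degree e, the map  u^a (x) phi :  the image of
   sum_j u^(m-j) (x) c_j  is  sum_j u^(m+a-j) (x) phi(c_j), whose coefficient
   in V^l is phi(c_(l-e)); the exponent a is implicit in the degrees. *)
Section LargeShift.
Variables (V W : gvs) (e : int).
Variable phi : forall j : int, {linear V (j - e) -> W j}.

Lemma large_shiftP (c : formal_sum V) :
  exists B : int, forall j : int, j < B -> phi j (c (j - e)) = 0.
Proof.
have [B cB] := coefP c; exists (B + e) => j jB.
by rewrite cB ?linear0 // ltrBlDr.
Qed.

Definition large_shift_fun (c : formal_sum V) : formal_sum W :=
  FormalSum (large_shiftP c).

Lemma large_shift_linear : linear large_shift_fun.
Proof. by move=> a c d; apply: formal_sum_ext => j /=; rewrite linearP. Qed.

HB.instance Definition _ := GRing.isLinear.Build 'F_2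
  (formal_sum V) (formal_sum W) *:%R large_shift_fun large_shift_linear.

Definition large_shift : {linear formal_sum V -> formal_sum W} :=
  large_shift_fun.
End LargeShift.

(* Multiplication by u_1^(a 0) ... u_s^(a (s-1)), as a map from degree m to
   degree n = m + a 0 + ... + a (s-1); it is only used for such n. *)
Fixpoint mulmon (s : nat) (M : sqmod) (a : nat -> nat) :
    forall m n : int, {linear larges s M m -> larges s M n} :=
  match s with
  | 0 => transport M
  | s'.+1 => fun m n =>
      let a' := fun i => a i.+1 in
      let e := (\sum_(i < s') a' i)%N%:Z in
      @large_shift (larges s' M) (larges s' M) e
        (fun j => mulmon s' M a' (j - e) j)
  end.

(* Multiplication by f, homogeneous of degree n - m, from degree m to n; the
   variable u_(i+1) is 'X_i. *)
Definition mulpoly (s : nat) (M : sqmod) (f : {mpoly 'F_2[s]}) (m n : int)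
    (c : larges s M m) : larges s M n :=
  \sum_(a <- msupp f) f@_a *: mulmon s M (fun i => nth 0%N a i) m n c.

(* The Dickson algebra D(s) = F[u_1, ..., u_s]^(GL_s(F)). *)
Definition dickson (s : nat) (f : {mpoly 'F_2[s]}) : Prop :=
  forall g : 'M['F_2]_s, g \in unitmx ->
    f \mPo [tuple \sum_(j < s) g i j *: 'X_j | i < s] = f.

(* R_s M, the sub D(s)-module generated by the St_s(x), x homogeneous in M.
   Being generated, it may be formed in F[u_1^(+-1)] (x) (...) rather than in
   its subspace R_1(...(R_1 M)). *)
Inductive singer (s : nat) (M : sqmod) : gsub (larges s M) :=
  | singer_St (d : int) (x : M d) : singer (St s x)
  | singer_zero (n : int) : singer (0 : larges s M n)
  | singer_add (n : int) (c c' : larges s M n) :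
      singer c -> singer c' -> singer (c + c')
  | singer_mul (k : nat) (f : {mpoly 'F_2[s]}) (m n : int)
      (c : larges s M m) :
      n = m + k%:Z -> dickson f -> f \is k.-homog ->
      singer c -> singer (mulpoly f n c).

(* The residue  F[u^(+-1)] (x) M -> Sigma^(-1) M  takes the coefficient of
   u^(-1), which for a formal sum of degree n is m_(n+1). *)
Section Residue.
Variables (V : gvs) (n : int).

Definition residue_fun (c : large_gvs V n) : susp_gvs (-1) V n :=
  coef c (n - -1).

Lemma residue_linear : linear residue_fun.
Proof. by []. Qed.

HB.instance Definition _ := GRing.isLinear.Build 'F_2
  (large_gvs V n) (susp_gvs (-1) V n) *:%R residue_fun residue_linear.

Definition residue_lin : {linear large_gvs V n -> susp_gvs (-1) V n} :=
  residue_fun.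
End Residue.

Definition residue (M : sqmod) : gmap (large M) (susp (-1) M) :=
  @residue_lin M.

(* The regrouping of the (s+1)-fold construction on M as the s-fold one on
   F[u^(+-1)] (x) M; it restricts to the inclusion R_(s+1) M -> R_s R_1 M. *)
Fixpoint larges_regroup (s : nat) (M : sqmod) :
    gmap (larges s.+1 M) (larges s (large M)) :=
  match s with
  | 0 => @id_gmap (large M)
  | s'.+1 => large_map (larges_regroup s' M)
  end.

(* d_(s+1,M) : R_(s+1) M -> R_s R_1 M -> R_s (Sigma^(-1) M), before
   restriction: R_s f is the restriction of [larges_map s f]. *)
Definition singer_diff (s : nat) (M : sqmod) :
    gmap (larges s.+1 M) (larges s (susp (-1) M)) :=
  comp_gmap (larges_map s (residue M)) (@larges_regroup s M).

(** * The functor D *)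

(* Sigma applied to the s-fold large tensor construction on Sigma^(s-1) M;
   it contains D_s M = Sigma R_s(Sigma^(s-1) M). *)
Definition D_ambient (s : nat) (M : sqmod) : sqmod :=
  susp 1 (larges s (susp (s%:Z - 1) M)).

Definition D_sub (s : nat) (M : sqmod) : gsub (D_ambient s M) :=
  susp_gsub 1 (@singer s (susp (s%:Z - 1) M)).

(* Sigma d_(s+1), followed by Sigma^(-1) Sigma^s M = Sigma^(s-1) M. *)
Definition D_diff (s : nat) (M : sqmod) :
    gmap (D_ambient s.+1 M) (D_ambient s M) :=
  susp_gmap 1
    (comp_gmap
       (@larges_map s (susp (-1) (susp (s.+1%:Z - 1) M)) (susp (s%:Z - 1) M)
          (susp_susp (-1) (s.+1%:Z - 1) (s%:Z - 1) M))
       (@singer_diff s (susp (s.+1%:Z - 1) M))).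

Definition D_map (s : nat) (M N : sqmod) (f : gmap M N) :
    gmap (D_ambient s M) (D_ambient s N) :=
  susp_gmap 1
    (@larges_map s (susp (s%:Z - 1) M) (susp (s%:Z - 1) N)
       (susp_gmap (s%:Z - 1) f)).

(* i identifies A with the graded subspace S of P, together with the
   Steenrod operations (S is in particular stable under them). *)
Definition identifies_with (A P : sqmod) (i : gmap A P) (S : gsub P) : Prop :=
  [/\ sq_equivariant i,
      forall n : int, injective (i n)
    & forall (n : int) (c : P n), S n c <-> exists x : A n, i n x = c].

(* Main.v *)
Require Import Defs.
From HB Require Import structures.
From mathcomp Require Import all_boot all_order all_algebra.
From mathcomp Require Import perm boolp mpoly.
From mathcomp Require Import ring zify.

Set Implicit Arguments.
Unset Strict Implicit.
Unset Printing Implicit Defensive.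

Import Order.TTheory GRing.Theory Num.Theory.
Local Open Scope ring_scope.

(* Over F_2 the Adem relations amount to the Bullett-Macdonald identity
   P(s^2 + st) P(t^2) = P(t^2 + st) P(s^2) for the total square P, a form of the
   relations which passes from M to F[u^(+-1)] (x) M and which computes
   Sq^k St_1(x).  Iterating, Sq^k St_s(x) is a combination of the St_s(Sq^i x)
   whose coefficients are those of powers of Vt_s(z) = prod_l (1 + z l), where l
   runs over the linear forms; they are Dickson invariants, so that R_s M is
   stable under the Steenrod algebra.

   An element f of D(s+1) is a sum of r_j V^j with r_j in D(s), where V is the
   product of the u_(s+1) + l, with l a linear form in u_1, ..., u_s.  As V acts
   through the innermost variable, the residue of f St_(s+1)(x), for |x| = d, is
   the sum of the r_j St_s(Sq^(d+j+1) x).  The series all of whose Dickson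
   multiples have vanishing double residue are stable under the Sq^k; this
   reduces d d = 0 to the case of R_2, where D(2) = F[Q0, Q1] and the vanishing
   follows from Adem relations.

   For exactness in the middle, St_s(y) has leading term u^e (x) y, so that in a
   relation between elements f_i St_s(y_i) the terms of lowest degree satisfy
   sum_i f_i (x) y_i = 0. *)

(** The total square is multiplicative and P(z) u = u + z u^2. The Bullett-Macdonald identity can
    therefore be carried through F[u^(+-1)] (x) M one factor u at a time; a single Adem relation has
    no such multiplicative form.

    The reduction to R_2 rests on two facts about the outermost variable. The coefficients of
    St_(s+1)(x) in powers of u_1 are the Sq^k St_s(x), and the coefficients of a Dickson invariant
    in powers of u_1 are Dickson invariants in the other variables; both residues concern inner
    variables and leave u_1 alone. In R_2, Q0 St_2(x) has again the form of St_2(x), with the degree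
    of x raised by one. This is why the degree d is a parameter of St_s unrelated to x. Only the
    powers of Q1 then remain.

    In a relation between elements f_i St_s(y_i), the leading exponents depend on the degrees of the
    y_i, which may differ. Since St_s(y) only involves elements of degree at least |y|, the relation
    is treated from the lowest degree upwards, and the terms already lifted are subtracted. *)

Lemma pchar_F2 : 2%N \in [pchar 'F_2].
Proof. exact: pchar_Fp. Qed.

Lemma addv2 (V : lmodType 'F_2) (x : V) : x + x = 0.
Proof. by rewrite -mulr2n -scaler_nat (_ : 2%:R = 0) ?scale0r //; apply/eqP. Qed.

Lemma oppv (V : lmodType 'F_2) (x : V) : - x = x.
Proof. by apply/eqP; rewrite eq_sym -subr_eq0 opprK addv2. Qed.

Lemma F2_cases (c : 'F_2) : c = 0 \/ c = 1.
Proof.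
by case: c => [[|[|n]] n2] //; [left | right]; apply/val_inj.
Qed.

Lemma addF2 (c : 'F_2) : c + c = 0.
Proof. by case: (F2_cases c) => ->; apply/val_inj. Qed.

Lemma addF2_eq0 (c d : 'F_2) : (c + d == 0) = (c == d).
Proof. by case: (F2_cases c) (F2_cases d) => -> [] ->. Qed.

Lemma addv_eq0 (V : lmodType 'F_2) (x y : V) : (x + y == 0) = (x == y).
Proof. by rewrite -{1}(oppv y) subr_eq0. Qed.

(** * Binomial coefficients modulo 2 with integer entries *)

Section Binomials.

(** With the value 0 for negative k, Pascal's rule holds for all integers n and k, and sums of such
    coefficients may be extended to any longer range. *)
Definition bz (n k : int) : 'F_2 :=
  match k with Posz i => (zbin n i)%:~R | Negz _ => 0 end.

Arguments bz : simpl never.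

Lemma bz_lt0 n k : k < 0 -> bz n k = 0.
Proof. by case: k. Qed.

Lemma bz_n0 n : bz n 0 = 1.
Proof. by case: n => p; rewrite /bz /= ?expr0 ?mul1r bin0. Qed.

Lemma bz_nat (m i : nat) : bz m i = 'C(m, i)%:R.
Proof. by []. Qed.

Lemma bz_0n k : bz 0 k = (k == 0)%:R.
Proof. by case: k => [[|k]|k]. Qed.

Lemma bz_Negz p (i : nat) : bz (Negz p) i = 'C(p + i, i)%:R.
Proof.
rewrite /bz /zbin rmorphM /= rmorphXn /= rmorphN1.
by rewrite (_ : -1 = 1 :> 'F_2) ?expr1n ?mul1r //; apply/eqP.
Qed.

Lemma bz_pascal (n k : int) : bz (n + 1) k = bz n k + bz n (k - 1).
Proof.
case: k => [[|k]|k]; last 2 first.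
- rewrite (_ : k.+1%:Z - 1 = k); last lia.
  case: n => [p|[|p]].
  + by rewrite (_ : Posz p + 1 = p.+1) ?bz_nat ?binS ?natrD //; lia.
  + rewrite (_ : Negz 0 + 1 = 0); last lia.
    by rewrite bz_0n !bz_Negz !add0n !binn; apply/eqP.
  + rewrite (_ : Negz p.+1 + 1 = Negz p); last lia.
    by rewrite !bz_Negz !addSn !addnS [in RHS]binS natrD -[RHS]addrA addF2 addr0.
- by rewrite !bz_lt0 ?addr0 //; lia.
- by rewrite !bz_n0 bz_lt0 ?addr0.
Qed.

Lemma bz_pascal_pred (n k : int) : bz n k = bz (n - 1) k + bz (n - 1) (k - 1).
Proof. by rewrite -bz_pascal subrK. Qed.

Lemma bz_vandermonde (n : int) (m : nat) (k : int) :
  bz (n + m%:Z) k = \sum_(i < m.+1) 'C(m, i)%:R * bz n (k - i%:Z).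
Proof.
elim: m k => [|m IH] k.
  by rewrite big_ord_recl big_ord0 bin0 mul1r subr0 !addr0.
rewrite (_ : n + m.+1%:Z = n + m%:Z + 1); last lia.
rewrite bz_pascal !IH [RHS]big_ord_recl /=.
under [X in _ = _ + X]eq_bigr => i _ do rewrite /bump /= add1n binS natrD mulrDl.
rewrite big_split /= addrA; congr (_ + _); last first.
  by apply: eq_bigr => i _; congr (_ * bz _ _); lia.
rewrite big_ord_recl [X in _ = _ + X]big_ord_recr /= !bin0.
under [in LHS]eq_bigr => i _ do rewrite /bump /= add1n.
by rewrite (@bin_small m m.+1) // mulr0n mul0r !addr0.
Qed.

Lemma bin_pow2 r i : (0 < i < 2 ^ r)%N -> 'C(2 ^ r, i)%:R = 0 :> 'F_2.
Proof.
move=> /andP[i0 ir].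
have ch : 2%N \in [pchar {poly 'F_2}] by rewrite pchar_poly pchar_F2.
have : (('X : {poly 'F_2}) + 1) ^+ (2 ^ r) = 'X^(2 ^ r) + 1.
  by rewrite exprDn_pchar ?expr1n // pnatX pnatE // ch.
move/(congr1 (fun p : {poly 'F_2} => p`_i)).
rewrite coefD coefXn coef1 (gtn_eqF i0) (ltn_eqF ir) addr0 => coef0.
transitivity (('X + 1 : {poly 'F_2}) ^+ (2 ^ r))`_i; last by rewrite coef0.
rewrite addrC exprDn coef_sum (bigD1 (Ordinal (leqW ir))) //=.
rewrite expr1n mul1r coefMn coefXn eqxx big1 ?addr0 // => j ji.
rewrite expr1n mul1r coefMn coefXn.
by rewrite (_ : (i == j :> nat) = false) ?mul0rn // eq_sym; exact: negbTE.
Qed.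

(** In the Vandermonde sum, C(2^r, i) is even for 0 < i < 2^r, and for i >= 2^r the lower entry k -
    i is negative. This periodicity allows a negative upper entry to be replaced by a nonnegative
    one. *)
Lemma bz_shift_pow2 (n : int) r (k : int) : k < (2 ^ r)%N%:Z ->
  bz (n + (2 ^ r)%N%:Z) k = bz n k.
Proof.
move=> kr; rewrite bz_vandermonde big_ord_recl bin0 mul1r subr0.
rewrite big1 ?addr0 // => i _ /=; rewrite /bump /= add1n.
have [ir|] := ltnP i.+1 (2 ^ r); first by rewrite bin_pow2 ?mul0r.
by move=> ri; rewrite bz_lt0 ?mulr0 //; lia.
Qed.

Lemma bz_shift_mul (n : int) r q (k : int) : k < (2 ^ r)%N%:Z ->
  bz (n + (q * 2 ^ r)%N%:Z) k = bz n k.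
Proof.
move=> kr; elim: q => [|q IH]; first by rewrite mul0n addr0.
by rewrite mulSnr PoszD addrA bz_shift_pow2.
Qed.

(* [C(-1-i, i) = C(2i, i)] up to sign, and the latter is even for [i > 0]. *)
Lemma bz_neg_diag (i : int) : bz (- 1 - i) i = (i == 0)%:R.
Proof.
case: i => [[|i]|i] //.
rewrite (_ : -1 - i.+1%:Z = Negz i.+1); last lia.
rewrite bz_Negz (_ : (i.+1 + i.+1 = (i.+1 + i).+1)%N) ?addnS // binS natrD.
have -> : 'C(i.+1 + i, i) = 'C(i.+1 + i, i.+1).
  by rewrite -[RHS]bin_sub ?leq_addr // addKn.
by rewrite addF2.
Qed.

End Binomials.
Arguments bz : simpl never.

Section Fibonacci.
Variables (R : comNzRingType) (A B al be : R).
Hypothesis R2 : 2%:R = 0 :> R.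
Hypotheses (sumB : al + be = B) (prodAB : al * be = A * B).

(** A Fibonacci sequence whose recursion T^2 = B T + A B has, in characteristic 2, the roots [al]
    and [be]. Binet's formula would give it as (al^(m+1) - be^(m+1)) / (al - be), and the
    denominator is B modulo 2. *)
Let fib m := \sum_(i < m.+1) 'C(i, m - i)%:R * A ^+ (m - i) * B ^+ i.

Let fib_rec m : fib m.+2 = B * fib m.+1 + A * B * fib m.
Proof.
rewrite {1}/fib big_ord_recl bin0n !mul0r add0r.
rewrite big_ord_recr [fib m.+1]big_ord_recr /= !subnn !bin0 !mul1r mulrDr.
rewrite [X in _ = X + _]addrC -addrA [LHS]addrC; congr (_ + _).
rewrite !mulr_sumr -big_split /=; apply: eq_bigr => i _.
rewrite /bump /= !add1n !subSS subSn ?(leq_ord i) // binS natrD.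
by rewrite !exprS; ring.
Qed.

Let fib_closed m : B * fib m = al ^+ m.+1 + be ^+ m.+1 /\
  B * fib m.+1 = al ^+ m.+2 + be ^+ m.+2.
Proof.
elim: m => [|m [IH1 IH2]].
  rewrite /fib !big_ord_recl !big_ord0 !bin0n /= !bin0; split.
    by rewrite -sumB; ring.
  rewrite -sumB !(expr0, expr1, mul0r, mul1r, addr0, add0r) -!expr2 sqrrD.
  by rewrite -mulr_natl R2 mul0r addr0.
split=> //; rewrite fib_rec mulrDr mulrCA [B * (A * B * _)]mulrCA IH1 IH2.
rewrite -prodAB -sumB !exprS.
have -> : forall x y : R, (al + be) * (al * (al * x) + be * (be * y)) +
  al * be * (al * x + be * y) = al * (al * (al * x)) + be * (be * (be * y)) +
  2%:R * (al * be * (al * x + be * y)) by move=> x y; ring.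
by rewrite R2 mul0r addr0.
Qed.

Lemma fibonacci_sum m :
  \sum_(i < m) 'C(i, m.-1 - i)%:R * (A ^+ (m.-1 - i) * B ^+ i.+1) =
  al ^+ m + be ^+ m.
Proof.
case: m => [|m]; first by rewrite big_ord0 !expr0 -mulr2n R2.
rewrite -(fib_closed m).1 mulr_sumr; apply: eq_bigr => i _ /=.
by rewrite exprS; ring.
Qed.
End Fibonacci.

(** * The Bullett-Macdonald identities *)

Section BullettMacdonald.

(* The coefficient of [Sq^(n-i) Sq^i] in
   [P(1+t) P(t^2) - P(t+t^2) P(1)], where [P(z) = sum_k z^k Sq^k]. *)
Definition bmpoly (n i : nat) : {poly 'F_2} :=
  ('X + 'X^2) ^+ (n - i) + 'X^(2 * i) * (1 + 'X) ^+ (n - i).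

Lemma poly2 : 2%:R = 0 :> {poly 'F_2}.
Proof. by rewrite -polyC_natr (_ : 2%:R = 0) ?polyC0 //; apply/eqP. Qed.

(** The inadmissible Sq^(n-i) Sq^i are those with n < 3i. If each of them is replaced by its Adem
    expansion in the sum of the [bmpoly n i] Sq^(n-i) Sq^i, the left-hand side is the resulting
    coefficient of the admissible Sq^(n-j) Sq^j. *)
Lemma bmpoly_adem n j : (3 * j <= n)%N ->
  bmpoly n j + \sum_(0 <= i < n.+1 | (n < 3 * i)%N && (2 * j <= n - i)%N)
    'C(i - 1 - j, n - i - 2 * j)%:R * bmpoly n i = 0.
Proof.
move=> jn; pose m := (n - 3 * j)%N; pose w : {poly 'F_2} := 'X + 'X^2.
have wE k l : (k = 2 * j + l)%N -> w ^+ k = w ^+ (2 * j) * w ^+ l.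
  by move=> ->; rewrite exprD.
have wX : 'X ^+ (2 * j) * (1 + 'X) ^+ (2 * j) = w ^+ (2 * j).
  by rewrite -exprMn; congr (_ ^+ _); rewrite /w; ring.
have bmE i : (i <= m)%N ->
  bmpoly n (j + i) =
    w ^+ (2 * j) * (w ^+ (m - i) + (1 + 'X) ^+ (m - i) * ('X^2) ^+ i).
  move=> im; rewrite /bmpoly -/w (wE _ (m - i)%N); last lia.
  rewrite (_ : (n - (j + i) = 2 * j + (m - i))%N); last lia.
  rewrite mulnDr (exprD _ (2 * j) (2 * i)) (exprD _ (2 * j) (m - i)) -wX -exprM.
  set a := 'X^(2 * j); set b := _ ^+ (2 * j); set c := _ ^+ (m - i); ring.
have j0 := bmE 0%N (leq0n _); rewrite addn0 in j0.
rewrite {1}j0 subn0 expr0 mulr1.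
(* Both conditions confine the index to j < i <= j + m. Conversely, an index in this range with 3i
   <= n has a binomial coefficient equal to 0. *)
have -> : \sum_(0 <= i < n.+1 | (n < 3 * i)%N && (2 * j <= n - i)%N)
    'C(i - 1 - j, n - i - 2 * j)%:R * bmpoly n i =
  \sum_(i < m) 'C(i, m.-1 - i)%:R * bmpoly n (j + i.+1).
  rewrite big_mkcond (big_cat_nat (n := j.+1)) //=; last lia.
  rewrite big_nat big1 ?add0r => [|i ij]; last first.
    by case: ifP => // /andP[]; lia.
  rewrite (big_cat_nat (n := (j + m).+1)) //=; try lia.
  rewrite [X in _ + X]big_nat [X in _ + X]big1 ?addr0 => [|i ij]; last first.
    by case: ifP => // /andP[]; lia.
  rewrite -{1}[j.+1]add0n big_addn (_ : ((j + m).+1 - j.+1 = m)%N); last lia.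
  rewrite big_mkord; apply: eq_bigr => i _.
  rewrite (_ : (i + j.+1 - 1 - j = i)%N); last lia.
  rewrite (_ : (n - (i + j.+1) - 2 * j = m.-1 - i)%N); last lia.
  rewrite (_ : (i + j.+1 = j + i.+1)%N); last lia.
  case: ifP => // cF; rewrite bin_small ?mul0r //.
  by have := ltn_ord i; move: cF; lia.
under eq_bigr => i _ do rewrite bmE //.
have -> : \sum_(i < m) 'C(i, m.-1 - i)%:R * (w ^+ (2 * j) * (w ^+ (m - i.+1) +
    (1 + 'X) ^+ (m - i.+1) * 'X^2 ^+ i.+1)) = w ^+ (2 * j) *
    (\sum_(i < m) 'C(i, m.-1 - i)%:R * (w ^+ (m.-1 - i) * 1 ^+ i.+1) +
     \sum_(i < m) 'C(i, m.-1 - i)%:R * ((1 + 'X) ^+ (m.-1 - i) * 'X^2 ^+ i.+1)).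
  rewrite -big_split mulr_sumr; apply: eq_bigr => i _ /=.
  by rewrite (_ : (m - i.+1 = m.-1 - i)%N) ?expr1n; [ring | lia].
(* The two sums equal X^m + (1+X)^m and X^m + w^m; together with w^m + (1+X)^m, coming from the
   index j, everything occurs twice. *)
rewrite (@fibonacci_sum _ w 1 'X (1 + 'X)) ?poly2 //; last 2 first.
- by rewrite addrCA -mulr2n -mulr_natl poly2 mul0r addr0.
- by rewrite /w; ring.
rewrite (@fibonacci_sum _ (1 + 'X) ('X^2) 'X w) ?poly2 //; last 2 first.
- by rewrite /w addrA -mulr2n -mulr_natl poly2 mul0r add0r.
- by rewrite /w; ring.
have -> : forall a b c d : {poly 'F_2}, a * (b + c) + a * (d + c + (d + b)) =
  2%:R * (a * (b + c + d)) by move=> *; ring.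
by rewrite poly2 mul0r.
Qed.

(** The two summands of [bmpoly n i] have orders n - i and 2i, and n - i < 2i. The inadmissible ones
    thus have distinct orders, and this triangularity recovers the Adem relations from the
    Bullett-Macdonald identities. *)
Lemma bmpoly_order n i k : (n < 3 * i)%N -> (k <= n - i)%N ->
  (bmpoly n i)`_k = (k == n - i)%N%:R.
Proof.
move=> ni ki; rewrite /bmpoly coefD coefXnM ifT ?addr0; last lia.
rewrite (_ : 'X + 'X^2 = 'X * (1 + 'X)); last ring.
rewrite exprMn coefXnM; case: ltngtP ki => // -> _.
by rewrite subnn -horner_coef0 horner_exp !hornerE expr1n.
Qed.

Variables (V : lmodType 'F_2) (n : nat) (e : nat -> V).

(** For e i = Sq^(n-i) Sq^i, the failure of the Adem relation for this composite. *)
Definition adem_defect i : V :=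
  e i + \sum_(j < (n - i)./2.+1) 'C(i - 1 - j, n - i - 2 * j)%:R *: e j.

(** By [bmpoly_adem], the admissible part of the left-hand side is what the Adem sums inside the
    defects contribute. *)
Lemma bm_defect k :
  \sum_(i < n.+1) (bmpoly n i)`_k *: e i =
  \sum_(i < n.+1 | (n < 3 * i)%N) (bmpoly n i)`_k *: adem_defect i.
Proof.
under [RHS]eq_bigr => i _ do rewrite scalerDr.
rewrite big_split /= (bigID (fun i : 'I_n.+1 => (n < 3 * i)%N)) /=.
congr (_ + _).
transitivity (\sum_(0 <= j < n.+1 | (3 * j <= n)%N)
  (\sum_(0 <= i < n.+1 | (n < 3 * i)%N && (2 * j <= n - i)%N)
    ('C(i - 1 - j, n - i - 2 * j)%:R * (bmpoly n i)`_k : 'F_2)) *: e j).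
  rewrite big_mkord; apply: eq_big => [j|j]; first by rewrite -leqNgt.
  rewrite -leqNgt => /bmpoly_adem/(congr1 (fun p : {poly 'F_2} => p`_k)).
  rewrite coefD coef_sum coef0 => /eqP.
  rewrite addF2_eq0 => /eqP ->; congr (_ *: _).
  by apply: eq_bigr => i _; rewrite mulr_natl coefMn mulr_natl.
under [LHS]eq_bigr => j _ do rewrite scaler_suml.
rewrite (exchange_big_dep (fun i => (n < 3 * i)%N)) /=; last first.
  by move=> j i _ /andP[].
rewrite big_mkord; apply: eq_bigr => i ni.
rewrite scaler_sumr -(big_mkord xpredT (fun j => (bmpoly n i)`_k *:
  ('C(i - 1 - j, n - i - 2 * j)%:R *: e j))) /=.
rewrite [RHS](big_nat_widen _ _ n.+1); last by have := ltn_ord i; lia.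
rewrite [LHS]big_mkcond [RHS]big_mkcond /=.
apply: eq_big_nat => j jn; do 2! case: ifP => //; try lia.
by move=> _ _; rewrite mulrC scalerA.
Qed.

Lemma bm_of_adem : (forall i, (i <= n < 3 * i)%N -> adem_defect i = 0) ->
  forall k, \sum_(i < n.+1) (bmpoly n i)`_k *: e i = 0.
Proof.
move=> ad k; rewrite bm_defect big1 // => i ni.
by rewrite ad ?scaler0 // -ltnS ltn_ord.
Qed.

Lemma adem_of_bm : (forall k, \sum_(i < n.+1) (bmpoly n i)`_k *: e i = 0) ->
  forall i, (i <= n < 3 * i)%N -> adem_defect i = 0.
Proof.
(* Induction on n - i, reading the coefficient of z^(n-i): defects of larger index vanish by
   induction, and those of smaller index h only enter from z^(n-h) on. *)
move=> bm i; have [a] := ubnP (n - i)%N; elim: a i => // a IH i nia /andP[lin ni].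
have := bm (n - i)%N; rewrite bm_defect.
rewrite (bigD1 (Ordinal (lin : (i < n.+1)%N))) //= bmpoly_order // eqxx scale1r.
rewrite big1 ?addr0 // => h /andP[nh hi].
have hn : (h <= n)%N by rewrite -ltnS.
have {}hi : (h != i :> nat) by apply: contraNneq hi => hi; apply/eqP/val_inj.
have [ltih|leih] := ltnP i h.
  by rewrite IH ?scaler0 ?nh ?hn //; lia.
rewrite bmpoly_order //; last by lia.
suff -> : (n - i == n - h)%N = false by rewrite scale0r.
by apply/eqP; move/eqP: hi; lia.
Qed.

End BullettMacdonald.

Lemma big_ord_trim (V : nmodType) (m N : nat) (F : nat -> V) : (m <= N)%N ->
  (forall i, (m <= i < N)%N -> F i = 0) -> \sum_(i < N) F i = \sum_(i < m) F i.
Proof.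
move=> mN F0; rewrite -!(big_mkord xpredT) (big_cat_nat (n := m)) //=.
by rewrite [X in _ + X]big_nat [X in _ + X]big1 ?addr0.
Qed.

(** * Graded spaces as products of their degrees *)

Definition Tot (V : gvs) : Type := forall n : int, V n.

Section Tot.
Variable V : gvs.
Implicit Types x y : Tot V.

Lemma totP x y : (forall n, x n = y n) -> x = y.
Proof. exact: functional_extensionality_dep. Qed.

HB.instance Definition _ := gen_eqMixin (Tot V).
HB.instance Definition _ := gen_choiceMixin (Tot V).

Definition tot_zero : Tot V := fun n => 0.
Definition tot_opp x : Tot V := fun n => - x n.
Definition tot_add x y : Tot V := fun n => x n + y n.
Definition tot_scale (a : 'F_2) x : Tot V := fun n => a *: x n.

Fact tot_addA : associative tot_add.
Proof. by move=> x y z; apply: totP => n; rewrite /tot_add addrA. Qed.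
Fact tot_addC : commutative tot_add.
Proof. by move=> x y; apply: totP => n; rewrite /tot_add addrC. Qed.
Fact tot_add0 : left_id tot_zero tot_add.
Proof. by move=> x; apply: totP => n; rewrite /tot_add add0r. Qed.
Fact tot_addN : left_inverse tot_zero tot_opp tot_add.
Proof. by move=> x; apply: totP => n; rewrite /tot_add addNr. Qed.
HB.instance Definition _ :=
  GRing.isZmodule.Build (Tot V) tot_addA tot_addC tot_add0 tot_addN.

Fact tot_scaleA a b x : tot_scale a (tot_scale b x) = tot_scale (a * b) x.
Proof. by apply: totP => n; rewrite /tot_scale scalerA. Qed.
Fact tot_scale1 : left_id 1 tot_scale.
Proof. by move=> x; apply: totP => n; rewrite /tot_scale scale1r. Qed.
Fact tot_scaleDr : right_distributive tot_scale +%R.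
Proof. by move=> a x y; apply: totP => n; rewrite /tot_scale scalerDr. Qed.
Fact tot_scaleDl x : {morph tot_scale^~ x : a b / a + b}.
Proof. by move=> a b; apply: totP => n; rewrite /tot_scale scalerDl. Qed.
HB.instance Definition _ := GRing.Zmodule_isLmodule.Build 'F_2 (Tot V)
  tot_scaleA tot_scale1 tot_scaleDr tot_scaleDl.

Lemma totD x y n : (x + y) n = x n + y n. Proof. by []. Qed.
Lemma totZ (a : 'F_2) x n : (a *: x) n = a *: x n. Proof. by []. Qed.

Lemma tot_sum (I : Type) (r : seq I) (P : pred I) (F : I -> Tot V) n :
  (\sum_(i <- r | P i) F i) n = \sum_(i <- r | P i) F i n.
Proof.
by elim/big_rec2: _ => //= i y x _ <-; rewrite totD.
Qed.
End Tot.

(** * Series with Steenrod operations *)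

(* Degrees are forgotten, which removes the casts of the graded setting: a graded
   module becomes the product of all its degrees. *)
Record sqspace := SqSpace {
  sqcar :> lmodType 'F_2;
  sq : int -> {linear sqcar -> sqcar};
  sq_lt0 : forall i x, i < 0 -> sq i x = 0;
  sq_0 : forall x, sq 0 x = x
}.
Arguments sq {s}.

(* Formal sums [sum_a u^a (x) x_a], over all integers [a] and without any
   finiteness condition; the Cartan formula still makes sense. *)
Section Series.
Variable X : sqspace.

Definition ser_car : lmodType 'F_2 := Tot (fun _ : int => sqcar X).

Definition ser_sq_fun (k : int) (c : ser_car) : ser_car :=
  fun a => \sum_(i < `|k|.+1) bz (a - i%:Z) i *: sq (k - i%:Z) (c (a - i%:Z)).

Fact ser_sq_linear k : linear (ser_sq_fun k).
Proof.
move=> a x y; apply: totP => n; rewrite totD totZ /ser_sq_fun.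
rewrite scaler_sumr -big_split; apply: eq_bigr => i _ /=.
by rewrite totD totZ linearP scalerDr !scalerA mulrC.
Qed.
HB.instance Definition _ k := GRing.isLinear.Build 'F_2 ser_car ser_car *:%R
  (ser_sq_fun k) (ser_sq_linear k).
Definition ser_sq k : {linear ser_car -> ser_car} := ser_sq_fun k.

Fact ser_sq_lt0 i c : i < 0 -> ser_sq i c = 0.
Proof.
move=> i0; apply: totP => a; apply: big1 => j _.
by rewrite sq_lt0 ?scaler0 //; lia.
Qed.

Fact ser_sq_0 c : ser_sq 0 c = c.
Proof.
apply: totP => a; rewrite /ser_sq /= /ser_sq_fun big_ord_recl big_ord0 addr0.
by rewrite !subr0 (bz_n0 a) scale1r sq_0.
Qed.

Definition ser : sqspace := SqSpace ser_sq_lt0 ser_sq_0.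

Definition ser_at (c : ser) (a : int) : X := c a.

Lemma serP (c d : ser) : (forall a, ser_at c a = ser_at d a) -> c = d.
Proof. exact: totP. Qed.

Lemma ser_atD (c d : ser) a : ser_at (c + d) a = ser_at c a + ser_at d a.
Proof. by []. Qed.
Lemma ser_atZ (k : 'F_2) (c : ser) a : ser_at (k *: c) a = k *: ser_at c a.
Proof. by []. Qed.
Lemma ser_at_sum (I : Type) (r : seq I) (P : pred I) (F : I -> ser) a :
  ser_at (\sum_(i <- r | P i) F i) a = \sum_(i <- r | P i) ser_at (F i) a.
Proof. exact: tot_sum. Qed.

(** The terms with i > k contain an operation of negative index. The free bound N serves to bring
    several Cartan sums to a common range. *)
Lemma sq_serE (k : int) (c : ser) a (N : nat) : k < N%:Z ->
  ser_at (sq k c) a =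
  \sum_(i < N) bz (a - i%:Z) i *: sq (k - i%:Z) (ser_at c (a - i%:Z)).
Proof.
move=> kN; rewrite /ser_at /= /ser_sq_fun.
pose F (i : nat) := bz (a - i%:Z) i *: sq (k - i%:Z) (c (a - i%:Z)).
have F0 i : k < i%:Z -> F i = 0.
  by move=> ki; rewrite /F sq_lt0 ?scaler0 //; lia.
have [le|le] := leqP N `|k|.+1.
  by rewrite (big_ord_trim (F := F) le) // => i iN; apply: F0; lia.
by rewrite -(big_ord_trim (F := F) (ltnW le)) // => i iN; apply: F0; lia.
Qed.

Opaque ser.

Definition shift (a : int) (c : ser) : ser := fun i => ser_at c (i - a).
Fact shift_linear a : linear (shift a).
Proof. by []. Qed.
HB.instance Definition _ a :=
  GRing.isLinear.Build 'F_2 ser ser *:%R (shift a) (shift_linear a).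

Lemma shiftE a c i : ser_at (shift a c) i = ser_at c (i - a).
Proof. by []. Qed.

Lemma shift_shift a b c : shift a (shift b c) = shift (a + b) c.
Proof. by apply: serP => i; rewrite !shiftE; congr ser_at; ring. Qed.

Lemma shift0 c : shift 0 c = c.
Proof. by apply: serP => i; rewrite shiftE subr0. Qed.

Lemma shift_inj a : injective (shift a).
Proof.
move=> c d /(congr1 (shift (- a))).
by rewrite !shift_shift addNr !shift0.
Qed.

Lemma sq_shift1 k c : sq k (shift 1 c) = shift 1 (sq k c) + shift 2 (sq (k - 1) c).
Proof.
apply: serP => a; rewrite ser_atD !shiftE.
rewrite (@sq_serE k _ a `|k|.+2) ?(@sq_serE k _ (a - 1) `|k|.+2); try lia.
rewrite (@sq_serE (k - 1) _ _ `|k|.+1); try lia.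
under eq_bigr => i _ do rewrite shiftE bz_pascal_pred scalerDl.
rewrite big_split /=; congr (_ + _).
  by apply: eq_bigr => i _; congr (bz _ _ *: sq _ (ser_at _ _)); lia.
rewrite big_ord_recl bz_lt0 // scale0r add0r; apply: eq_bigr => i _.
by rewrite lift0; congr (bz _ _ *: sq _ (ser_at _ _)); lia.
Qed.

Lemma sq_shift2 k c : sq k (shift 2 c) = shift 2 (sq k c) + shift 4 (sq (k - 2) c).
Proof.
rewrite -[in LHS](shift_shift 1 1) sq_shift1 !sq_shift1 !linearD /= !shift_shift.
rewrite -[LHS]addrA; congr (_ + _).
rewrite [LHS]addrA (_ : (2 : int) + 1 = 1 + 2) // addv2 add0r.
by congr (shift _ (sq _ _)); ring.
Qed.

Definition delta (y : X) : ser := fun i => if i == 0 then y else 0.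
Fact delta_linear : linear delta.
Proof.
move=> k x y; apply: serP => i.
rewrite ser_atD ser_atZ /ser_at /delta; case: eqP => // _.
by rewrite scaler0 addr0.
Qed.
HB.instance Definition _ :=
  GRing.isLinear.Build 'F_2 X ser *:%R delta delta_linear.

Lemma deltaE y i : ser_at (delta y) i = if i == 0 then y else 0.
Proof. by []. Qed.

Lemma sq_delta k y : sq k (delta y) = delta (sq k y).
Proof.
apply: serP => a; rewrite deltaE.
rewrite (@sq_serE _ _ _ `|k|.+1); last lia.
rewrite big_ord_recl deltaE !subr0 bz_n0 scale1r big1 => [|i _]; last first.
  rewrite deltaE; case: eqP => [->|_]; last by rewrite linear0 scaler0.
  by rewrite bz_0n scale0r.
by rewrite addr0; case: eqP => // _; rewrite linear0.
Qed.

(** Locality of the operations: although series are infinite, identities at one exponent can be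
    checked on finite sums of monomials. *)
Lemma eq_sq_ser k (c d : ser) (a : int) :
  (forall i : nat, i%:Z <= k -> ser_at c (a - i%:Z) = ser_at d (a - i%:Z)) ->
  ser_at (sq k c) a = ser_at (sq k d) a.
Proof.
move=> cd; rewrite !(@sq_serE _ _ _ `|k|.+1); try lia.
apply: eq_bigr => i _; have [ki|ki] := ltP k i; first by rewrite !sq_lt0 //; lia.
by rewrite cd.
Qed.
End Series.
Arguments shift {X}.
Arguments delta {X}.
Arguments shift_inj {X}.
Opaque ser.
Arguments ser_at {X}.

(** * The Bullett-Macdonald identities for series *)

Section BM.
Variable X : sqspace.

(** An integer n lets inductions pass freely to n - 1 and n - 3. For n < 0 all terms vanish, so that
    the absolute value does no harm. *)
Definition bmsum (n : int) (c : X) (N : nat) (k : nat) : X :=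
  \sum_(i < N) (bmpoly `|n| i)`_k *: sq (n - i%:Z) (sq i c).

Definition bullett_macdonald : Prop :=
  forall (n k : nat) (c : X), bmsum n c n.+1 k = 0.

Lemma bmsum_trim n c N M k : n < N%:Z -> (N <= M)%N -> bmsum n c M k = bmsum n c N k.
Proof.
move=> nN NM; rewrite /bmsum.
rewrite (big_ord_trim (F := fun i => (bmpoly `|n| i)`_k *: sq (n - i%:Z) (sq i c)) NM) //.
by move=> i iN; rewrite sq_lt0 ?scaler0 //; lia.
Qed.

Definition bm_at (c : X) : Prop :=
  forall (n : int) (N k : nat), n < N%:Z -> bmsum n c N k = 0.

Lemma bmsum_neg (n : int) c N k : n < 0 -> bmsum n c N k = 0.
Proof.
by move=> n0; apply: big1 => i _; rewrite sq_lt0 ?scaler0 //; lia.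
Qed.

Lemma bmP : bullett_macdonald <-> forall c, bm_at c.
Proof.
split=> [bm c n N k nN|bm n k c]; last by apply: bm; lia.
case: n nN => [n|n] nN; last by rewrite bmsum_neg.
by rewrite (@bmsum_trim n c n.+1) ?bm //; lia.
Qed.
End BM.

Lemma coef_family_mul (V : lmodType 'F_2) (N : nat) (q : {poly 'F_2})
    (p : nat -> {poly 'F_2}) (e : nat -> V) :
  (forall k, \sum_(i < N) (p i)`_k *: e i = 0) ->
  forall k, \sum_(i < N) (q * p i)`_k *: e i = 0.
Proof.
move=> pe k; under eq_bigr => i _ do rewrite coefM scaler_suml.
rewrite exchange_big big1 // => j _ /=.
under eq_bigr => i _ do rewrite -scalerA.
by rewrite -scaler_sumr pe scaler0.
Qed.

Section BMSeries.
Variable X : sqspace.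
Implicit Type c : ser X.

(* [P(s^2+st)P(t^2)] and [P(t^2+st)P(s^2)] both send [u c] to
   [u + (s^2+st+t^2)u^2 + s^2t^2(s+t)^2u^4] times what they send [c] to. *)
Lemma bmsum_shift c (n : int) (N k : nat) : n < N%:Z ->
  (forall M l, n <= M%:Z -> bmsum (n - 1) c M l = 0) ->
  (forall M l, n <= M%:Z -> bmsum (n - 3) c M l = 0) ->
  bmsum n (shift 1 c) N.+1 k = shift 1 (bmsum n c N.+1 k).
Proof.
move=> nN bm1 bm3; rewrite /bmsum.
under eq_bigr => i _.
  rewrite sq_shift1 linearD /= sq_shift1 sq_shift2 !scalerDr -addrA.
  over.
rewrite big_split /= linear_sum /=.
under [X in _ = X]eq_bigr => i _ do rewrite linearZ.
rewrite -[RHS]addr0; congr (_ + _); rewrite big_split /= big_split /= addrA.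
set e1 := fun i : nat => sq (n - 1 - i%:Z) (sq i c).
set e3 := fun i : nat => sq (n - 3 - i%:Z) (sq i c).
(* The multipliers in [q1] and [q3] are s^2 + st + t^2 and s^2 t^2 (s+t)^2 at s = 1, t = X; having
   degrees 2 and 6 in s and t, they go with the identities for n - 1 and n - 3. *)
have q1 l : \sum_(i < N) ((1 + 'X + 'X^2) * bmpoly `|n - 1| i)`_l *: e1 i = 0.
  apply: (@coef_family_mul _ _ _ (bmpoly `|n - 1|)) => {}l.
  by apply: bm1; lia.
have q3 l : \sum_(i < N) (('X + 'X^2) ^+ 2 * bmpoly `|n - 3| i)`_l *: e3 i = 0.
  apply: (@coef_family_mul _ _ _ (bmpoly `|n - 3|)) => {}l.
  by apply: bm3; lia.
rewrite [X in _ + X](_ : _ = 0) ?addr0; last first.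
  rewrite big_ord_recl (sq_lt0 (i := 0%N%:Z - 1)) // !linear0 add0r.
  transitivity (shift 4 (\sum_(i < N)
    (('X + 'X^2) ^+ 2 * bmpoly `|n - 3| i)`_k *: e3 i)); last by rewrite q3 linear0.
  rewrite linear_sum; apply: eq_bigr => i _ /=; rewrite linearZ /= /bump /= /e3.
  rewrite (_ : (1 + i)%N%:Z - 1 = i%:Z); last lia.
  rewrite (_ : n - (1 + i)%N%:Z - 2 = n - 3 - i%:Z); last lia.
  have [lt0|ge0] := ltP (n - 3 - i%:Z) 0; first by rewrite sq_lt0 // !linear0 ?scaler0.
  congr ((polyseq _)`_k *: _); rewrite /bmpoly.
  rewrite (_ : (`|n| - (1 + i) = (`|n - 3| - i) + 2)%N); last lia.
  rewrite (_ : (2 * (1 + i) = 2 * i + 2)%N); last lia.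
  move: (`|n - 3| - i)%N (2 * i)%N => p q; rewrite !exprD.
  by set a := _ ^+ p; set b := 'X ^+ q; set d := _ ^+ p; ring.
rewrite big_ord_recr /=.
rewrite (sq_lt0 (i := n - N%:Z - 1)); last lia.
rewrite !linear0 addr0.
rewrite big_ord_recl (sq_lt0 (i := 0%N%:Z - 1)) // !linear0 add0r.
rewrite -big_split /=.
transitivity (shift 2 (\sum_(i < N)
    ((1 + 'X + 'X^2) * bmpoly `|n - 1| i)`_k *: e1 i)); last by rewrite q1 linear0.
rewrite linear_sum; apply: eq_bigr => i _ /=; rewrite linearZ /= /bump /= /e1.
rewrite (_ : (1 + i)%N%:Z - 1 = i%:Z); last lia.
rewrite (_ : n - (1 + i)%N%:Z = n - 1 - i%:Z); last lia.
rewrite (_ : n - i%:Z - 1 = n - 1 - i%:Z); last lia.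
have [lt0|ge0] := ltP (n - 1 - i%:Z) 0; first by rewrite sq_lt0 // !linear0 ?scaler0 addr0.
rewrite -scalerDl -coefD; congr ((polyseq _)`_k *: _); rewrite /bmpoly.
rewrite (_ : (`|n| - (1 + i) = `|n - 1| - i)%N); last lia.
rewrite (_ : (`|n| - i = (`|n - 1| - i) + 1)%N); last lia.
rewrite (_ : (2 * (1 + i) = 2 * i + 2)%N); last lia.
move: (`|n - 1| - i)%N (2 * i)%N => p q; rewrite !exprD.
by set a := _ ^+ p; set b := 'X ^+ q; set d := _ ^+ p; ring.
Qed.

Lemma bm_at_shift c : bm_at c -> bm_at (shift 1 c).
Proof.
move=> bm n N k nN; rewrite -(@bmsum_trim _ n _ N N.+1) // bmsum_shift //.
- by rewrite bm ?linear0 //; lia.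
- by move=> M l nM; apply: bm; lia.
- by move=> M l nM; apply: bm; lia.
Qed.

(** Division by u, which gives access to negative powers: the identities for n - 1 and n - 3 come
    from an induction on n, and multiplication by u is injective. *)
Lemma bm_at_unshift c : bm_at (shift 1 c) -> bm_at c.
Proof.
move=> bm n; have [m] := ubnP `|n|; elim: m n => // m IH n nm N k nN.
have IH' (h : int) : 0 < h -> forall M l, n - h < M%:Z -> bmsum (n - h) c M l = 0.
  move=> h0 M l nM; have [n0|n0] := ltP (n - h) 0; first exact: bmsum_neg.
  by apply: IH => //; lia.
apply: (@shift_inj _ 1); rewrite linear0 -(@bmsum_trim _ n _ N N.+1) //.
rewrite -bmsum_shift // => [|M l nM|M l nM]; last 2 first.
- by apply: IH' => //; lia.
- by apply: IH' => //; lia.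
by apply: bm; lia.
Qed.

Lemma bm_at_monomial (y : X) (a : int) : bm_at y -> bm_at (shift a (delta y)).
Proof.
move=> bm; elim/int_ind: a => [|a|a].
- rewrite shift0 => n N k nN; rewrite /bmsum.
  under eq_bigr => i _ do rewrite !sq_delta -linearZ.
  by rewrite -linear_sum -/(bmsum _ _ _ _) bm ?linear0.
- by move/bm_at_shift; rewrite shift_shift; congr bm_at; congr (shift _ _); lia.
- move=> bma; apply: bm_at_unshift; rewrite shift_shift.
  by rewrite (_ : 1 - a.+1%:Z = - a%:Z); [exact: bma | lia].
Qed.

Lemma eq_bmsum (n : int) N k (c d : ser X) (a : int) :
  (forall i : nat, i%:Z <= n -> ser_at c (a - i%:Z) = ser_at d (a - i%:Z)) ->
  ser_at (bmsum n c N k) a = ser_at (bmsum n d N k) a.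
Proof.
move=> cd; rewrite /bmsum !ser_at_sum; apply: eq_bigr => i _.
rewrite !ser_atZ; congr (_ *: _); apply: eq_sq_ser => j jn.
apply: eq_sq_ser => h hi.
by rewrite (_ : a - j%:Z - h%:Z = a - (j + h)%N%:Z) ?cd //; lia.
Qed.

Lemma bm_ser : bullett_macdonald X -> bullett_macdonald (ser X).
Proof.
move=> /bmP bm; apply/bmP => c n N k nN; apply: serP => a.
(* The finitely many monomials of [c] that operations of total degree n can carry to u^a. *)
pose d := \sum_(h < `|n|.+1) shift (a - h%:Z) (delta (ser_at c (a - h%:Z))).
rewrite (@eq_bmsum _ _ _ _ d); last first.
  move=> i lin; rewrite /d ser_at_sum.
  have ltin : (i < `|n|.+1)%N by lia.
  rewrite (bigD1 (Ordinal ltin)) //= shiftE deltaE subrr eqxx big1 ?addr0 //.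
  move=> j /eqP ji; rewrite shiftE deltaE ifF //; apply/eqP => eqji.
  by apply: ji; apply: val_inj => /=; lia.
rewrite /bmsum /d.
under eq_bigr => i _ do rewrite !linear_sum ?scaler_sumr /=.
rewrite exchange_big /= (@big1 _ _ _ _ _ xpredT) // => h _.
exact: (@bm_at_monomial _ (a - h%:Z) (bm _) n N k nN).
Qed.
End BMSeries.

(** Pascal's rule determines row e + 1 from row e, and also row e from row e + 1 by induction on k.
    An identity between binomial sums with arbitrary integer e is thus reduced to one convenient
    e. *)
Lemma pascal_vanish (V : zmodType) (G : int -> int -> V) (e0 : int) :
  (forall e k, G (e + 1) k = G e k + G e (k - 1)) ->
  (forall e k, k < 0 -> G e k = 0) -> (forall k, G e0 k = 0) ->
  forall e k, G e k = 0.
Proof.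
move=> Gp Gneg G0.
have up e : (forall k, G e k = 0) -> forall k, G (e + 1) k = 0.
  by move=> Ge k; rewrite Gp !Ge addr0.
have down e : (forall k, G (e + 1) k = 0) -> forall k, G e k = 0.
  move=> Ge k; have [m] := ubnP `|k|; elim: m k => // m IH k km.
  have [k0|k0] := ltP k 0; first exact: Gneg.
  have := Ge k; rewrite Gp (_ : G e (k - 1) = 0) ?addr0 //.
  have [k1|k1] := ltP (k - 1) 0; first exact: Gneg.
  by apply: IH; lia.
move=> e; rewrite (_ : e = e0 + (e - e0)); last ring.
elim/int_ind: (e - e0) => [|a|a] Ga; first by rewrite addr0.
  by rewrite (_ : e0 + a.+1 = e0 + a%:Z + 1); [exact: up | lia].
by apply: down; rewrite (_ : _ + 1 = e0 - a%:Z) //; lia.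
Qed.

(** * Steenrod operations on St_1 *)

Section SteenrodTotal.
Variable X : sqspace.

(* [u^e sum_i u^(-i) (x) Sq^i y], which is [St_1 y] when [y] has degree [e]. *)
Definition st1 (e : int) (y : X) : ser X := fun a => sq (e - a) y.
Fact st1_linear e : linear (st1 e).
Proof. by move=> k x y; apply: serP => a; rewrite /ser_at /st1 linearP. Qed.
HB.instance Definition _ e :=
  GRing.isLinear.Build 'F_2 X (ser X) *:%R (st1 e) (st1_linear e).

Lemma st1E e y a : ser_at (st1 e y) a = sq (e - a) y.
Proof. by []. Qed.

Hypothesis bm : bullett_macdonald X.

(** Both sides obey Pascal's rule in e and k. For e = n they are the two halves of the
    Bullett-Macdonald identity, C(b, k-b) and C(n-j, k-2j) being the coefficients of z^k in
    (z+z^2)^b and z^(2j) (1+z)^(n-j). *)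
Lemma bm_binomial (n e k : int) (N : nat) (y : X) : n < N%:Z ->
  \sum_(b < N) bz (e - n + b%:Z) (k - b%:Z) *: sq b (sq (n - b%:Z) y) =
  \sum_(j < N) bz (e - j%:Z) (k - 2 * j%:Z) *: sq (n - j%:Z) (sq j y).
Proof.
move=> nN; apply/eqP; rewrite -subr_eq0; apply/eqP.
move: e k; apply: (@pascal_vanish _ _ n) => [e k|e k k0|k].
- rewrite [RHS]addrACA -opprD -!big_split /=.
  congr (_ - _); apply: eq_bigr => i _; rewrite -scalerDl; congr (_ *: _).
  + by rewrite (_ : e + 1 - n + i%:Z = e - n + i%:Z + 1) ?bz_pascal;
      [congr (_ + bz _ _) | ]; lia.
  + by rewrite (_ : e + 1 - i%:Z = e - i%:Z + 1) ?bz_pascal;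
      [congr (_ + bz _ _) | ]; lia.
- by rewrite !big1 ?subr0 // => i _; rewrite bz_lt0 ?scale0r //; lia.
- case: k => [k|k]; last first.
    by rewrite !big1 ?subr0 // => i _; rewrite bz_lt0 ?scale0r //; lia.
  have [n0|] := ltP n 0.
    have sqn0 (i : nat) x : sq (n - i%:Z) x = 0 :> X by rewrite sq_lt0 //; lia.
    by rewrite !big1 ?subr0 // => i _; rewrite sqn0 ?linear0 ?scaler0.
  case: n nN => [n|//] nN _.
  rewrite oppv; have nN' : (n.+1 <= N)%N by lia.
  pose F (b : nat) := bz (n%:Z - n%:Z + b%:Z) (k%:Z - b%:Z) *: sq b (sq (n%:Z - b%:Z) y).
  pose H (j : nat) := bz (n%:Z - j%:Z) (k%:Z - 2 * j%:Z) *: sq (n%:Z - j%:Z) (sq j y).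
  rewrite (big_ord_trim (F := F) nN'); last first.
    by move=> i ni; rewrite /F (sq_lt0 (i := _ - _)) ?linear0 ?scaler0 //; lia.
  rewrite (big_ord_trim (F := H) nN'); last first.
    by move=> i ni; rewrite /H (sq_lt0 (i := _ - _)) ?scaler0 //; lia.
  rewrite (reindex_inj rev_ord_inj) -big_split /= -[RHS](bm n k y).
  apply: eq_bigr => i _; rewrite /F /H subSS.
  have lin : (i <= n)%N by rewrite -ltnS.
  rewrite (_ : n%:Z - (n - i)%N%:Z = i%:Z); last lia.
  rewrite (_ : (n - i)%N%:Z = n%:Z - i%:Z); last lia.
  rewrite -scalerDl; congr (_ *: _).
  rewrite subrr add0r /bmpoly coefD /=.
  rewrite (_ : n%:Z - i%:Z = (n - i)%N%:Z); last lia.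
  rewrite (_ : 'X + 'X^2 = 'X * (1 + 'X)); last ring.
  have co m l : ((1 + 'X : {poly 'F_2}) ^+ m)`_l = 'C(m, l)%:R.
    have [lm|lm] := leqP l m; last first.
      rewrite bin_small // nth_default //.
      apply: leq_trans lm; rewrite -[X in (_ <= X.+1)%N]mul1n.
      by apply: leq_trans (size_poly_exp_leq _ _) _; rewrite addrC size_XaddC.
    rewrite exprDn coef_sum (bigD1 (Ordinal (lm : (l < m.+1)%N))) //=.
    rewrite expr1n mul1r coefMn coefXn eqxx big1 ?addr0 // => j jl.
    rewrite expr1n mul1r coefMn coefXn.
    by rewrite (_ : (l == j :> nat) = false) ?mul0rn // eq_sym; exact: negbTE.
  rewrite exprMn !coefXnM !co; congr (_ + _).
    case: ltnP => kni; first by rewrite bz_lt0 //; lia.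
    by rewrite (_ : k%:Z - (n - i)%N%:Z = (k - (n - i))%N) //; lia.
  case: ltnP => ki; first by rewrite bz_lt0 //; lia.
  by rewrite (_ : k%:Z - 2 * i%:Z = (k - 2 * i)%N) //; lia.
Qed.

(** At u^a every term is a composite of two operations on y of total degree n = e - a + k, and the
    equality of the coefficients is [bm_binomial]. *)
Lemma sq_st1 (k e : int) (N : nat) (y : X) : k < N%:Z ->
  sq k (st1 e y) =
  \sum_(j < N) bz (e - j%:Z) (k - 2 * j%:Z) *:
    shift (k - 2 * j%:Z) (st1 (e + j%:Z) (sq j y)).
Proof.
move=> kN; apply: serP => a; rewrite (sq_serE _ _ kN) ser_at_sum.
have [k0|] := ltP k 0.
  rewrite [LHS]big1 => [|i _]; last by rewrite sq_lt0 ?scaler0 //; lia.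
  by rewrite big1 // => i _; rewrite bz_lt0 ?scale0r //; lia.
case: k kN => [k|//] kN _.
pose n := e - a + k%:Z; pose M := (`|n|.+1 + N)%N.
pose F (b : nat) := bz (e - n + b%:Z) (k%:Z - b%:Z) *: sq b (sq (n - b%:Z) y).
pose H (j : nat) := bz (e - j%:Z) (k%:Z - 2 * j%:Z) *: sq (n - j%:Z) (sq j y).
have kN' : (k.+1 <= N)%N by lia.
pose E (i : nat) := bz (a - i%:Z) i *: sq (k%:Z - i%:Z) (ser_at (st1 e y) (a - i%:Z)).
rewrite (big_ord_trim (F := E) kN'); last first.
  by move=> i ki; rewrite /E sq_lt0 ?scaler0 //; lia.
transitivity (\sum_(b < M) F b).
  rewrite (big_ord_trim (F := F) (m := k.+1)); last 2 first.
  - by rewrite /M; lia.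
  - by move=> i ki; rewrite /F bz_lt0 ?scale0r //; lia.
  rewrite (reindex_inj rev_ord_inj); apply: eq_bigr => i _ /=.
  have lik : (i <= k)%N by rewrite -ltnS.
  rewrite /E /F st1E subSS /n.
  rewrite (_ : k%:Z - (k - i)%N%:Z = i%:Z); last lia.
  by congr (bz _ _ *: sq _ (sq _ _)); lia.
rewrite bm_binomial; last by rewrite /M; lia.
rewrite (big_ord_trim (F := H) (m := N)); last 2 first.
- by rewrite /M; lia.
- by move=> i ki; rewrite /H bz_lt0 ?scale0r //; lia.
apply: eq_bigr => j _; rewrite /H ser_atZ shiftE st1E /n.
by congr (_ *: sq _ _); lia.
Qed.
End SteenrodTotal.
Arguments st1 {X}.

(** * Polynomials acting on iterated series *)

Lemma mnm_ind (n : nat) (P : 'X_{1..n} -> Prop) :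
  P 0%MM -> (forall i m, P m -> P (U_(i) + m)%MM) -> forall m, P m.
Proof.
move=> P0 PU m; have [d] := ubnP (mdeg m); elim: d m => // d IH m md.
have [->//|] := eqVneq m 0%MM.
rewrite -mdeg_eq0 mdegE sum_nat_eq0 negb_forall => /existsP[i /= mi].
have le_m : (U_(i) <= m)%MM by rewrite lep1mP.
rewrite -(submK le_m) addmC; apply: PU; apply: IH.
by rewrite -ltnS -(submK le_m) mdegD mdeg1 addn1 in md.
Qed.

Lemma mpoly_alg_ind (n : nat) (P : {mpoly 'F_2[n]} -> Prop) :
  P 0 -> (forall f g, P f -> P g -> P (f + g)) -> P 1 ->
  (forall i f, P f -> P ('X_i * f)) -> forall f, P f.
Proof.
move=> P0 PD P1 PX f; rewrite (mpolyE f).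
elim/big_rec: _ => // m g _ Pg; apply: (PD) => // {g Pg}.
case: (F2_cases f@_m) => ->; first by rewrite scale0r.
rewrite scale1r; elim/mnm_ind: m => [|i m IH]; first by rewrite mpolyX0.
by rewrite mpolyXD; apply: PX.
Qed.

Lemma mpoly_rmorph_eq (n : nat) (R : pzSemiRingType)
    (g h : {rmorphism {mpoly 'F_2[n]} -> R}) :
  (forall i, g 'X_i = h 'X_i) -> g =1 h.
Proof.
move=> gh; apply: mpoly_alg_ind => [|f f' E E'||i f E].
- by rewrite !rmorph0.
- by rewrite !rmorphD E E'.
- by rewrite !rmorph1.
- by rewrite !rmorphM E gh.
Qed.

Section SeriesMap.
Variables (X Y : sqspace) (T : {linear X -> Y}).

Definition sermap (c : ser X) : ser Y := fun a => T (ser_at c a).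

Lemma sermapE c a : ser_at (sermap c) a = T (ser_at c a).
Proof. by []. Qed.

Fact sermap_linear : linear sermap.
Proof.
move=> k c d; apply: serP => a.
by rewrite ser_atD ser_atZ !sermapE ser_atD ser_atZ linearP.
Qed.
HB.instance Definition _ :=
  GRing.isLinear.Build 'F_2 (ser X) (ser Y) *:%R sermap sermap_linear.
End SeriesMap.

Fixpoint L (X : sqspace) (s : nat) : sqspace :=
  match s with 0 => X | s'.+1 => ser (L X s') end.

Section Monomials.
Variable X : sqspace.

(* Multiplication by [u_(i+1)]. *)
Fixpoint op (s : nat) (i : nat) : {linear L X s -> L X s} :=
  match s with
  | 0 => idfun
  | s'.+1 => match i with
             | 0 => shift 1
             | i'.+1 => sermap (op s' i')
             end
  end.

Fixpoint mon (s : nat) (a : nat -> nat) : {linear L X s -> L X s} :=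
  match s with
  | 0 => idfun
  | s'.+1 => shift (a 0%N)%:Z \o sermap (mon s' (fun i => a i.+1))
  end.

Lemma monS s a (c : L X s.+1) i :
  ser_at (mon s.+1 a c) i = mon s (fun i => a i.+1) (ser_at c (i - (a 0%N)%:Z)).
Proof. by []. Qed.

Lemma opS0 s c : op s.+1 0 c = shift 1 c. Proof. by []. Qed.

Lemma opSS s i (c : L X s.+1) a : ser_at (op s.+1 i.+1 c) a = op s i (ser_at c a).
Proof. by []. Qed.

Lemma eq_mon s a b : (forall i, (i < s)%N -> a i = b i) -> mon s a =1 mon s b.
Proof.
elim: s a b => [|s IH] a b ab c //; apply: serP => i; rewrite !monS ab //.
by apply: IH => j js; apply: ab.
Qed.

Lemma mon_mon s a b c : mon s a (mon s b c) = mon s (fun i => a i + b i)%N c.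
Proof.
elim: s a b c => [|s IH] a b c //; apply: serP => i; rewrite !monS IH.
by congr (mon _ _ (ser_at _ _)); lia.
Qed.

Lemma mon0 s c : mon s (fun=> 0%N) c = c.
Proof.
by elim: s c => [|s IH] c //; apply: serP => i; rewrite !monS IH subr0.
Qed.

Lemma mon_op s i c : (i < s)%N -> mon s (fun j => (i == j) : nat) c = op s i c.
Proof.
elim: s i c => [|s IH] [|i] c //= lis; apply: serP => a.
  by rewrite !shiftE sermapE mon0.
by rewrite shiftE !sermapE subr0 IH.
Qed.

Lemma sq_op s i k c : (i < s)%N ->
  sq k (op s i c) = op s i (sq k c) + op s i (op s i (sq (k - 1) c)).
Proof.
elim: s i k c => [|s IH] [|i] k c // lis.
  by rewrite sq_shift1 !opS0 shift_shift.
apply: serP => a; rewrite ser_atD !opSS !(@sq_serE _ _ _ _ `|k|.+2); try lia.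
rewrite !linear_sum -big_split; apply: eq_bigr => j _ /=.
rewrite opSS IH // scalerDr !linearZ /=.
by rewrite (_ : k - j%:Z - 1 = k - 1 - j%:Z) //; lia.
Qed.

Definition act (s : nat) (f : {mpoly 'F_2[s]}) (c : L X s) : L X s :=
  \sum_(m <- msupp f) f@_m *: mon s (fun i => nth 0%N m i) c.

Fact act_linear s f : linear (@act s f).
Proof.
move=> k c d; rewrite /act scaler_sumr -big_split; apply: eq_bigr => m _ /=.
by rewrite linearP scalerDr !scalerA mulrC.
Qed.
HB.instance Definition _ s f :=
  GRing.isLinear.Build 'F_2 (L X s) (L X s) *:%R (@act s f) (@act_linear s f).

Lemma act_supp s (f : {mpoly 'F_2[s]}) (r : seq 'X_{1..s}) c :
  uniq r -> {subset msupp f <= r} ->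
  act f c = \sum_(m <- r) f@_m *: mon s (fun i => nth 0%N m i) c.
Proof.
move=> r_uniq fr; rewrite (bigID (mem (msupp f))) /= [X in _ + X]big1 ?addr0.
  rewrite -big_filter; apply: perm_big; apply: uniq_perm; rewrite ?filter_uniq //.
  by move=> m; rewrite mem_filter andb_idr // => /fr.
by move=> m; rewrite mcoeff_msupp negbK => /eqP->; rewrite scale0r.
Qed.

Definition actl s (c : L X s) (f : {mpoly 'F_2[s]}) : L X s := act f c.

Fact actl_linear s c : linear (@actl s c).
Proof.
move=> k f g; rewrite /actl.
set r := undup (msupp f ++ msupp g ++ msupp (k *: f + g)).
have sub h : {subset msupp h <= msupp f ++ msupp g ++ msupp (k *: f + g)} ->
    act h c = \sum_(m <- r) h@_m *: mon s (fun i => nth 0%N m i) c.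
  by move=> hr; apply: act_supp; rewrite ?undup_uniq // => m /hr; rewrite mem_undup.
rewrite !sub => [|m|m|m]; try by rewrite !mem_cat => ->; rewrite ?orbT.
rewrite scaler_sumr -big_split; apply: eq_bigr => m _ /=.
by rewrite mcoeffD mcoeffZ scalerDl scalerA.
Qed.
HB.instance Definition _ s c :=
  GRing.isLinear.Build 'F_2 {mpoly 'F_2[s]} (L X s) *:%R (@actl s c) (@actl_linear s c).

Lemma act0l s (c : L X s) : act 0 c = 0.
Proof. exact: (linear0 (actl c)). Qed.
Lemma actDl s (f g : {mpoly 'F_2[s]}) c : act (f + g) c = act f c + act g c.
Proof. exact: (linearD (actl c)). Qed.
Lemma actZl s k (f : {mpoly 'F_2[s]}) c : act (k *: f) c = k *: act f c.
Proof. exact: (linearZ_LR (actl c)). Qed.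
Lemma act_suml s (I : Type) (r : seq I) (P : pred I) (F : I -> {mpoly 'F_2[s]}) c :
  act (\sum_(i <- r | P i) F i) c = \sum_(i <- r | P i) act (F i) c.
Proof. exact: (linear_sum (actl c)). Qed.

Lemma act_mon s (m : 'X_{1..s}) c : act 'X_[m] c = mon s (fun i => nth 0%N m i) c.
Proof. by rewrite /act msuppX big_seq1 mcoeffX eqxx scale1r. Qed.

Lemma act1 s (c : L X s) : act 1 c = c.
Proof.
rewrite -mpolyX0 act_mon -[RHS]mon0; apply: eq_mon => i lis.
by rewrite -(mnm_nth 0%N _ (Ordinal lis)) mnm0E.
Qed.

Lemma act_op s (i : 'I_s) c : act 'X_i c = op s i c.
Proof.
rewrite act_mon -mon_op //; apply: eq_mon => j js.
by rewrite -(mnm_nth 0%N _ (Ordinal js)) mnm1E.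
Qed.

Lemma actM s (f g : {mpoly 'F_2[s]}) c : act (f * g) c = act f (act g c).
Proof.
rewrite {1}(mpolyE f) {1}(mpolyE g) mulr_suml act_suml.
apply: eq_bigr => m _; rewrite -scalerAl actZl; congr (_ *: _).
rewrite mulr_sumr act_suml linear_sum; apply: eq_bigr => m' _.
rewrite -scalerAr actZl linearZ /= -mpolyXD act_mon mon_mon; congr (_ *: _).
apply: eq_mon => i lis.
by rewrite -!(mnm_nth 0%N _ (Ordinal lis)) mnmDE.
Qed.

Lemma actXM s (i : 'I_s) f c : act ('X_i * f) c = op s i (act f c).
Proof. by rewrite actM act_op. Qed.

End Monomials.

Lemma act_semilinear (X Y : sqspace) (s s' : nat) (T : {linear L X s -> L Y s'})
    (h : {rmorphism {mpoly 'F_2[s]} -> {mpoly 'F_2[s']}}) :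
  (forall (i : 'I_s) c, T (op X s i c) = act (h 'X_i) (T c)) ->
  forall f c, T (act f c) = act (h f) (T c).
Proof.
move=> Top f c; elim/mpoly_alg_ind: f => [|f g IHf IHg||i f IHf].
- by rewrite rmorph0 !act0l linear0.
- by rewrite rmorphD !actDl linearD /= IHf IHg.
- by rewrite rmorph1 !act1.
- by rewrite actXM Top rmorphM actM IHf.
Qed.

(* Substitutions are only used through their values on the variables; keeping
   them opaque prevents costly comparisons between different ones. *)
Lemma psubst_exists (n m : nat) (h : 'I_n -> {poly {mpoly 'F_2[m]}}) :
  {g : {rmorphism {mpoly 'F_2[n]} -> {poly {mpoly 'F_2[m]}}} | forall i, g 'X_i = h i}.
Proof.
exists (mmap (@polyC {mpoly 'F_2[m]} \o @mpolyC m 'F_2) h) => i.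
by rewrite /= mmapX mmap1U.
Qed.

Lemma msubst_exists (n m : nat) (h : 'I_n -> {mpoly 'F_2[m]}) :
  {g : {rmorphism {mpoly 'F_2[n]} -> {mpoly 'F_2[m]}} | forall i, g 'X_i = h i}.
Proof.
exists (comp_mpoly [tuple h i | i < n]) => i.
by rewrite /= comp_mpolyXU -tnth_nth tnth_mktuple.
Qed.

Lemma F2_morphZ (n m : nat) (g : {rmorphism {mpoly 'F_2[n]} -> {mpoly 'F_2[m]}}) a f :
  g (a *: f) = a *: g f.
Proof. by case: (F2_cases a) => ->; rewrite ?scale1r // !scale0r rmorph0. Qed.

Lemma sqpoly_exists n :
  {g : {rmorphism {mpoly 'F_2[n]} -> {poly {mpoly 'F_2[n]}}} |
    forall i, g 'X_i = ('X_i)%:P + ('X_i ^+ 2)%:P * 'X}.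
Proof. exact: psubst_exists. Qed.

(* The total square [f |-> sum_k z^k Sq^k f] of [F[u_1, ..., u_n]]. *)
Definition sqpoly n := sval (sqpoly_exists n).

Lemma sqpolyX n (i : 'I_n) : sqpoly n 'X_i = ('X_i)%:P + ('X_i ^+ 2)%:P * 'X.
Proof. exact: (svalP (sqpoly_exists n)). Qed.

Lemma cartan (X : sqspace) s (f : {mpoly 'F_2[s]}) (k : int) (N : nat) (c : L X s) :
  k < N%:Z ->
  sq k (act f c) = \sum_(i < N) act (sqpoly s f)`_i (sq (k - i%:Z) c).
Proof.
have [k0|] := ltP k 0.
  rewrite sq_lt0 // big1 // => i _; rewrite sq_lt0 ?linear0 //; lia.
move=> k0; elim/mpoly_alg_ind: f k N k0 c => [|f g IHf IHg||i f IH] k N k0 c kN.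
- by rewrite act0l linear0 big1 // => i _; rewrite rmorph0 coef0 act0l.
- rewrite actDl linearD /= (IHf _ N) // (IHg _ N) // -big_split.
  by apply: eq_bigr => i _ /=; rewrite rmorphD coefD actDl.
- rewrite act1; case: N kN => [|N] kN; first lia.
  rewrite big_ord_recl rmorph1 coef1 act1 subr0 big1 ?addr0 // => i _.
  by rewrite coef1 act0l.
rewrite actXM sq_op // (IH _ N) //.
have -> : sq (k - 1) (act f c) = \sum_(j < N) act (sqpoly s f)`_j (sq (k - 1 - j%:Z) c).
  have [k1|k1] := ltP (k - 1) 0; last by apply: IH; lia.
  rewrite sq_lt0 // big1 // => j _; rewrite sq_lt0 ?linear0 //; lia.
have E j : (sqpoly s ('X_i * f))`_j = 'X_i * (sqpoly s f)`_j +
    (if j is j'.+1 then 'X_i ^+ 2 * (sqpoly s f)`_j' else 0).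
  rewrite rmorphM sqpolyX mulrDl coefD coefCM -mulrA coefCM coefXM.
  by case: j => [|j] /=; rewrite ?mulr0.
move: (sqpoly s f) E => p E.
under [RHS]eq_bigr => j _ do rewrite E actDl actXM.
rewrite big_split /= linear_sum; congr (_ + _).
case: N kN => [|N] kN; first lia.
rewrite [RHS]big_ord_recl act0l add0r big_ord_recr /= (sq_lt0 (i := k - 1 - N%:Z)); last lia.
rewrite linear0 addr0 !linear_sum.
apply: eq_bigr => j _; rewrite expr2 -mulrA !actM !act_op /bump add0n.
by rewrite (_ : k - 1 - j%:Z = k - (1 + j)%N%:Z) //; lia.
Qed.

(** * Linear forms and the polynomials Vt_s *)

Section LinearForms.

Lemma up_exists s : {g : {rmorphism {mpoly 'F_2[s]} -> {mpoly 'F_2[s.+1]}} |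
  forall i, g 'X_i = 'X_(lift ord0 i)}.
Proof. exact: msubst_exists. Qed.

Definition up s := sval (up_exists s).

Lemma upX s i : up s 'X_i = 'X_(lift ord0 i).
Proof. exact: (svalP (up_exists s)). Qed.

Lemma sharp_exists s : {g : {rmorphism {mpoly 'F_2[s]} -> {mpoly 'F_2[s.+1]}} |
  forall i, g 'X_i = 'X_(lift ord0 i) * ('X_(lift ord0 i) + 'X_ord0)}.
Proof. exact: msubst_exists. Qed.

(* [f |-> sum_k u_1^(|f|-k) Sq^k f], with the variables of [f] renumbered. *)
Definition sharp s := sval (sharp_exists s).

Lemma sharpX s i :
  sharp s 'X_i = 'X_(lift ord0 i) * ('X_(lift ord0 i) + 'X_ord0).
Proof. exact: (svalP (sharp_exists s)). Qed.

Lemma mpoly2 s : 2%:R = 0 :> {mpoly 'F_2[s]}.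
Proof. by rewrite -mpolyC_nat (_ : 2%:R = 0) ?mpolyC0 //; apply/val_inj. Qed.

Definition lform (s : nat) (l : 'rV['F_2]_s) : {mpoly 'F_2[s]} :=
  \sum_(j < s) l 0 j *: 'X_j.

(** In characteristic 2 the map y |-> y (y + u_1) is additive, so it suffices that the formula holds
    on variables. *)
Lemma sharp_lform s l :
  sharp s (lform l) = up s (lform l) * (up s (lform l) + 'X_ord0).
Proof.
rewrite /lform; elim: (index_enum _) => [|j r].
  by rewrite !big_nil !rmorph0 mul0r.
rewrite !big_cons; move: (\sum_(_ <- r) _) => f IH.
rewrite !rmorphD /= IH !F2_morphZ sharpX upX /=.
case: (F2_cases (l 0 j)) => ->; first by rewrite !scale0r !add0r.
rewrite !scale1r; set x := 'X_(lift _ _); set y := up s f; set u := 'X_ord0.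
have -> : (x + y) * (x + y + u) = x * (x + u) + y * (y + u) + 2%:R * (x * y) by ring.
by rewrite mpoly2 mul0r addr0.
Qed.

Lemma lform0 s : lform (0 : 'rV_s) = 0.
Proof. by apply: big1 => j _; rewrite mxE scale0r. Qed.

Lemma lform_row_mx s (a : 'F_2) (l : 'rV_s) :
  lform (row_mx (a%:M : 'rV_1) l : 'rV_s.+1) = a *: 'X_ord0 + up s (lform l).
Proof.
rewrite /lform big_ord_recl; congr (_ + _).
  have E : row_mx (a%:M : 'rV_1) l 0 (lshift s ord0) = a.
    by rewrite row_mxEl mxE eqxx.
  congr (_ *: _); rewrite -[RHS]E; congr (fun_of_matrix _ _ _).
  exact: val_inj.
rewrite rmorph_sum; apply: eq_bigr => j _ /=; rewrite F2_morphZ upX.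
congr (_ *: _); rewrite -(row_mxEr (a%:M : 'rV_1) l); congr (fun_of_matrix _ _ _).
exact: val_inj.
Qed.

Lemma big_rowS (R : comPzRingType) s (F : 'rV['F_2]_s.+1 -> R) :
  \prod_(l : 'rV['F_2]_s.+1) F l =
  \prod_(l : 'rV['F_2]_s) (F (row_mx (0%:M : 'rV_1) l) * F (row_mx (1%:M : 'rV_1) l)).
Proof.
pose h (p : 'rV['F_2]_s * 'F_2) : 'rV['F_2]_s.+1 := row_mx (p.2%:M : 'rV_1) p.1.
pose h' (l : 'rV['F_2]_s.+1) : 'rV['F_2]_s * 'F_2 :=
  (@rsubmx _ 1 1 s l, @lsubmx _ 1 1 s l 0 0).
rewrite (reindex h) /=; last first.
  exists h' => [[l a] _|l _]; rewrite /h /h' /=.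
    by rewrite row_mxKr row_mxKl mxE eqxx.
  by rewrite -mx11_scalar (@hsubmxK _ 1 1 s l).
rewrite -(pair_bigA _ (fun l a => F (h (l, a)))) /=; apply: eq_bigr => l _.
rewrite (bigD1 0) //= (bigD1 1) //= big1 ?mulr1 // => a /andP[a0 a1].
by case: (F2_cases a) a0 a1 => ->; rewrite eqxx.
Qed.

End LinearForms.

Section Graded.
Variable s : nat.

(** Homogeneity of degree k when the variable of p has degree -1, as in a total square. *)
Definition graded (k : nat) (p : {poly {mpoly 'F_2[s]}}) : Prop :=
  forall i, p`_i \is (k + i).-homog.

Lemma graded0 k : graded k 0.
Proof. by move=> i; rewrite coef0 rpred0. Qed.

Lemma gradedD k p q : graded k p -> graded k q -> graded k (p + q).
Proof. by move=> kp kq i; rewrite coefD rpredD. Qed.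

Lemma gradedM k l p q : graded k p -> graded l q -> graded (k + l) (p * q).
Proof.
move=> kp lq i; rewrite coefM rpred_sum // => j _.
rewrite (_ : (k + l + i = k + j + (l + (i - j)))%N) ?dhomogM //.
by have := ltn_ord j; lia.
Qed.

Lemma gradedC k f : f \is k.-homog -> graded k f%:P.
Proof. by move=> fk [|i]; rewrite coefC ?addn0 // rpred0. Qed.

Lemma graded1 : graded 0 1.
Proof. by apply: gradedC; apply: dhomog1. Qed.

Lemma gradedCX k f : f \is k.+1.-homog -> graded k (f%:P * 'X).
Proof.
by move=> fk [|[|i]]; rewrite coefCM coefX ?mulr0 ?rpred0 // mulr1 addn1.
Qed.

Lemma graded_exp p n : graded 0 p -> graded 0 (p ^+ n).
Proof.
move=> p0; elim: n => [|n IH]; first by rewrite expr0; apply: graded1.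
by rewrite exprS; apply: (@gradedM 0 0).
Qed.

Lemma graded_prod (I : Type) (r : seq I) (P : pred I) (F : I -> {poly {mpoly 'F_2[s]}}) :
  (forall i, P i -> graded 0 (F i)) -> graded 0 (\prod_(i <- r | P i) F i).
Proof.
move=> F0; elim/big_rec: _ => [|i p Pi p0]; first exact: graded1.
by apply: (@gradedM 0 0) => //; apply: F0.
Qed.

Lemma lform_homog (l : 'rV['F_2]_s) : lform l \is 1.-homog.
Proof. by apply: rpred_sum => j _; rewrite dhomogZ // dhomogX; apply/eqP/mdeg1. Qed.
End Graded.

Lemma graded_sqpoly s k (f : {mpoly 'F_2[s]}) :
  f \is k.-homog -> graded k (sqpoly s f).
Proof.
move=> /dhomogP fk; rewrite (mpolyE f) rmorph_sum big_seq.
elim/big_rec: _ => [|m p mf IH]; first exact: graded0.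
apply: gradedD => //; move/fk: mf => {IH} /= mk.
case: (F2_cases f@_m) => ->; first by rewrite scale0r rmorph0; apply: graded0.
rewrite scale1r -mk mpolyXE_id rmorph_prod /= mdegE.
elim/big_rec2: _ => [|i d q _ IH]; first exact: graded1.
apply: gradedM => //; rewrite rmorphXn /= sqpolyX.
elim: (m i) => [|a IHa]; first by rewrite expr0; apply: graded1.
rewrite exprS -add1n; apply: gradedM => //; apply: gradedD.
  by apply: gradedC; rewrite dhomogX; apply/eqP/mdeg1.
by apply: gradedCX; apply: (@dhomogMn _ _ _ 1); rewrite dhomogX; apply/eqP/mdeg1.
Qed.

Lemma coef_exp_1aCX (R : comNzRingType) (a : R) m k :
  ((1 + a%:P * 'X) ^+ m)`_k = a ^+ k *+ 'C(m, k).
Proof.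
elim: m k => [|m IH] k.
  by rewrite expr0 coef1 bin0n; case: k.
rewrite exprS mulrDl mul1r coefD -mulrA coefCM coefXM !IH.
by case: k => [|k] /=; rewrite ?bin0 ?mulr0 ?addr0 // binS mulrnDr exprS mulrnAr.
Qed.

Lemma char2_factor (R : comNzRingType) (u y z : R) : 2%:R = 0 :> R ->
  (1 + y * z) * (1 + (u + y) * z) = 1 + u * z + y * (y + u) * z ^+ 2.
Proof.
move=> R2.
have -> : (1 + y * z) * (1 + (u + y) * z) =
  1 + u * z + y * (y + u) * z ^+ 2 + 2%:R * (y * z) by ring.
by rewrite R2 mul0r addr0.
Qed.

Section Twist.
Variables (R R' : comNzRingType) (h : {rmorphism R -> R'}) (u : R').
Implicit Type G : {poly R}.

Lemma size_mul_1aCX (a : R) G M :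
  (size G <= M)%N -> (size ((1 + a%:P * 'X) * G)%R <= M.+1)%N.
Proof.
move=> GM; rewrite mulrDl mul1r; apply: leq_trans (size_polyD _ _) _.
rewrite geq_max (leq_trans GM) //= -mulrA; apply/leq_sizeP => j Mj.
rewrite coefCM coefXM; case: j Mj => [|j] Mj; rewrite ?mulr0 //=.
by rewrite nth_default ?mulr0 // (leq_trans GM).
Qed.

(* [G(z) |-> (1 + z u)^M G^h(z^2 / (1 + z u))] for [G] of degree at most [M]. *)
Definition twist M G : {poly R'} :=
  \sum_(j < M.+1) (h G`_j)%:P * 'X^(2 * j) * (1 + u%:P * 'X) ^+ (M - j).

(** The factor 1 + z l becomes 1 + z^2 h(l) / (1 + z u), and raising the bound M by one supplies the
    factor 1 + z u that clears the denominator. *)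
Lemma twist_mul_1aCX M (l : R) G : (size G <= M.+1)%N ->
  twist M.+1 ((1 + l%:P * 'X) * G) =
  (1 + u%:P * 'X + (h l)%:P * 'X^2) * twist M G.
Proof.
move=> GM; rewrite /twist; set w := 1 + u%:P * 'X.
have coefE j : ((1 + l%:P * 'X) * G)`_j = G`_j + (if j is j'.+1 then l * G`_j' else 0).
  rewrite mulrDl mul1r coefD -mulrA coefCM coefXM.
  by case: j => [|j] /=; rewrite ?mulr0.
under eq_bigr => j _ do rewrite coefE rmorphD rmorphD !mulrDl.
rewrite big_split /= mulrDl; congr (_ + _).
  rewrite big_ord_recr /= nth_default // rmorph0 rmorph0 !mul0r addr0 mulr_sumr.
  by apply: eq_bigr => j _; rewrite subSn ?leq_ord // exprS mulrCA.
rewrite big_ord_recl /= rmorph0 rmorph0 !mul0r add0r mulr_sumr.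
apply: eq_bigr => j _; rewrite /bump /= add1n subSS rmorphM polyCM mulnS exprD.
by rewrite add0n; move: 'X^2 'X^(2 * j) => a b; rewrite -!mulrA (mulrCA _ a).
Qed.

Lemma twist_prod M (r : seq R) G : (size G <= M.+1)%N ->
  (size (\prod_(l <- r) (1 + l%:P * 'X) * G)%R <= (size r + M).+1)%N /\
  twist (size r + M) (\prod_(l <- r) (1 + l%:P * 'X) * G) =
  \prod_(l <- r) (1 + u%:P * 'X + (h l)%:P * 'X^2) * twist M G.
Proof.
move=> GM; elim: r => [|l r [IH1 IH2]]; first by rewrite !big_nil !mul1r.
rewrite !big_cons -!mulrA /=; split; first by rewrite addSn; apply: size_mul_1aCX.
by rewrite addSn twist_mul_1aCX // IH2 mulrA.
Qed.

Lemma twist_prod_exp (r : seq R) (D : nat) (n := (size r * D)%N)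
    (p := \prod_(l <- r) (1 + l%:P * 'X)) :
  (size (p ^+ D)%R <= n.+1)%N /\
  twist n (p ^+ D) = (\prod_(l <- r) (1 + u%:P * 'X + (h l)%:P * 'X^2)) ^+ D.
Proof.
rewrite /n {n}; elim: D => [|D [IH1 IH2]].
  rewrite muln0 !expr0; split; first by rewrite size_poly1.
  by rewrite /twist big_ord1 coef1 rmorph1 muln0 subn0 !expr0 !mulr1.
by rewrite mulnS (exprS p) (exprS (\prod_(l <- r) _)) -IH2; apply: twist_prod.
Qed.

Lemma coef_XnM_twist G (M A k : nat) :
  ('X^(2 * A) * twist M G)`_k = \sum_(l < M.+1)
    (if (k < 2 * (A + l))%N then 0 else
     u ^+ (k - 2 * (A + l)) * h G`_l *+ 'C(M - l, k - 2 * (A + l))).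
Proof.
rewrite /twist mulr_sumr coef_sum; apply: eq_bigr => l _.
rewrite -mulrA mulrCA coefCM mulrA -exprD -mulnDr coefXnM.
by case: ifP; rewrite ?mulr0 // coef_exp_1aCX mulrnAr mulrC.
Qed.

End Twist.

Section TotalSquare.

Definition vt (s : nat) : {poly {mpoly 'F_2[s]}} :=
  \prod_(l : 'rV['F_2]_s) (1 + (lform l)%:P * 'X).

(** The linear forms come in pairs y, y + u_1 with y free of u_1, and (1 + y z)(1 + (y + u_1) z) = 1
    + u_1 z + y (y + u_1) z^2 modulo 2. Hence Vt_(s+1) is the twist of Vt_s. *)
Lemma vtS s : vt s.+1 =
  \prod_(l : 'rV['F_2]_s) (1 + ('X_ord0)%:P * 'X + (sharp s (lform l))%:P * 'X^2).
Proof.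
rewrite /vt big_rowS; apply: eq_bigr => l _.
have -> : lform (row_mx (0%:M : 'rV_1) l : 'rV_s.+1) = up s (lform l).
  by rewrite lform_row_mx scale0r add0r.
have -> : lform (row_mx (1%:M : 'rV_1) l : 'rV_s.+1) = 'X_ord0 + up s (lform l).
  by rewrite lform_row_mx scale1r.
rewrite sharp_lform.
rewrite polyCM !polyCD; apply: char2_factor.
by rewrite -polyC_natr mpoly2 polyC0.
Qed.

Lemma twist_vt s D : (size (vt s ^+ D)%R <= (2 ^ s * D).+1)%N /\
  twist (sharp s) 'X_ord0 (2 ^ s * D) (vt s ^+ D) = vt s.+1 ^+ D.
Proof.
pose r := [seq lform l | l <- index_enum 'rV['F_2]_s].
have size_r : size r = (2 ^ s)%N.
  rewrite size_map /index_enum -enumT -cardE card_mx card_ord mul1n.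
  by rewrite (_ : (Zp_trunc (pdiv 2)).+2 = 2%N).
have vtE : vt s = \prod_(l <- r) (1 + l%:P * 'X) by rewrite big_map.
have vtSE : vt s.+1 =
    \prod_(l <- r) (1 + ('X_ord0)%:P * 'X + (sharp s l)%:P * 'X^2).
  by rewrite big_map vtS.
by rewrite vtE vtSE -size_r; apply: twist_prod_exp.
Qed.

Lemma graded_vt s : graded 0 (vt s).
Proof.
apply: graded_prod => l _; apply: gradedD; first exact: graded1.
by apply: gradedCX; apply: lform_homog.
Qed.

End TotalSquare.

(** * Steenrod operations on St_s *)

Section IteratedTotal.
Variable X : sqspace.

Lemma st1_op s (i : 'I_s) (e : int) (c : L X s) :
  st1 (e + 1) (op X s i c) = act (sharp s 'X_i) (st1 e c : L X s.+1).
Proof.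
rewrite sharpX mulrDr actDl !actM !act_op; apply: serP => a.
rewrite ser_atD st1E !opSS st1E opS0 shiftE st1E sq_op // addrC.
by congr (op _ _ _ (op _ _ _ (sq _ _)) + op _ _ _ (sq _ _)); ring.
Qed.

(** St_1 is multiplicative by the Cartan formula, and [sharp] is St_1 on polynomials. The power of
    u_1 depends on the degree, hence the homogeneity of f. *)
Lemma st1_act s (f : {mpoly 'F_2[s]}) (k : nat) (e : int) (c : L X s) :
  f \is k.-homog ->
  st1 (e + k%:Z) (act f c) = act (sharp s f) (st1 e c : L X s.+1).
Proof.
move=> /dhomogP fk; rewrite (mpolyE f) rmorph_sum !act_suml linear_sum.
rewrite big_seq [RHS]big_seq; apply: eq_bigr => m /fk /= <-.
rewrite F2_morphZ !actZl linearZ /=; congr (_ *: _) => {f fk k}.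
elim/mnm_ind: m e c => [|i m IH] e c.
  by rewrite mdeg0 addr0 mpolyX0 rmorph1 !act1.
rewrite mpolyXD actXM rmorphM [RHS]actM -IH -st1_op mdegD mdeg1.
by congr (st1 _ _); lia.
Qed.

Fixpoint stn (s : nat) (d : int) : {linear X -> L X s} :=
  match s with
  | 0 => idfun
  | s'.+1 => st1 ((2 ^ s')%N%:Z * d) \o stn s' d
  end.

Lemma stnS s d x : stn s.+1 d x = st1 ((2 ^ s)%N%:Z * d) (stn s d x).
Proof. by []. Qed.

Lemma act_X0n s n (c : L X s.+1) : act ('X_ord0 ^+ n) c = shift n%:Z c.
Proof.
elim: n => [|n IH]; first by rewrite expr0 act1 shift0.
by rewrite exprS actXM IH opS0 shift_shift; congr shift; lia.
Qed.

Lemma bm_L s : bullett_macdonald X -> bullett_macdonald (L X s).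
Proof. by move=> bm; elim: s => //= s; apply: bm_ser. Qed.

(** The left-hand side is what [sq_st1] does to the coefficients of z^A G when St_1 is applied once
    more. It is a twist, since C(A+M-j, k-2j) u_1^(k-2j) is the coefficient of z^(k-2j) in (1 + z
    u_1)^(A+M-j). *)
Lemma twist_coef s (G : {poly {mpoly 'F_2[s]}}) (M A k : nat) (b : nat -> 'F_2) :
  (size G <= M.+1)%N ->
  (forall j, (2 * j <= k)%N -> (A <= j)%N -> b j = 'C(A + M - j, k - 2 * j)%:R) ->
  (forall j, (k < 2 * j)%N -> b j = 0) ->
  \sum_(j < k.+1) b j *: ('X_ord0 ^+ (k - 2 * j) * sharp s ('X^A * G)`_j) =
  ('X^(2 * A) * twist (sharp s) 'X_ord0 M G)`_k.
Proof.
move=> GM bE b0; rewrite coef_XnM_twist.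
pose F j := b j *: ('X_ord0 ^+ (k - 2 * j) * sharp s ('X^A * G)`_j).
pose N := (k + M).+1.
rewrite -(big_ord_trim (F := F) (N := (A + N)%N)); last 2 first.
- by rewrite /N; lia.
- by move=> j kj; rewrite /F b0 ?scale0r //; lia.
rewrite -(big_mkord xpredT F) (big_cat_nat (n := A)) ?leq_addr //=.
rewrite big_nat big1 ?add0r => [|j jA]; last first.
  by rewrite /F coefXnM ifT ?rmorph0 ?mulr0 ?scaler0.
rewrite -{1}[A]add0n big_addn addKn big_mkord.
pose H l := (if (k < 2 * (A + l))%N then 0 else
     'X_ord0 ^+ (k - 2 * (A + l)) * sharp s G`_l *+ 'C(M - l, k - 2 * (A + l))).
rewrite -[RHS](big_ord_trim (F := H) (N := N)); last 2 first.
- by rewrite /N; lia.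
- move=> j /andP[Mj _]; rewrite /H; case: ifP => // _.
  by rewrite [G`_j]nth_default ?rmorph0 ?mulr0 ?mul0rn // (leq_trans GM).
apply: eq_bigr => j _; rewrite /F /H (addnC A); case: ltnP => kj.
  by rewrite b0 ?scale0r //; lia.
rewrite coefXnM ifF ?addnK; last lia.
have [jM|Mj] := leqP j M; last first.
  by rewrite [G`_j]nth_default ?(leq_trans GM) // rmorph0 mulr0 scaler0 mul0rn.
rewrite bE //; try lia.
by rewrite (_ : A + M - (j + A) = M - j)%N ?scaler_nat //; lia.
Qed.

(* [sum_k z^k Sq^k St_s(x) = sum_i z^(2^s i) Vt_s(z)^(d-i) St_s(Sq^i x)] for [|x| = d],
   where the exponent [d - i], possibly negative, is made nonnegative by adding a
   multiple of [2^r]: as [Vt_s(z)^(2^r) = 1] modulo [z^(2^r)], this does not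
   affect the coefficient of [z^k] for [k < 2^r]. *)
Lemma sq_stn s (k r q D : nat) (d : int) (x : X) : bullett_macdonald X ->
  (k < 2 ^ r)%N -> d + (q * 2 ^ r)%N%:Z = D%:Z -> (k <= D)%N ->
  sq k (stn s d x) =
  \sum_(i < k.+1) act ('X^(2 ^ s * i) * vt s ^+ (D - i))`_k
    (stn s (d + i%:Z) (sq i x)).
Proof.
move=> bm; elim: s k => [|s IH] k kr dD kD.
  have vt0 : vt 0 = 1.
    rewrite /vt big1 // => l _.
    by rewrite (_ : l = 0) ?lform0 ?mul0r ?addr0 //; apply/rowP => -[].
  rewrite big_ord_recr big1 /= => [|i _].
    by rewrite add0r vt0 expr1n mulr1 expn0 mul1n coefXn eqxx act1.
  rewrite vt0 expr1n mulr1 expn0 mul1n coefXn (_ : (k == i) = false) ?act0l //.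
  by have := ltn_ord i; lia.
rewrite stnS (@sq_st1 _ (bm_L (s := s) bm) k%:Z _ k.+1); last lia.
set e := (2 ^ s)%N%:Z * d.
pose g (j i : nat) := ('X^(2 ^ s * i) * vt s ^+ (D - i))`_j.
pose b (j : nat) := bz (e - j%:Z) (k%:Z - 2 * j%:Z).
(* The induction hypothesis expands Sq^j St_s(x) inside the outer St_1, and [st1_act] brings its
   coefficients out through [sharp]. *)
transitivity (\sum_(j < k.+1) \sum_(i < k.+1)
    act (b j *: ('X_ord0 ^+ (k - 2 * j) * sharp s (g j i)))
      (stn s.+1 (d + i%:Z) (sq i x))).
  apply: eq_bigr => j _; have [kj|kj] := ltnP k (2 * j).
    rewrite bz_lt0 ?scale0r ?big1 //; last lia.
    by move=> i _; rewrite /b bz_lt0 ?scale0r ?act0l //; lia.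
  under eq_bigr => i _ do rewrite actZl actM act_X0n.
  rewrite -scaler_sumr /b (_ : (k - 2 * j)%N%:Z = k%:Z - 2 * j%:Z); last lia.
  congr (_ *: _); rewrite -linear_sum; congr (shift _ _).
  pose F i := act (g j i) (stn s (d + i%:Z) (sq i x)).
  have jk : (j.+1 <= k.+1)%N by have := ltn_ord j; lia.
  rewrite (IH j); try lia.
  rewrite -/(F _) -(big_ord_trim (F := F) jk); last first.
    move=> i ji; rewrite /F /g coefXnM ifT ?act0l //.
    by have := expn_gt0 2 s; nia.
  rewrite linear_sum; apply: eq_bigr => i _; rewrite stnS /F.
  have [ij|ij] := ltnP j (2 ^ s * i).
    by rewrite /g coefXnM ij act0l linear0 rmorph0 act0l.
  rewrite -(@st1_act _ _ (j - 2 ^ s * i)); last first.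
    rewrite /g coefXnM ltnNge ij /=.
    have := graded_exp (D - i) (graded_vt s) => /(_ (j - 2 ^ s * i)%N).
    by rewrite add0n.
  by congr (st1 _ _); rewrite /e; lia.
rewrite exchange_big; apply: eq_bigr => i _.
rewrite -[LHS]act_suml; congr (act _ _).
have [size_vt twE] := twist_vt s (D - i).
rewrite expnS -mulnA -twE /g.
rewrite (@twist_coef s (vt s ^+ (D - i)) (2 ^ s * (D - i)) (2 ^ s * i) k b) //.
- move=> j jk ij; rewrite /b.
  rewrite (_ : k%:Z - 2 * j%:Z = (k - 2 * j)%N%:Z); last lia.
  (* The entry e - j may be negative. As k - 2j < 2^r, it may be increased by 2^s q 2^r, which turns
     it into 2^s D - j. *)
  rewrite -(@bz_shift_mul _ r (2 ^ s * q)); last lia.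
  have iD : (i <= D)%N by have := ltn_ord i; lia.
  have -> : (2 ^ s * i + 2 ^ s * (D - i) = 2 ^ s * D)%N by rewrite -mulnDr subnKC.
  have jD : (j <= 2 ^ s * D)%N by have := expn_gt0 2 s; nia.
  rewrite (_ : e - j%:Z + _ = (2 ^ s * D - j)%N%:Z) ?bz_nat //.
  by rewrite /e -subzn // !PoszM -dD PoszM; ring.
- by move=> j kj; rewrite /b bz_lt0 //; lia.
Qed.

End IteratedTotal.

Lemma mpoly_homogX n (i : 'I_n) : ('X_i : {mpoly 'F_2[n]}) \is 1.-homog.
Proof. by rewrite dhomogX; apply/eqP/mdeg1. Qed.

Lemma homog_subst n m w k (h : {rmorphism {mpoly 'F_2[n]} -> {mpoly 'F_2[m]}}) f :
  (forall i, h 'X_i \is w.-homog) -> f \is k.-homog -> h f \is (w * k).-homog.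
Proof.
move=> hw /dhomogP fk; rewrite (mpolyE f) rmorph_sum big_seq.
apply: rpred_sum => a /fk /= <-; rewrite F2_morphZ dhomogZ // {fk f k}.
elim/mnm_ind: a => [|i a IH]; first by rewrite mpolyX0 rmorph1 mdeg0 muln0 dhomog1.
by rewrite mpolyXD rmorphM mdegD mdeg1 mulnDr muln1 dhomogM.
Qed.

Lemma homog_exp n k (f : {mpoly 'F_2[n]}) j : f \is k.-homog -> f ^+ j \is (k * j).-homog.
Proof. exact: dhomogMn. Qed.

Lemma lformD s (l m : 'rV['F_2]_s) : lform (l + m) = lform l + lform m.
Proof. by rewrite /lform -big_split; apply: eq_bigr => j _; rewrite mxE scalerDl. Qed.

Lemma lform_coef s (l : 'rV['F_2]_s) j : (lform l)@_U_(j) = l 0 j.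
Proof.
rewrite /lform raddf_sum (bigD1 j) //= mcoeffZ mcoeffXU eqxx mulr1 big1 ?addr0 //.
by move=> i /negbTE ij; rewrite mcoeffZ mcoeffXU ij mulr0.
Qed.

Lemma lform_inj s : injective (@lform s).
Proof.
move=> l m lm; apply/rowP => j.
by rewrite -!lform_coef lm.
Qed.

(** * The action of GL_s and Dickson invariants *)

Section LinearSubstitution.
Variable s : nat.
Implicit Types (g : 'M['F_2]_s) (f : {mpoly 'F_2[s]}).

Lemma gl_exists g : {h : {rmorphism {mpoly 'F_2[s]} -> {mpoly 'F_2[s]}} |
  forall i, h 'X_i = \sum_(j < s) g i j *: 'X_j}.
Proof. exact: msubst_exists. Qed.

Definition gl g := sval (gl_exists g).

Lemma glX g i : gl g 'X_i = \sum_(j < s) g i j *: 'X_j.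
Proof. exact: (svalP (gl_exists g)). Qed.

Lemma dicksonP f : dickson f <-> forall g, g \in unitmx -> gl g f = f.
Proof.
have glE g : comp_mpoly [tuple \sum_(j < s) g i j *: 'X_j | i < s] =1 gl g.
  apply: mpoly_rmorph_eq => i.
  by rewrite /= comp_mpolyXU -tnth_nth tnth_mktuple glX.
by split=> fD g gU; [rewrite -glE fD | rewrite glE fD].
Qed.

Lemma glX_lform g i : gl g 'X_i = lform (row i g).
Proof. by rewrite glX; apply: eq_bigr => j _; rewrite mxE. Qed.

Lemma gl_lform g l : gl g (lform l) = lform (l *m g).
Proof.
rewrite /lform rmorph_sum; under [RHS]eq_bigr => j _ do rewrite mxE scaler_suml.
rewrite exchange_big; apply: eq_bigr => i _ /=.
rewrite F2_morphZ glX scaler_sumr; apply: eq_bigr => j _.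
by rewrite scalerA.
Qed.

Lemma pihomog_subst n w d k (h : {rmorphism {mpoly 'F_2[n]} -> {mpoly 'F_2[s]}})
    (f : {mpoly 'F_2[n]}) (a : {mpoly 'F_2[s]}) :
  (0 < w)%N -> (forall i, h 'X_i \is w.-homog) -> a \is d.-homog ->
  pihomog mdeg (d + w * k) (h f * a) = h (pihomog mdeg k f) * a.
Proof.
move=> w0 hw ad; pose G p := pihomog mdeg (d + w * k) (h p * a).
pose H p := h (pihomog mdeg k p) * a.
rewrite -/(G f) -/(H f) (mpolyE f).
rewrite (@big_morph _ _ G 0 +%R 0 +%R); last 2 first.
- by move=> p q; rewrite /G rmorphD mulrDl linearD.
- by rewrite /G rmorph0 mul0r linear0.
rewrite (@big_morph _ _ H 0 +%R 0 +%R); last 2 first.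
- by move=> p q; rewrite /H linearD rmorphD mulrDl.
- by rewrite /H linear0 rmorph0 mul0r.
apply: eq_bigr => m _; rewrite /G /H.
rewrite linearZ !F2_morphZ -!scalerAl linearZ /= pihomogX; congr (_ *: _).
have hm : h 'X_[m] * a \is (d + w * mdeg m).-homog.
  by rewrite addnC dhomogM // homog_subst // dhomogX.
case: eqP => [<-|km]; first by rewrite pihomog_dE.
rewrite rmorph0 mul0r; apply: pihomog_ne0 hm.
by apply/eqP => /addnI/eqP; rewrite eqn_pmul2l // => /eqP.
Qed.

Lemma dickson0 : @dickson s 0.
Proof. by apply/dicksonP => g _; rewrite rmorph0. Qed.
Lemma dickson1 : @dickson s 1.
Proof. by apply/dicksonP => g _; rewrite rmorph1. Qed.
Lemma dicksonD f f' : dickson f -> dickson f' -> dickson (f + f').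
Proof.
by move=> /dicksonP D /dicksonP D'; apply/dicksonP => g gU; rewrite rmorphD /= D ?D'.
Qed.
Lemma dicksonM f f' : dickson f -> dickson f' -> dickson (f * f').
Proof.
by move=> /dicksonP D /dicksonP D'; apply/dicksonP => g gU; rewrite rmorphM /= D ?D'.
Qed.
Lemma dicksonX f n : dickson f -> dickson (f ^+ n).
Proof.
move=> D; elim: n => [|n IH]; first by rewrite expr0; apply: dickson1.
by rewrite exprS; apply: dicksonM.
Qed.
Lemma dickson_cancel f f' : f != 0 -> dickson f -> dickson (f * f') -> dickson f'.
Proof.
move=> f0 /dicksonP D /dicksonP D'; apply/dicksonP => g gU; apply: (mulfI f0).
by rewrite -{1}(D g gU) -rmorphM D'.
Qed.

Lemma dickson_pihomog k f : dickson f -> dickson (pihomog mdeg k f).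
Proof.
move=> /dicksonP D; apply/dicksonP => g gU.
rewrite -[LHS]mulr1 -(@pihomog_subst _ 1 0) ?dhomog1 // => [|i].
  by rewrite mulr1 D // add0n mul1n.
by rewrite glX_lform lform_homog.
Qed.

Lemma coef_dickson (p : {poly {mpoly 'F_2[s]}}) :
  (forall g, g \in unitmx -> map_poly (gl g) p = p) <-> (forall i, dickson p`_i).
Proof.
split=> [pD i|pD g gU].
  by apply/dicksonP => g gU; rewrite -{2}(pD g gU) coef_map.
by apply/polyP => i; rewrite coef_map; apply: (iffLR (dicksonP _) (pD i)).
Qed.

Lemma gl_prod_lform g (F : {mpoly 'F_2[s]} -> {poly {mpoly 'F_2[s]}}) :
  g \in unitmx -> (forall l, map_poly (gl g) (F (lform l)) = F (gl g (lform l))) ->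
  map_poly (gl g) (\prod_(l : 'rV['F_2]_s) F (lform l)) = \prod_(l : 'rV['F_2]_s) F (lform l).
Proof.
move=> gU FE; rewrite rmorph_prod [RHS](reindex (mulmx^~ g)) /=; last first.
  by exists (mulmx^~ (invmx g)) => l _; rewrite ?mulmxK ?mulmxKV.
by apply: eq_bigr => l _; rewrite FE gl_lform.
Qed.

Lemma vt_dickson a n i : dickson ('X^a * vt s ^+ n)`_i.
Proof.
move: i; apply/coef_dickson => g gU; rewrite rmorphM !rmorphXn /= map_polyX.
rewrite (gl_prod_lform (F := fun l => 1 + l%:P * 'X)) // => l.
by rewrite rmorphD rmorph1 rmorphM /= map_polyC map_polyX.
Qed.

Lemma sqpoly_lform l :
  sqpoly s (lform l) = (lform l)%:P + (lform l ^+ 2)%:P * 'X.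
Proof.
have p2 (R : comNzRingType) (x y z : R) : 2%:R = 0 :> R ->
    x + x ^+ 2 * z + (y + y ^+ 2 * z) = x + y + (x + y) ^+ 2 * z.
  move=> R2.
  have -> : x + y + (x + y) ^+ 2 * z =
    x + x ^+ 2 * z + (y + y ^+ 2 * z) + 2%:R * (x * y * z) by ring.
  by rewrite R2 mul0r addr0.
rewrite /lform; elim: (index_enum _) => [|j r].
  by rewrite !big_nil !rmorph0 expr0n rmorph0 mul0r addr0.
rewrite !big_cons; move: (\sum_(_ <- r) _) => f IH.
rewrite rmorphD /= IH; case: (F2_cases (l 0 j)) => ->.
  by rewrite scale0r rmorph0 !add0r.
rewrite scale1r sqpolyX !rmorphXn /= polyCD; apply: p2.
by rewrite -polyC_natr mpoly2 polyC0.
Qed.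

(** The total square commutes with linear substitutions, because it sends every linear form l, and
    not only the variables, to l + l^2 z. *)
Lemma sqpoly_dickson f i : dickson f -> dickson (sqpoly s f)`_i.
Proof.
move=> /dicksonP D; move: i; apply/coef_dickson => g gU.
rewrite -{2}(D g gU).
pose h1 : {rmorphism {mpoly 'F_2[s]} -> {poly {mpoly 'F_2[s]}}} :=
  map_poly (gl g) \o sqpoly s.
pose h2 : {rmorphism {mpoly 'F_2[s]} -> {poly {mpoly 'F_2[s]}}} :=
  sqpoly s \o gl g.
apply: (@mpoly_rmorph_eq _ _ h1 h2) => j; rewrite /h1 /h2 /=.
rewrite sqpolyX glX_lform sqpoly_lform -glX_lform -(rmorphXn (gl g)).
by rewrite rmorphD rmorphM /= !map_polyC map_polyX.
Qed.

Lemma gl_perm (p : 'S_s) i : gl (perm_mx p) 'X_i = 'X_(p i).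
Proof.
rewrite glX (bigD1 (p i)) //= !mxE eqxx scale1r big1 ?addr0 // => j pj.
by rewrite !mxE eq_sym (negbTE pj) scale0r.
Qed.

End LinearSubstitution.

(** * Expansion of invariants in one variable *)

Section Peel.
Variable s : nat.

(* [F[u_1, ..., u_(s+1)] = F[u_2, ..., u_(s+1)][u_1]]. *)
Lemma peel_exists : {h : {rmorphism {mpoly 'F_2[s.+1]} -> {poly {mpoly 'F_2[s]}}} |
  forall i, h 'X_i = oapp (fun j => ('X_j)%:P) 'X (unlift ord0 i)}.
Proof. exact: psubst_exists. Qed.

Definition peel := sval peel_exists.

Lemma peelX0 : peel 'X_ord0 = 'X.
Proof. by rewrite (svalP peel_exists) unlift_none. Qed.

Lemma peelX i : peel 'X_(lift ord0 i) = ('X_i)%:P.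
Proof. by rewrite (svalP peel_exists) liftK. Qed.

Lemma coef_peelX0 f j : (peel ('X_ord0 * f))`_j = if j == 0%N then 0 else (peel f)`_j.-1.
Proof. by rewrite rmorphM peelX0; apply: coefXM. Qed.

Lemma act_peel (X : sqspace) (f : {mpoly 'F_2[s.+1]}) (c : L X s.+1) a (N : nat) :
  (size (peel f) <= N)%N ->
  ser_at (act f c) a = \sum_(j < N) act (peel f)`_j (ser_at c (a - j%:Z)).
Proof.
pose F f c a j := act (peel f)`_j (ser_at (c : L X s.+1) (a - j%:Z)).
suff [M FM] : exists M, forall N, (M <= N)%N -> forall c a,
    ser_at (act f c) a = \sum_(j < N) F f c a j.
  move=> fN; rewrite (FM (maxn M N)) ?leq_maxl //.
  rewrite (big_ord_trim (F := F f c a) (leq_maxr M N)) // => i /andP[Ni _].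
  by rewrite /F nth_default ?act0l // (leq_trans fN).
move: {N c a} f; apply: mpoly_alg_ind => [|f g [M IH] [M' IH']||i f [M IH]].
- by exists 0%N => N _ c a; rewrite act0l big1 // => j _; rewrite /F rmorph0 coef0 act0l.
- exists (maxn M M') => N; rewrite geq_max => /andP[MN MN'] c a.
  rewrite actDl ser_atD (IH N) // (IH' N) // -big_split; apply: eq_bigr => j _.
  by rewrite /F rmorphD coefD actDl.
- exists 1%N => -[//|N] _ c a; rewrite big_ord_recl big1 => [|j _].
    by rewrite /F rmorph1 coef1 !act1 subr0 addr0.
  by rewrite /F rmorph1 coef1 act0l.
exists M.+1 => N MN c a; rewrite actXM.
have [j ->|->] := unliftP ord0 i.
  rewrite opSS (IH N) 1?ltnW // linear_sum; apply: eq_bigr => h _.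
  by rewrite /F rmorphM peelX coefCM actXM.
case: N MN => // N MN; rewrite opS0 shiftE (IH N) // big_ord_recl.
have F0 : F ('X_ord0 * f) c a 0%N = 0.
  by rewrite /F; have -> := coef_peelX0 f 0; rewrite act0l.
rewrite [X in _ = X + _](F0 : _ = 0).
rewrite add0r; apply: eq_bigr => j _.
rewrite /F coef_peelX0 /= /bump add1n.
by congr (act _ (ser_at _ _)); lia.
Qed.

Lemma blockE (A : 'M['F_2]_1) (B : 'rV_s) (C : 'cV_s) (D : 'M_s)
    (T : 'M_s.+1 := block_mx A B C D) :
  [/\ T ord0 ord0 = A 0 0, forall j, T ord0 (lift ord0 j) = B 0 j,
      forall i, T (lift ord0 i) ord0 = C i 0
    & forall i j, T (lift ord0 i) (lift ord0 j) = D i j].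
Proof.
split=> [|j|i|i j].
- rewrite -(block_mxEul A B C D); congr (fun_of_matrix _ _ _); exact: val_inj.
- rewrite -(block_mxEur A B C D); congr (fun_of_matrix _ _ _); exact: val_inj.
- rewrite -(block_mxEdl A B C D); congr (fun_of_matrix _ _ _); exact: val_inj.
- rewrite -(block_mxEdr A B C D); congr (fun_of_matrix _ _ _); exact: val_inj.
Qed.

Lemma gl_lift0 (g : 'M['F_2]_s) :
  gl (lift0_mx g) 'X_ord0 = 'X_ord0 /\
  forall i, gl (lift0_mx g) 'X_(lift ord0 i) = up s (gl g 'X_i).
Proof.
have [E00 E0S ES0 ESS] := blockE 1%:M 0 0 g.
split=> [|i]; rewrite glX big_ord_recl.
  rewrite E00 mxE eqxx scale1r big1 ?addr0 // => j _.
  by rewrite E0S mxE scale0r.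
rewrite ES0 mxE scale0r add0r glX rmorph_sum.
by apply: eq_bigr => j _; rewrite F2_morphZ upX ESS.
Qed.

Lemma peel_up f : peel (up s f) = f%:P.
Proof.
pose h : {rmorphism {mpoly 'F_2[s]} -> {poly {mpoly 'F_2[s]}}} := peel \o up s.
by apply: (@mpoly_rmorph_eq _ _ h (@polyC _)) => i; rewrite /h /= upX peelX.
Qed.

Lemma peel_lift0 (g : 'M['F_2]_s) f :
  peel (gl (lift0_mx g) f) = map_poly (gl g) (peel f).
Proof.
pose h1 : {rmorphism {mpoly 'F_2[s.+1]} -> {poly {mpoly 'F_2[s]}}} :=
  peel \o gl (lift0_mx g).
pose h2 : {rmorphism {mpoly 'F_2[s.+1]} -> {poly {mpoly 'F_2[s]}}} :=
  map_poly (gl g) \o peel.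
apply: (@mpoly_rmorph_eq _ _ h1 h2) => i; rewrite /h1 /h2 /=.
have [g0 gS] := gl_lift0 g; have [j ->|->] := unliftP ord0 i.
  by rewrite gS peel_up peelX map_polyC.
by rewrite g0 peelX0 map_polyX.
Qed.

Lemma lift0_unit (g : 'M['F_2]_s) : g \in unitmx -> (lift0_mx g : 'M_s.+1) \in unitmx.
Proof. by rewrite !unitmxE (@det_ublock _ 1 s) det1 mul1r. Qed.

Lemma peel_gl_inv f g : dickson f -> g \in unitmx -> map_poly (gl g) (peel f) = peel f.
Proof.
by move=> /dicksonP D gU; rewrite -peel_lift0 D // lift0_unit.
Qed.

Lemma peel_dickson f i : dickson f -> dickson (peel f)`_i.
Proof. by move=> D; move: i; apply/coef_dickson => g; apply: peel_gl_inv. Qed.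

Lemma peel_translate (l : 'rV['F_2]_s) f : dickson f ->
  peel f \Po ('X + (lform l)%:P) = peel f.
Proof.
(* The substitution u_1 |-> u_1 + l, fixing the other variables. *)
pose T : 'M['F_2]_s.+1 := block_mx (1%:M : 'M_1) l 0 1%:M.
have TU : T \in unitmx by rewrite unitmxE (@det_ublock _ 1 s) !det1 mulr1 unitr1.
move=> /dicksonP D; rewrite -{2}(D T TU).
pose h1 : {rmorphism {mpoly 'F_2[s.+1]} -> {poly {mpoly 'F_2[s]}}} :=
  comp_poly ('X + (lform l)%:P) \o peel.
pose h2 : {rmorphism {mpoly 'F_2[s.+1]} -> {poly {mpoly 'F_2[s]}}} := peel \o gl T.
apply: (@mpoly_rmorph_eq _ _ h1 h2) => i; rewrite /h1 /h2 /=.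
have [E00 E0S ES0 ESS] := blockE 1%:M l 0 1%:M.
rewrite glX big_ord_recl; have [j ->|->] := unliftP ord0 i.
  rewrite peelX comp_polyC ES0 mxE scale0r add0r.
  rewrite (bigD1 j) //= big1 => [|h /negbTE hj]; last first.
    by rewrite ESS mxE eq_sym hj scale0r.
  by rewrite ESS mxE eqxx scale1r addr0 peelX.
rewrite peelX0 comp_polyX E00 mxE eqxx scale1r rmorphD /= peelX0.
congr (_ + _); rewrite -peel_up; congr (peel _); rewrite /lform rmorph_sum.
by apply: eq_bigr => j _; rewrite F2_morphZ upX E0S.
Qed.

End Peel.

Lemma poly_roots_dvd (R : idomainType) (rs : seq R) (p : {poly R}) :
  uniq rs -> (forall x, x \in rs -> root p x) ->
  exists q, p = q * \prod_(x <- rs) ('X - x%:P).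
Proof.
elim: rs p => [|x rs IH] p /=; first by exists p; rewrite big_nil mulr1.
move=> /andP[xrs rs_uniq] rp.
have /factor_theorem[q pE] : root p x by rewrite rp ?mem_head.
have [y yrs|q' q'E] := IH q rs_uniq.
  have := rp y; rewrite inE yrs orbT => /(_ isT).
  rewrite pE rootM => /orP[//|]; rewrite root_XsubC => /eqP yx.
  by rewrite -yx yrs in xrs.
by exists q'; rewrite big_cons pE q'E -!mulrA; congr (_ * _); rewrite mulrC.
Qed.

Section ParabolicInvariants.
Variable s : nat.
Let R := {mpoly 'F_2[s]}.

Let W : {poly R} := \prod_(l : 'rV['F_2]_s) ('X + (lform l)%:P).

Let WE : W = \prod_(x <- [seq lform l | l <- enum 'rV['F_2]_s]) ('X - x%:P).
Proof.
rewrite big_map big_enum; apply: eq_bigr => l _; congr (_ + _).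
by rewrite -rmorphN; congr (_%:P); rewrite oppv.
Qed.

Let W_monic : W \is monic.
Proof. by rewrite WE monic_prod_XsubC. Qed.

Let size_W : (1 < size W)%N.
Proof.
rewrite WE size_prod_XsubC size_map -cardE card_mx card_ord mul1n ltnS.
by rewrite expn_gt0.
Qed.

Let W_translate l : W \Po ('X + (lform l)%:P) = W.
Proof.
rewrite /W rmorph_prod [RHS](reindex_inj (addrI l)) /=; apply: eq_bigr => m _.
by rewrite rmorphD /= comp_polyX comp_polyC lformD polyCD addrA.
Qed.

(** By translation invariance F - F(0) vanishes at every linear form, so it is divisible by their
    product W. The quotient is invariant as well and of smaller degree, which gives an expansion in
    powers of W. *)
Lemma parabolic_invariants (F : {poly R}) :
  (forall l : 'rV['F_2]_s, F \Po ('X + (lform l)%:P) = F) ->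
  (forall g, g \in unitmx -> map_poly (gl g) F = F) ->
  exists r : seq R, (forall j, dickson r`_j) /\
    F = \sum_(j < size r) (r`_j)%:P * W ^+ j.
Proof.
have [n] := ubnP (size F); elim: n F => // n IH F Fn Ft Fg.
have F0 : dickson F`_0 by apply: (iffLR (coef_dickson F)).
have [F1|F1] := leqP (size F) 1.
  exists [:: F`_0]; split=> [[|[|j]] //=|]; try exact: dickson0.
  by rewrite big_ord1 expr0 mulr1 /= -size1_polyC.
have l_uniq : uniq [seq lform l | l <- enum 'rV['F_2]_s].
  by rewrite map_inj_uniq ?enum_uniq //; apply: lform_inj.
have l_root x : x \in [seq lform l | l <- enum 'rV['F_2]_s] -> root (F - (F`_0)%:P) x.
  case/mapP=> l _ ->; rewrite rootE !hornerE -horner_coef0 -{2}(Ft l).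
  by rewrite horner_comp !hornerE subrr.
have [q qE] := poly_roots_dvd l_uniq l_root.
rewrite -WE in qE.
have W0 : W != 0 by apply: monic_neq0.
have qn : (size q < n)%N.
  have [->|q0] := eqVneq q 0; first by rewrite size_poly0; lia.
  have : (size (q * W)%R <= size F)%N.
    rewrite -qE; apply: leq_trans (size_polyD _ _) _; rewrite geq_max leqnn.
    by rewrite size_polyN (leq_trans (size_polyC_leq1 _)) // ltnW.
  rewrite size_Mmonic // -(ltn_predK size_W) addnS /= => qWF.
  apply: leq_trans (Fn : (size F <= n)%N); apply: leq_trans qWF.
  by rewrite -addn1 leq_add2l -ltnS (ltn_predK size_W).
have [l|g gU|r [rD rE]] := IH q qn.
- apply: (mulIf W0); rewrite -{1}(W_translate l) -rmorphM -qE rmorphB /=.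
  by rewrite Ft comp_polyC.
- apply: (mulIf W0).
  have WD : map_poly (gl g) W = W.
    rewrite /W (gl_prod_lform (F := fun x => 'X + x%:P)) // => l.
    by rewrite rmorphD /= map_polyX map_polyC.
  rewrite -{1}WD -rmorphM -qE rmorphB /= Fg // map_polyC /=.
  by rewrite (iffLR (dicksonP _) F0).
exists (F`_0 :: r); split=> [[|j] //=|].
rewrite /= big_ord_recl expr0 mulr1 /= -[LHS](subrK (F`_0)%:P) addrC qE rE.
congr (_ + _); rewrite mulr_suml; apply: eq_bigr => j _.
by rewrite exprSr mulrA.
Qed.

End ParabolicInvariants.

Section Last.

Lemma wid_exists s : {h : {rmorphism {mpoly 'F_2[s]} -> {mpoly 'F_2[s.+1]}} |
  forall i, h 'X_i = 'X_(widen_ord (leqnSn s) i)}.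
Proof. exact: msubst_exists. Qed.

Definition wid s := sval (wid_exists s).

Lemma widX s i : wid s 'X_i = 'X_(widen_ord (leqnSn s) i).
Proof. exact: (svalP (wid_exists s)). Qed.

Definition bigV s : {mpoly 'F_2[s.+1]} :=
  \prod_(l : 'rV['F_2]_s) ('X_ord_max + wid s (lform l)).

Lemma up_wid s f : up s.+1 (wid s f) = wid s.+1 (up s f).
Proof.
pose h1 : {rmorphism {mpoly 'F_2[s]} -> {mpoly 'F_2[s.+2]}} := up s.+1 \o wid s.
pose h2 : {rmorphism {mpoly 'F_2[s]} -> {mpoly 'F_2[s.+2]}} := wid s.+1 \o up s.
apply: (@mpoly_rmorph_eq _ _ h1 h2) => i; rewrite /h1 /h2 /= widX !upX widX.
by congr ('X_ _); apply: val_inj.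
Qed.

Lemma sharp_form s l : sharp s.+1 ('X_ord_max + wid s (lform l)) =
  up s.+1 ('X_ord_max + wid s (lform l)) *
    (up s.+1 ('X_ord_max + wid s (lform l)) + 'X_ord0).
Proof.
pose m : 'rV['F_2]_s.+1 := \row_j (if unlift ord_max j is Some i then l 0 i else 1).
suff -> : 'X_ord_max + wid s (lform l) = lform m by exact: sharp_lform.
rewrite [RHS]/lform big_ord_recr addrC mxE unlift_none scale1r; congr (_ + _).
rewrite rmorph_sum; apply: eq_bigr => j _ /=; rewrite F2_morphZ widX mxE.
rewrite (_ : widen_ord _ j = lift ord_max j); last first.
  by apply: val_inj; rewrite /= /bump leqNgt ltn_ord.
by rewrite liftK.
Qed.

(** The factors pair off as y and y + u_1, with product y (y + u_1). Thus V is obtained from the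
    innermost variable by iterating [sharp]. *)
Lemma bigVS s : bigV s.+1 = sharp s.+1 (bigV s).
Proof.
rewrite /bigV big_rowS rmorph_prod; apply: eq_bigr => l _ /=.
have -> : lform (row_mx (0%:M : 'rV_1) l : 'rV_s.+1) = up s (lform l).
  by rewrite lform_row_mx scale0r add0r.
have -> : lform (row_mx (1%:M : 'rV_1) l : 'rV_s.+1) = 'X_ord0 + up s (lform l).
  by rewrite lform_row_mx scale1r.
rewrite sharp_form !rmorphD /= up_wid upX widX.
rewrite (_ : lift ord0 ord_max = ord_max); last exact: val_inj.
rewrite (_ : widen_ord _ ord0 = ord0); last exact: val_inj.
by congr (_ * _); rewrite -addrA; congr (_ + _); rewrite addrC.
Qed.

Lemma bigV0 : bigV 0 = 'X_ord0.
Proof.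
rewrite /bigV (bigD1 0) //= big1 => [|l /eqP[]]; last by apply/rowP => -[].
by rewrite mulr1 lform0 rmorph0 addr0; congr ('X_ _); apply: val_inj.
Qed.

Lemma bigV_homog s : bigV s \is (2 ^ s).-homog.
Proof.
elim: s => [|s IH]; first by rewrite bigV0; exact: mpoly_homogX.
rewrite bigVS expnS; apply: homog_subst IH => i.
rewrite sharpX -[2%N]/(1 + 1)%N; apply: dhomogM; first exact: mpoly_homogX.
by rewrite rpredD ?mpoly_homogX.
Qed.

Lemma dickson_decomposition s k (f : {mpoly 'F_2[s.+1]}) :
  dickson f -> f \is k.-homog ->
  exists r : seq {mpoly 'F_2[s]},
    [/\ forall j, dickson r`_j,
        forall j, (2 ^ s * j <= k)%N -> r`_j \is (k - 2 ^ s * j).-homog,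
        forall j, (k < 2 ^ s * j)%N -> r`_j = 0
      & f = \sum_(j < size r) wid s r`_j * bigV s ^+ j].
Proof.
move=> fD fk.
have [l|g|r [rD fE]] := @parabolic_invariants s (peel s f).
- exact: peel_translate.
- exact: peel_gl_inv.
pose ev : {rmorphism {poly {mpoly 'F_2[s]}} -> {mpoly 'F_2[s.+1]}} :=
  horner_eval 'X_ord_max \o map_poly (wid s).
(* The cyclic permutation taking the first variable to the last. As f is invariant under it, its
   expansion in the first variable is also one in the last, where the residue is taken. *)
pose c i : 'I_s.+1 := if unlift ord0 i is Some j then widen_ord (leqnSn s) j else ord_max.
have c_inj : injective c.
  move=> i i'; rewrite /c; case: unliftP => [j ->|->]; case: unliftP => [j' ->|->] //.
  - by move/(congr1 val) => /= /val_inj ->.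
  - by move/(congr1 val) => /= jE; have := ltn_ord j; rewrite jE ltnn.
  - by move/(congr1 val) => /= jE; have := ltn_ord j'; rewrite -jE ltnn.
have evf : ev (peel s f) = f.
  rewrite -[RHS](iffLR (dicksonP f) fD (perm_mx (perm c_inj)) (unitmx_perm _ _)).
  pose h : {rmorphism {mpoly 'F_2[s.+1]} -> {mpoly 'F_2[s.+1]}} := ev \o peel s.
  apply: (@mpoly_rmorph_eq _ _ h) => i; rewrite /h /= gl_perm permE /c /ev /=.
  case: unliftP => [j ->|->].
    by rewrite peelX map_polyC /horner_eval hornerC; apply: widX.
  by rewrite peelX0 map_polyX /horner_eval hornerX.
have evE : f = \sum_(j < size r) wid s r`_j * bigV s ^+ j.
  rewrite -{1}evf fE rmorph_sum; apply: eq_bigr => j _.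
  rewrite rmorphM rmorphXn rmorph_prod /ev /= map_polyC /horner_eval hornerC.
  congr (_ * _ ^+ _); apply: eq_bigr => l _.
  by rewrite rmorphD /= map_polyX map_polyC hornerD hornerX hornerC.
(* The coefficients found so far need not be homogeneous; only the component of degree k - 2^s j
   contributes to f, which is homogeneous of degree k. *)
pose r' := mkseq (fun j => if (2 ^ s * j <= k)%N then pihomog mdeg (k - 2 ^ s * j) r`_j
                           else 0) (size r).
have r'E j : r'`_j = if (2 ^ s * j <= k)%N then pihomog mdeg (k - 2 ^ s * j) r`_j else 0.
  have [jr|jr] := ltnP j (size r); first by rewrite nth_mkseq.
  by rewrite nth_default ?size_mkseq // nth_default // raddf0; case: ifP.
exists r'; split=> [j|j jk|j kj|].
- rewrite r'E; case: ifP => _; [exact: dickson_pihomog | exact: dickson0].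
- by rewrite r'E jk pihomogP.
- by rewrite r'E leqNgt kj.
rewrite size_mkseq -{1}(pihomog_dE fk) evE raddf_sum; apply: eq_bigr => j _ /=.
rewrite r'E; have Vj := homog_exp j (bigV_homog s).
have wid1 i : wid s 'X_i \is 1.-homog by rewrite widX mpoly_homogX.
case: leqP => jk.
  rewrite -(@pihomog_subst _ _ 1 (2 ^ s * j)) //.
  by congr (pihomog _ _ _); lia.
rewrite rmorph0 mul0r {1}(mpolyE r`_j) rmorph_sum mulr_suml raddf_sum big1 // => m _ /=.
rewrite F2_morphZ -scalerAl linearZ /=.
rewrite (pihomog_ne0 (d := (mdeg m + 2 ^ s * j)%N)) ?scaler0 //; first by apply/eqP; lia.
by rewrite dhomogM // -[mdeg m]mul1n homog_subst // dhomogX.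
Qed.

End Last.

(** * Naturality, and residues of f St_s(x) *)

Section Naturality.
Variables (X Y : sqspace) (T : {linear X -> Y}).
Hypothesis sqT : forall k x, T (sq k x) = sq k (T x).

Lemma sq_sermap k c : sermap T (sq k c) = sq k (sermap T c).
Proof.
apply: serP => a; rewrite sermapE !(@sq_serE _ _ _ _ `|k|.+1); try lia.
by rewrite linear_sum; apply: eq_bigr => i _ /=; rewrite linearZ /= sqT.
Qed.

Lemma sermap_st1 e y : sermap T (st1 e y) = st1 e (T y).
Proof. by apply: serP => a; rewrite sermapE !st1E sqT. Qed.
End Naturality.

Section Lmap.
Variables (X Y : sqspace) (T : {linear X -> Y}).

Fixpoint Lmap s : {linear L X s -> L Y s} :=
  match s with 0 => T | s'.+1 => sermap (Lmap s') end.

Lemma LmapS s c a : ser_at (Lmap s.+1 c) a = Lmap s (ser_at c a).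
Proof. by []. Qed.

Lemma Lmap_op s (i : 'I_s) c : Lmap s (op X s i c) = op Y s i (Lmap s c).
Proof.
elim: s i c => [[]//|s IH] i c; apply: serP => a.
have [j ->|->] := unliftP ord0 i; last by rewrite opS0 LmapS !shiftE.
by rewrite LmapS !opSS IH.
Qed.

Lemma Lmap_act s f c : Lmap s (act f c) = act f (Lmap s c).
Proof.
by apply: (@act_semilinear X Y s s _ idfun) => i {}c; rewrite act_op Lmap_op.
Qed.

Hypothesis sqT : forall k x, T (sq k x) = sq k (T x).

Lemma sq_Lmap s k c : Lmap s (sq k c) = sq k (Lmap s c).
Proof. by elim: s k c => [|s IH] k c; [apply: sqT | apply: sq_sermap]. Qed.

Lemma Lmap_stn s d x : Lmap s (stn X s d x) = stn Y s d (T x).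
Proof.
by elim: s => //= s IH; rewrite (sermap_st1 (@sq_Lmap s)) IH.
Qed.
End Lmap.

Section Residue.
Variable X : sqspace.

Definition res0 (c : ser X) : X := ser_at c (-1).
Fact res0_linear : linear res0.
Proof. by move=> k c d; rewrite /res0 ser_atD ser_atZ. Qed.
HB.instance Definition _ :=
  GRing.isLinear.Build 'F_2 (ser X) X *:%R res0 res0_linear.

(** In the Cartan sum at u^(-1), the coefficient of c at u^(-1-i) enters with C(-1-i, i), which is
    even for i > 0. *)
Lemma sq_res0 k c : res0 (sq k c) = sq k (res0 c).
Proof.
have [k0|] := ltP k 0; first by rewrite !sq_lt0 ?linear0.
case: k => // k _; rewrite /res0 (@sq_serE _ _ _ _ k.+1); last lia.
rewrite big_ord_recl !subr0 bz_n0 scale1r big1 ?addr0 // => i _.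
by rewrite bz_neg_diag scale0r.
Qed.

Fixpoint res s : {linear L X s.+1 -> L X s} :=
  match s with 0 => res0 | s'.+1 => sermap (res s') end.

Lemma resS s c a : ser_at (res s.+1 c) a = res s (ser_at c a).
Proof. by []. Qed.

Lemma sq_res s k c : res s (sq k c) = sq k (res s c).
Proof. by elim: s k c => [|s IH] k c; [apply: sq_res0 | apply: sq_sermap]. Qed.

Lemma res_op s (i : 'I_s) c : res s (op X s.+1 i c) = op X s i (res s c).
Proof.
elim: s i c => [[]//|s IH] i c; apply: serP => a.
have [j ->|->] := unliftP ord0 i; first by rewrite resS !opSS IH.
by rewrite resS opS0 !shiftE -resS.
Qed.

Lemma res_wid s g c : res s (act (wid s g) c) = act g (res s c).
Proof.
elim/mpoly_alg_ind: g => [|f g IHf IHg||i f IH].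
- by rewrite rmorph0 !act0l linear0.
- by rewrite rmorphD !actDl linearD /= IHf IHg.
- by rewrite rmorph1 !act1.
by rewrite rmorphM widX !actXM res_op IH.
Qed.

(* [St_s(y)] for [y] in [F[u^(+-1)] (x) X] of degree [e]; the inner variable
   becomes the last one. *)
Fixpoint stl s (e : int) : {linear ser X -> L X s.+1} :=
  match s with
  | 0 => idfun
  | s'.+1 => st1 ((2 ^ s')%N%:Z * e) \o stl s' e
  end.

Lemma stlS s e y : stl s.+1 e y = st1 ((2 ^ s)%N%:Z * e) (stl s e y).
Proof. by []. Qed.

Lemma stn_stl s d x : stn X s.+1 d x = stl s (2 * d) (st1 d x).
Proof.
elim: s => [|s IH]; first by rewrite stnS mul1r.
by rewrite stnS IH stlS expnS PoszM; congr (st1 _ _); ring.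
Qed.

Lemma res_stl s e y : res s (stl s e y) = stn X s e (res0 y).
Proof.
elim: s => [|s IH] //=.
by rewrite (sermap_st1 (@sq_res s)) IH.
Qed.

(** V is St_s of the innermost variable u, so multiplying by V outside amounts to multiplying by u
    inside, at the cost of one degree. *)
Lemma stl_bigV s e y : act (bigV s) (stl s e y) = stl s (e + 1) (shift 1 y).
Proof.
elim: s => [|s IH]; first by rewrite bigV0 act_op.
rewrite bigVS stlS -(st1_act _ _ (bigV_homog s)) IH stlS.
by congr (st1 _ _); ring.
Qed.

Lemma stl_bigVn s e y n :
  act (bigV s ^+ n) (stl s e y) = stl s (e + n%:Z) (shift n%:Z y).
Proof.
elim: n => [|n IH]; first by rewrite expr0 act1 addr0 shift0.
by rewrite exprS actM IH stl_bigV shift_shift; congr (stl _ _ (shift _ _)); lia.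
Qed.

(** Once V^n has become u^n inside St_s, the residue is that of u^n St_1(x): the coefficient of
    u^(-1-n) in St_1(x). *)
Lemma res_bigV s g n (d : int) x :
  res s (act (wid s g * bigV s ^+ n) (stn X s.+1 d x)) =
  act g (stn X s (2 * d + n%:Z) (sq (d + n%:Z + 1) x)).
Proof.
rewrite actM res_wid stn_stl stl_bigVn res_stl /res0 shiftE st1E.
by congr (act _ (stn _ _ _ (sq _ _))); lia.
Qed.

Lemma res_act_stn s k f : @dickson s.+1 f -> f \is k.-homog ->
  exists r : seq {mpoly 'F_2[s]},
    [/\ forall j, dickson r`_j,
        forall j, (2 ^ s * j <= k)%N -> r`_j \is (k - 2 ^ s * j).-homog,
        forall j, (k < 2 ^ s * j)%N -> r`_j = 0
      & forall d x, res s (act f (stn X s.+1 d x)) =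
          \sum_(j < size r) act r`_j (stn X s (2 * d + j%:Z) (sq (d + j%:Z + 1) x))].
Proof.
move=> fD fk; have [r [rD rk r0 fE]] := dickson_decomposition fD fk.
exists r; split=> // d x; rewrite {1}fE act_suml linear_sum.
by apply: eq_bigr => j _; apply: res_bigV.
Qed.

End Residue.

(** * Vanishing of the double residue *)

Section AdemVanishing.

(** The coefficient of z^k in (1+z)^n (1+z+z^2)^b, with the trinomial expanded as 1 + z(1+z) and as
    (1+z) + z^2. *)
Lemma bz_trinomial (n k : int) (b : nat) :
  \sum_(j < b.+1) 'C(b, j)%:R * bz (n + j%:Z) (k - j%:Z) =
  \sum_(i < b.+1) 'C(b, i)%:R * bz (n + b%:Z - i%:Z) (k - 2 * i%:Z).
Proof.
apply/eqP; rewrite -subr_eq0; apply/eqP; move: n k.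
apply: (@pascal_vanish _ _ 0) => [n k|n k k0|k].
- rewrite [RHS]addrACA -opprD -!big_split /=.
  congr (_ - _); apply: eq_bigr => i _; rewrite -mulrDr; congr (_ * _).
  + by rewrite (_ : n + 1 + i%:Z = n + i%:Z + 1) ?bz_pascal;
      [congr (_ + bz _ _) | ]; lia.
  + by rewrite (_ : n + 1 + b%:Z - i%:Z = n + b%:Z - i%:Z + 1) ?bz_pascal;
      [congr (_ + bz _ _) | ]; lia.
- by rewrite !big1 ?subr0 // => i _; rewrite bz_lt0 ?mulr0 //; lia.
case: k => [k|k]; last first.
  by rewrite !big1 ?subr0 // => i _; rewrite bz_lt0 ?mulr0 //; lia.
apply/eqP; rewrite subr_eq0; apply/eqP.
have co m l : ((1 + 'X : {poly 'F_2}) ^+ m)`_l = 'C(m, l)%:R.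
  by rewrite -['X]mul1r -[X in X * 'X]/(1%:P) coef_exp_1aCX expr1n.
transitivity ((1 + ('X + 'X^2) : {poly 'F_2}) ^+ b)`_k.
  rewrite exprDn coef_sum; apply: eq_bigr => j _.
  rewrite expr1n mul1r coefMn -[RHS]mulr_natl; congr (_ * _).
  rewrite (_ : 'X + 'X^2 = 'X * (1 + 'X)); last ring.
  rewrite exprMn coefXnM co add0r; case: ltnP => jk; first by rewrite bz_lt0 //; lia.
  by rewrite (_ : k%:Z - j%:Z = (k - j)%N) //; lia.
rewrite addrA exprDn coef_sum; apply: eq_bigr => i _.
rewrite coefMn -[LHS]mulr_natl -exprM mulrC [_ * 'X^_]mulrC coefXnM co add0r mulrC; congr (_ * _).
have ib : (i <= b)%N by rewrite -ltnS.
rewrite (_ : b%:Z - i%:Z = (b - i)%N); last lia.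
case: ltnP => ik; first by rewrite bz_lt0 //; lia.
by rewrite (_ : k%:Z - 2 * i%:Z = (k - 2 * i)%N) //; lia.
Qed.

Variable X : sqspace.
Hypothesis bm : bullett_macdonald X.

(** For e = n - a - 1 and k = a, the left-hand side of [bm_binomial] has the coefficients
    C(-1-(a-b), a-b), of which only the one with b = a is odd. Allowing negative upper entries
    removes the condition on the two indices from the Adem relations. *)
Lemma adem_int (n a : int) (N : nat) (x : X) : n < N%:Z ->
  sq a (sq (n - a) x) =
  \sum_(j < N) bz (n - a - 1 - j%:Z) (a - 2 * j%:Z) *: sq (n - j%:Z) (sq j x).
Proof.
move=> nN; rewrite -(@bm_binomial X bm) //.
have bzE (i : nat) : bz (n - a - 1 - n + i%:Z) (a - i%:Z) = (a == i%:Z)%:R.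
  rewrite (_ : n - a - 1 - n + i%:Z = -1 - (a - i%:Z)); last ring.
  by rewrite bz_neg_diag subr_eq0.
under eq_bigr => i _ do rewrite bzE.
have [a0|] := ltP a 0.
  by rewrite sq_lt0 // big1 // => i _; rewrite (_ : (a == i) = false) ?scale0r //; lia.
case: a {bzE} => // a _; have [aN|Na] := ltnP a N.
  rewrite (bigD1 (Ordinal aN)) //= eqxx scale1r big1 ?addr0 // => i /eqP ia.
  rewrite (_ : (Posz a == i) = false) ?scale0r //; apply/eqP => -[ai].
  by apply: ia; apply: val_inj.
rewrite (sq_lt0 (i := n - a%:Z)) ?linear0; last lia.
rewrite big1 // => i _; rewrite (_ : (Posz a == i) = false) ?scale0r //.
by have := ltn_ord i; lia.
Qed.

(** After expansion by [adem_int], the coefficient of Sq^(n-J) Sq^J is by [bz_trinomial] a sum of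
    multiples of C(m-1, 2m-1) for integers m; these are 0, as 2m - 1 is either negative or larger
    than m - 1 >= 0. *)
Lemma adem_vanish (A : int) (b : nat) (x : X) :
  \sum_(j < b.+1) 'C(b, j)%:R *:
    sq (2 * A + 2 * b%:Z - 1 - j%:Z) (sq (A + j%:Z) x) = 0.
Proof.
pose n := 3 * A + 2 * b%:Z - 1; pose N := `|n|.+1.
have nN : n < N%:Z by rewrite /N; lia.
transitivity (\sum_(j < b.+1) 'C(b, j)%:R *: \sum_(J < N)
    bz (A + j%:Z - 1 - J%:Z) (2 * A + 2 * b%:Z - 1 - j%:Z - 2 * J%:Z) *:
    sq (n - J%:Z) (sq J x)).
  apply: eq_bigr => j _; congr (_ *: _).
  have := @adem_int n (2 * A + 2 * b%:Z - 1 - j%:Z) N x nN.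
  by rewrite (_ : n - (2 * A + 2 * b%:Z - 1 - j%:Z) = A + j%:Z) // /n; ring.
under eq_bigr => j _ do rewrite scaler_sumr.
rewrite exchange_big big1 // => J _ /=.
under eq_bigr => j _ do rewrite scalerA.
rewrite -scaler_suml (_ : \sum_(j < b.+1) _ = 0) ?scale0r //.
pose P := A - J%:Z.
transitivity (\sum_(j < b.+1) 'C(b, j)%:R *
    bz (P - 1 + j%:Z) (2 * P + 2 * b%:Z - 1 - j%:Z)).
  by apply: eq_bigr => j _; congr (_ * bz _ _); rewrite /P; ring.
rewrite bz_trinomial big1 // => i _.
rewrite (_ : 2 * P + 2 * b%:Z - 1 - 2 * i%:Z = 2 * (P + b%:Z - i%:Z) - 1); last ring.
rewrite (_ : P - 1 + b%:Z - i%:Z = (P + b%:Z - i%:Z) - 1); last ring.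
case: (P + b%:Z - i%:Z) => [[|p]|p]; last 2 first.
- rewrite (_ : p.+1%:Z - 1 = p); last lia.
  rewrite (_ : 2 * p.+1%:Z - 1 = (2 * p).+1); last lia.
  by rewrite bz_nat (@bin_small p) ?mulr0 //; lia.
- by rewrite bz_lt0 ?mulr0 //; lia.
by rewrite bz_lt0 ?mulr0.
Qed.

End AdemVanishing.

Section DicksonTwo.

(* [D(2) = F[Q0, Q1]] with [Q0 = uv(u+v)] and [Q1 = u^2 + uv + v^2]. *)
Let u : {mpoly 'F_2[2]} := wid 1 'X_ord0.
Let V : {mpoly 'F_2[2]} := bigV 1.
Let Q0 := u * V.
Let Q1 := u ^+ 2 + V.

Let uE : u = 'X_ord0.
Proof. by rewrite /u widX; congr ('X_ _); apply: val_inj. Qed.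

Let VE : V = 'X_ord_max * ('X_ord_max + u).
Proof.
rewrite /V bigVS bigV0 sharpX uE.
by rewrite (_ : lift ord0 ord0 = ord_max) //; apply: val_inj.
Qed.

(** Exhibits Q1 and Q0 as coefficients of Vt_2, whence their invariance. *)
Let vt2 : vt 2 = 1 + (Q1%:P * 'X^2 + Q0%:P * 'X^3).
Proof.
have char2 (R : comNzRingType) (x y z : R) : 2%:R = 0 :> R ->
    (1 + x * z + 0 * z ^+ 2) * (1 + x * z + y * z ^+ 2) =
    1 + ((x ^+ 2 + y) * z ^+ 2 + (x * y) * z ^+ 3).
  move=> R2; have -> : (1 + x * z + 0 * z ^+ 2) * (1 + x * z + y * z ^+ 2) =
    1 + ((x ^+ 2 + y) * z ^+ 2 + (x * y) * z ^+ 3) + 2%:R * (x * z) by ring.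
  by rewrite R2 mul0r addr0.
have lf1 (a : 'F_2) : lform (row_mx (a%:M : 'rV_1) (0 : 'rV_0) : 'rV_1) = a *: 'X_ord0.
  by rewrite lform_row_mx lform0 rmorph0 addr0.
rewrite vtS big_rowS (bigD1 0) //= big1 => [|l /eqP[]]; last by apply/rowP => -[].
rewrite mulr1 !lf1 scale0r scale1r rmorph0 polyC0 char2; last first.
  by rewrite -polyC_natr mpoly2 polyC0.
by rewrite /Q1 /Q0 /V bigVS bigV0 uE !(polyCD, polyCM).
Qed.

Let Q1D : dickson Q1.
Proof.
have := @vt_dickson 2 0 1 2; rewrite mul1r expr1 vt2.
by rewrite !coefD !coefCM !coefXn coef1 /= mulr1 mulr0 add0r addr0.
Qed.

Let Q0D : dickson Q0.
Proof.
have := @vt_dickson 2 0 1 3; rewrite mul1r expr1 vt2.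
by rewrite !coefD !coefCM !coefXn coef1 /= mulr1 mulr0 !add0r.
Qed.

Let u_homog : u \is 1.-homog.
Proof. by rewrite uE mpoly_homogX. Qed.

Let Q1_homog : Q1 \is 2.-homog.
Proof. by apply: rpredD; [exact: (homog_exp 2 u_homog) | exact: (bigV_homog 1)]. Qed.

(** The points (1,0) and (0,1) are exchanged by an element of GL_2. A homogeneous invariant
    vanishing at one of them vanishes at both, and this forces divisibility by Q0. *)
Let e10 (i : 'I_2) : 'F_2 := (i == ord0)%:R.
Let e01 (i : 'I_2) : 'F_2 := (i == ord_max)%:R.

Let eval_swap f : dickson f -> meval e10 f = meval e01 f.
Proof.
move=> fD; pose p := tperm (ord0 : 'I_2) ord_max.
rewrite -{1}(iffLR (dicksonP f) fD (perm_mx p) (unitmx_perm _ _)).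
pose h : {rmorphism {mpoly 'F_2[2]} -> 'F_2} := meval e10 \o gl (perm_mx p).
apply: (@mpoly_rmorph_eq _ _ h (meval e01)) => i.
rewrite /h /= gl_perm !mevalXU /e10 /e01 /p.
by case: tpermP => [->|->|/eqP i0 /eqP i1] //; rewrite (negbTE i0) (negbTE i1).
Qed.

Lemma mpoly1_homog k (g : {mpoly 'F_2[1]}) : g \is k.-homog ->
  g = g@_(U_(ord0) *+ k) *: 'X_ord0 ^+ k.
Proof.
move=> gk; apply/mpolyP => m.
rewrite mcoeffZ mpolyXn mcoeffX; case: eqP => [->|mk]; first by rewrite mulr1.
rewrite mulr0; apply: (dhomog_nemf_coeff gk); apply/eqP => mE; apply: mk.
have kE : k = (\sum_(i < 1) m i)%N by rewrite -mE; apply: mdegE.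
by apply/mnmP => i; rewrite mulmnE mnm1E (ord1 i) eqxx mul1n kE big_ord1.
Qed.

Let evalV v : meval v V = v ord_max * (v ord_max + v ord0).
Proof. by rewrite VE mevalM mevalD uE !mevalXU. Qed.

Let eval_u v : meval v u = v ord0.
Proof. by rewrite uE mevalXU. Qed.

(** In one variable, homogeneous polynomials are multiples of powers of u. As V is 0 at (1,0) and u
    is 0 at (0,1), the two evaluations select the coefficients of u^k and of V^(k/2). *)
Let dickson2_decomposition k f : dickson f -> f \is k.-homog ->
  exists (c : nat -> 'F_2) (n : nat),
    [/\ f = \sum_(j < n) c j *: (u ^+ (k - 2 * j) * V ^+ j),
        forall j, (k < 2 * j)%N -> c j = 0, meval e10 f = c 0%N,
        forall j, k = (2 * j)%N -> meval e01 f = c j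
      & odd k -> meval e01 f = 0].
Proof.
move=> fD fk; have [r [_ rk r0 fE]] := dickson_decomposition fD fk.
pose c j := if (2 * j <= k)%N then r`_j@_(U_(ord0) *+ (k - 2 * j)) else 0.
(* Large enough for the indices 0 and k/2 to be in range. *)
pose n := (size r + k).+1.
have c0 j : (k < 2 * j)%N -> c j = 0 by move=> kj; rewrite /c leqNgt kj.
have {}fE : f = \sum_(j < n) c j *: (u ^+ (k - 2 * j) * V ^+ j).
  pose F j := c j *: (u ^+ (k - 2 * j) * V ^+ j).
  rewrite (big_ord_trim (F := F) (m := size r)) => [||j /andP[rj _]]; last 2 first.
  - by rewrite /n; lia.
  - by rewrite /F /c nth_default // mcoeff0 if_same scale0r.
  rewrite fE; apply: eq_bigr => j _; rewrite /F /c.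
  case: leqP => jk; last by rewrite r0 // rmorph0 mul0r scale0r.
  by rewrite [in LHS](mpoly1_homog (rk j jk)) F2_morphZ rmorphXn -scalerAl.
exists c, n.
have e01E : meval e01 f = \sum_(j < n) c j * (0 ^+ (k - 2 * j)).
  rewrite {1}fE raddf_sum; apply: eq_bigr => j _ /=.
  by rewrite mevalZ mevalM !rmorphXn /= eval_u evalV /e01 /= addr0 mulr1 expr1n mulr1.
split=> // [|j kj|k_odd].
- rewrite {1}fE raddf_sum (bigD1 (ord0 : 'I_n)) //= big1 => [|j j0].
    by rewrite mevalZ mevalM !rmorphXn /= eval_u /e10 /= expr1n expr0 !mulr1 addr0.
  rewrite mevalZ mevalM !rmorphXn /= evalV /e10 /= mul0r.
  by rewrite expr0n (_ : (j == 0%N :> nat) = false) ?mulr0 //; apply/negbTE.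
- have jn : (j < n)%N by rewrite /n; lia.
  rewrite e01E (bigD1 (Ordinal jn)) //= big1 => [|i /eqP ij].
    by rewrite kj subnn expr0 mulr1 addr0.
  have [ki|ik] := ltnP k (2 * i); first by rewrite c0 ?mul0r.
  rewrite expr0n (_ : (k - 2 * i == 0)%N = false) ?mulr0 //.
  apply/eqP => ki; apply: ij; apply: val_inj => /=; lia.
- rewrite e01E big1 // => i _.
  have [ki|ik] := ltnP k (2 * i); first by rewrite c0 ?mul0r.
  rewrite expr0n (_ : (k - 2 * i == 0)%N = false) ?mulr0 //.
  by apply/eqP => ki; move: k_odd; rewrite (_ : k = 2 * i)%N ?oddM //; lia.
Qed.

Let Q0_neq0 : Q0 != 0.
Proof.
have neq0 (f : {mpoly 'F_2[2]}) v : meval v f != 0 -> f != 0.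
  by apply: contraNneq => ->; rewrite meval0.
rewrite /Q0 VE !mulf_neq0 //.
- by apply: (neq0 _ e10); rewrite eval_u.
- by apply: (neq0 _ e01); rewrite mevalXU.
- by apply: (neq0 _ e01); rewrite mevalD eval_u mevalXU.
Qed.

(** The pure powers of u and V have coefficient 0, and all other terms are divisible by u V = Q0.
    The quotient is invariant by cancellation. *)
Let dickson2_divide k f : dickson f -> f \is k.-homog -> meval e10 f = 0 ->
  exists f', [/\ dickson f', f' \is (k - 3).-homog, f = f' * Q0
    & (k < 3)%N -> f' = 0].
Proof.
move=> fD fk f0; have [c [n [fE c0 e10E e01E _]]] := dickson2_decomposition fD fk.
pose f' := \sum_(j < n | (0 < j)%N && (2 * j < k)%N)
  c j *: (u ^+ (k - 2 * j).-1 * V ^+ j.-1).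
have fE' : f = Q0 * f'.
  rewrite {1}fE /f' mulr_sumr [RHS]big_mkcond; apply: eq_bigr => j _.
  case: ifP => [/andP[j0 jk]|].
    rewrite -scalerAr; congr (_ *: _); rewrite /Q0 mulrACA -!exprS.
    by rewrite !prednK //; lia.
  move=> jP; suff -> : c j = 0 by rewrite scale0r.
  have [->|j0] := eqVneq (j : nat) 0%N; first by rewrite -e10E.
  have [kj|jk] := ltnP k (2 * j); first exact: c0.
  by rewrite -e01E -?eval_swap //; move: jP j0; lia.
exists f'; split.
- by apply: (@dickson_cancel _ Q0); rewrite -?fE'.
- apply: rpred_sum => j /andP[j0 jk]; rewrite dhomogZ //.
  rewrite (_ : (k - 3 = 1 * (k - 2 * j).-1 + 2 * j.-1)%N); last lia.
  by rewrite dhomogM // homog_exp //; exact: (bigV_homog 1).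
- by rewrite mulrC.
- by move=> k3; apply: big1 => j; lia.
Qed.

Variable X : sqspace.
Hypothesis bm : bullett_macdonald X.

(** V raises the inner exponent and u the outer one, so only the parameter d changes, while x stays
    the same. *)
Let act_Q0 d x : act Q0 (stn X 2 d x) = stn X 2 (d + 1) x.
Proof.
have shift_st1 (Y : sqspace) e (y : Y) : shift 1 (st1 e y) = st1 (e + 1) y.
  by apply: serP => a; rewrite shiftE !st1E; congr (sq _ _); ring.
have VstE : act V (stn X 2 d x) = st1 (2 * d + 1) (st1 (d + 1) x).
  rewrite (stn_stl 1 d x) stl_bigV shift_st1.
  by rewrite (stlS 0) mul1r.
rewrite actM VstE uE act_op opS0 shift_st1 stnS (stnS 0) mul1r.
by congr (st1 _ _); ring.
Qed.

(** Expanding (u^2 + V)^b, the double residues of the terms are the composites of [adem_vanish]. *)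
Let res_Q1 b d x : res X 0 (res X 1 (act (Q1 ^+ b) (stn X 2 d x))) = 0.
Proof.
have term (j : nat) : (j <= b)%N ->
    res X 0 (res X 1 (act ((u ^+ 2) ^+ (b - j) * V ^+ j) (stn X 2 d x))) =
    sq (2 * (d + 1) + 2 * b%:Z - 1 - j%:Z) (sq (d + 1 + j%:Z) x).
  move=> jb; rewrite /u /V -exprM -rmorphXn res_bigV act_X0n stnS.
  rewrite [LHS]/(res0 _) /res0 shiftE st1E.
  by congr (sq _ (sq _ _)); lia.
rewrite /Q1 exprDn act_suml (linear_sum (res X 1)) (linear_sum (res X 0)).
rewrite -[RHS](adem_vanish bm (d + 1) b x).
apply: eq_bigr => j _; rewrite -term ?leq_ord // -scaler_nat actZl.
by rewrite (linearZ_LR (res X 1)) (linearZ_LR (res X 0)).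
Qed.

Let res_res_stn2_homog k f d x : dickson f -> f \is k.-homog ->
  res X 0 (res X 1 (act f (stn X 2 d x))) = 0.
Proof.
move=> fD fk.
have [m] := ubnP k; elim: m k f d x fD fk => // m IH k f d x fD fk km.
have case0 g : dickson g -> g \is k.-homog -> meval e10 g = 0 ->
    res X 0 (res X 1 (act g (stn X 2 d x))) = 0.
  move=> gD gk g0; have [g' [g'D g'k -> g'0]] := dickson2_divide gD gk g0.
  rewrite actM act_Q0; have [k3|k3] := ltnP k 3.
    by rewrite g'0 // act0l !linear0.
  by apply: IH g'k _ => //; lia.
case: (F2_cases (meval e10 f)) => f1; first exact: case0.
have [c [n [_ _ _ _ e01odd]]] := dickson2_decomposition fD fk.
have k_even : ~~ odd k.
  by apply/negP => /e01odd; rewrite -eval_swap // f1.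
pose b := k./2; have kE : k = (2 * b)%N by rewrite mul2n even_halfK.
(* Both f and Q1^b take the value 1 at (1,0), so their sum is divisible by Q0 and the induction
   applies to the quotient. *)
rewrite -[f](addrK (Q1 ^+ b)) oppv actDl (linearD (res X 1)) (linearD (res X 0)).
rewrite res_Q1 addr0.
apply: case0.
- by apply: dicksonD => //; apply: dicksonX.
- by rewrite rpredD // kE homog_exp.
rewrite mevalD f1 rmorphXn /= /Q1 mevalD rmorphXn /= eval_u evalV /e10 /=.
by rewrite mul0r addr0 expr1n expr1n addF2.
Qed.

Lemma res_res_stn2 f d x : dickson f -> res X 0 (res X 1 (act f (stn X 2 d x))) = 0.
Proof.
move=> fD; rewrite (pihomog_partitionE (leqnn (msize f))).
rewrite act_suml (linear_sum (res X 1)) (linear_sum (res X 0)) big1 // => k _.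
by apply: (@res_res_stn2_homog k); [apply: dickson_pihomog | apply: pihomogP].
Qed.

End DicksonTwo.

Section DoubleResidue.
Variable X : sqspace.
Hypothesis bm : bullett_macdonald X.

Definition res_annihilated s (c : L X s.+2) : Prop :=
  forall f, dickson f -> res X s (res X s.+1 (act f c)) = 0.

Lemma sqpoly_coef0 n (f : {mpoly 'F_2[n]}) : (sqpoly n f)`_0 = f.
Proof.
pose h : {rmorphism {mpoly 'F_2[n]} -> {mpoly 'F_2[n]}} :=
  horner_eval 0 \o sqpoly n.
rewrite -horner_coef0; apply: (@mpoly_rmorph_eq _ _ h idfun) => i.
by rewrite /h /= sqpolyX /horner_eval !hornerE.
Qed.

(** The Cartan formula expresses f Sq^k c by Sq^k (f c), which the residues commute with, and by
    terms Sq^i(f) Sq^(k-i) c with i > 0, where Sq^i(f) is again invariant. *)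
Lemma res_annihilated_sq s k c : @res_annihilated s c -> res_annihilated (sq k c).
Proof.
move=> cZ; have [k0|] := ltP k 0.
  by move=> f _; rewrite sq_lt0 // !linear0.
case: k => // k _; have [m] := ubnP k; elim: m k => // m IH k km f fD.
have := @cartan X s.+2 f k%:Z k.+1 c; rewrite big_ord_recl sqpoly_coef0 subr0.
move/(_ ltac:(lia)) => cartE.
have -> : act f (sq k c) = sq k (act f c) +
    \sum_(i < k) act (sqpoly s.+2 f)`_i.+1 (sq (k%:Z - i.+1%:Z) c).
  by rewrite cartE -addrA addv2 addr0.
rewrite (linearD (res X s.+1)) (linearD (res X s)) !sq_res cZ // linear0 add0r.
rewrite (linear_sum (res X s.+1)) (linear_sum (res X s)) big1 // => i _.
rewrite (_ : k%:Z - i.+1%:Z = (k - i.+1)%N); last by have := ltn_ord i; lia.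
by apply: IH; [have := ltn_ord i; lia | exact: sqpoly_dickson].
Qed.

(** The residues act on each coefficient of a power of u_1 separately, and the coefficients of f in
    powers of u_1 are invariants in the remaining variables. *)
Lemma res_annihilated_ser s (c : L X s.+3) :
  (forall a, @res_annihilated s (ser_at c a)) -> @res_annihilated s.+1 c.
Proof.
move=> cZ f fD; apply: serP => a.
rewrite (resS (s := s)) (resS (s := s.+1)).
rewrite (act_peel c a (leqnn (size (peel s.+2 f)))).
rewrite (linear_sum (res X s.+1)) (linear_sum (res X s)).
rewrite big1 // => j _.
by apply: cZ; apply: peel_dickson.
Qed.

(** The coefficients of St_(s+3)(x) in powers of u_1 are of the form Sq^k St_(s+2)(x). *)
Lemma res_annihilated_stn s d x : @res_annihilated s (stn X s.+2 d x).
Proof.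
elim: s => [|s IH]; first by move=> f; apply: res_res_stn2.
by apply: res_annihilated_ser => a; rewrite stnS st1E; apply: res_annihilated_sq.
Qed.

End DoubleResidue.

(** * Relations between the elements f St_s(y) *)

Section LeadingCoefficient.
Variable X : sqspace.

(** The hypothesis is the equality of the tensors sum_i f_i (x) y_i and sum_i f_i (x) z_i, stated
    monomial by monomial so that no tensor product has to be formed. *)
Lemma act_coef_eq s n (f : 'I_n -> {mpoly 'F_2[s]}) (V : lmodType 'F_2)
    (y z : 'I_n -> V) (T : {linear V -> L X s}) :
  (forall m, \sum_i (f i)@_m *: y i = \sum_i (f i)@_m *: z i) ->
  \sum_i act (f i) (T (y i)) = \sum_i act (f i) (T (z i)).
Proof.
pose r := undup (flatten [seq msupp (f i) | i <- enum 'I_n]).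
have fr i : {subset msupp (f i) <= r}.
  move=> m mf; rewrite mem_undup; apply/flattenP; exists (msupp (f i)) => //.
  by apply/mapP; exists i; rewrite ?mem_enum.
move=> yz; have E (w : 'I_n -> V) : \sum_i act (f i) (T (w i)) =
    \sum_(m <- r) mon X s (fun i => nth 0%N m i) (T (\sum_i (f i)@_m *: w i)).
  under [LHS]eq_bigr => i _ do rewrite (act_supp _ (undup_uniq _) (fr i)).
  rewrite exchange_big; apply: eq_bigr => m _; rewrite !linear_sum.
  by apply: eq_bigr => i _; rewrite !linearZ.
by rewrite !E; apply: eq_bigr => m _; rewrite yz.
Qed.

Lemma unpeel s (f : {mpoly 'F_2[s.+1]}) N : (size (peel s f) <= N)%N ->
  f = \sum_(j < N) up s (peel s f)`_j * 'X_ord0 ^+ j.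
Proof.
move=> fN; pose ev : {rmorphism {poly {mpoly 'F_2[s]}} -> {mpoly 'F_2[s.+1]}} :=
  horner_eval 'X_ord0 \o map_poly (up s).
pose h : {rmorphism {mpoly 'F_2[s.+1]} -> {mpoly 'F_2[s.+1]}} := ev \o peel s.
transitivity (h f).
  symmetry; apply: (@mpoly_rmorph_eq _ _ h idfun) => i; rewrite /h /ev /=.
  have [j ->|->] := unliftP ord0 i.
    by rewrite peelX map_polyC /horner_eval hornerC; apply: upX.
  by rewrite peelX0 map_polyX /horner_eval hornerX.
rewrite /h /ev /= /horner_eval (@horner_coef_wide _ N); last first.
  by apply: leq_trans fN; apply: size_poly.
by apply: eq_bigr => j _; rewrite coef_map.
Qed.

(* [St_s(y)] has leading term [u^e (x) y], where the multi-exponent [e] only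
   depends on the degree of [y]. *)
Lemma stn_leading s (d : int) n (f : 'I_n -> {mpoly 'F_2[s]}) (y : 'I_n -> X) :
  \sum_i act (f i) (stn X s d (y i)) = 0 ->
  forall l : {mpoly 'F_2[s]} -> 'F_2, {morph l : a b / a + b} ->
  \sum_i l (f i) *: y i = 0.
Proof.
elim: s f => [|s IH] f f0 l lD.
  have l0 : l 0 = 0 by apply: (addrI (l 0)); rewrite -lD !addr0.
  have E i : l (f i) *: y i = l 1 *: act (f i) (y i).
    rewrite [f i]nvar0_mpolyC; case: (F2_cases (f i)@_0) => ->.
      by rewrite mpolyC0 l0 act0l scaler0 scale0r.
    by rewrite mpolyC1 act1.
  under eq_bigr => i _ do rewrite E.
  by rewrite -scaler_sumr [X in _ *: X]f0 scaler0.
have l0 : l 0 = 0 by apply: (addrI (l 0)); rewrite -lD !addr0.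
pose B := \max_i size (peel s (f i)).
have fB i : (size (peel s (f i)) <= B)%N by apply: leq_bigmax.
(* Descending induction on the power j of u_1, at the exponent e + j: powers below j would need
   operations of negative index, those above j vanish by induction, and j itself contributes
   Sq^0. *)
have key j : forall l' : {mpoly 'F_2[s]} -> 'F_2, {morph l' : a b / a + b} ->
    \sum_i l' (peel s (f i))`_j *: y i = 0.
  have [m] := ubnP (B - j)%N; elim: m j => // m IHm j jm l' l'D.
  have [Bj|jB] := leqP B j.
    have l'0 : l' 0 = 0 by apply: (addrI (l' 0)); rewrite -l'D !addr0.
    rewrite big1 // => i _; rewrite nth_default ?l'0 ?scale0r //.
    by apply: leq_trans Bj.
  apply: (IH (fun i => (peel s (f i))`_j)) => //.
  pose e := (2 ^ s)%N%:Z * d.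
  move/(congr1 (fun c : L X s.+1 => ser_at c (e + j%:Z))): f0.
  rewrite ser_at_sum.
  under eq_bigr => i _ do rewrite (act_peel _ _ (fB i)).
  rewrite exchange_big (bigD1 (Ordinal jB)) //= [X in _ + X]big1 ?addr0.
    move=> f0; transitivity (ser_at (0 : L X s.+1) (e + j%:Z)) => //.
    rewrite -f0; apply: eq_bigr => i _; rewrite st1E /e.
    by rewrite (_ : _ - _ = 0) ?sq_0 //; ring.
  move=> h /eqP hj; under eq_bigr => i _ do rewrite st1E.
  have [hj'|jh] := ltnP h j.
    by rewrite big1 // => i _; rewrite sq_lt0 ?linear0 // /e; lia.
  have {}jh : (j < h)%N.
    by rewrite ltn_neqAle jh andbT; apply/eqP => jh'; apply: hj; apply: val_inj.
  pose T : {linear X -> L X s} := sq (e - (e + j%:Z - h%:Z)) \o stn X s d.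
  rewrite (@act_coef_eq s n (fun i => (peel s (f i))`_h) X y (fun=> 0) T) => [|a].
    by rewrite big1 // => i _; rewrite !linear0.
  rewrite [RHS]big1 => [|i _]; last by rewrite scaler0.
  apply: (IHm h); first by lia.
  by move=> p q; rewrite mcoeffD.
pose lj j g := l (up s g * 'X_ord0 ^+ j).
have ljD j : {morph lj j : a b / a + b}.
  by move=> a b; rewrite /lj rmorphD mulrDl lD.
have lE i : l (f i) = \sum_(j < B) lj j (peel s (f i))`_j.
  rewrite {1}(unpeel (fB i)).
  by rewrite (@big_morph _ _ l 0 +%R 0 +%R).
under eq_bigr => i _ do rewrite lE scaler_suml.
by rewrite exchange_big big1 // => j _; apply: key; apply: ljD.
Qed.

End LeadingCoefficient.

(* The kernel of [1 (x) G] is [F[u_1, ..., u_s] (x) ker G]. *)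
Lemma tensor_kernel s n (f : 'I_n -> {mpoly 'F_2[s]}) (V W : lmodType 'F_2)
    (G : {linear V -> W}) (y : 'I_n -> V) :
  (forall m, \sum_i (f i)@_m *: G (y i) = 0) ->
  exists z : 'I_n -> V, (forall i, G (z i) = 0) /\
    (forall m, \sum_i (f i)@_m *: y i = \sum_i (f i)@_m *: z i).
Proof.
move=> Gy; pose r := undup (flatten [seq msupp (f i) | i <- enum 'I_n]).
have fr i m : m \in msupp (f i) -> m \in r.
  move=> mf; rewrite mem_undup; apply/flattenP; exists (msupp (f i)) => //.
  by apply/mapP; exists i; rewrite ?mem_enum.
pose F : 'M['F_2]_(n, size r) := \matrix_(i, b) (f i)@_(nth 0%MM r b).
pose T m := \sum_i (f i)@_m *: y i.
(* [pinvmx F] is a generalised inverse F' with F F' F = F. Each z_i is a combination of the sums T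
   m, all killed by G, and F F' F = F gives back the same sums. *)
pose z i := \sum_b pinvmx F b i *: T (nth 0%MM r b).
exists z; split=> [i|m].
  rewrite linear_sum big1 // => b _; rewrite linearZ /= linear_sum /=.
  rewrite [X in _ *: X](_ : _ = 0) ?scaler0 // -[RHS](Gy (nth 0%MM r b)).
  by apply: eq_bigr => j _; rewrite linearZ.
have [mr|mr] := boolP (m \in r); last first.
  have f0 i : (f i)@_m = 0 by apply/eqP; rewrite mcoeff_eq0; apply: contra mr; apply: fr.
  by rewrite !big1 // => i _; rewrite f0 scale0r.
have mi : (index m r < size r)%N by rewrite index_mem.
pose b0 := Ordinal mi.
have FE i : (f i)@_m = F i b0 by rewrite mxE /= nth_index.
under eq_bigr => i _ do rewrite FE.
under [RHS]eq_bigr => i _ do rewrite FE.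
have Fpinv : F *m pinvmx F *m F = F by apply: mulmxKpV.
have TE (b : 'I_(size r)) : T (nth 0%MM r b) = \sum_i F i b *: y i.
  by apply: eq_bigr => i _; rewrite mxE.
rewrite /z; under [RHS]eq_bigr => i _ do rewrite scaler_sumr.
rewrite exchange_big /=.
under [RHS]eq_bigr => b _.
  under eq_bigr => i _ do rewrite scalerA.
  rewrite -scaler_suml TE scaler_sumr.
  over.
rewrite exchange_big /=; apply: eq_bigr => i _.
under [RHS]eq_bigr => b _ do rewrite scalerA.
rewrite -scaler_suml; congr (_ *: _).
rewrite -{1}Fpinv mxE; under [RHS]eq_bigr => b _ do rewrite mulr_suml.
rewrite [RHS]exchange_big; apply: eq_bigr => j _; rewrite mxE mulr_suml.
by apply: eq_bigr => b _; rewrite mulrC mulrA mulrAC.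
Qed.

(** * From graded modules to total spaces and back *)

Section TotalModule.

Definition tot_sq (M : sqmod) (k : int) (x : Tot M) : Tot M :=
  fun d => Sq M (d - k) d (x (d - k)).

Fact tot_sq_linear M k : linear (@tot_sq M k).
Proof.
by move=> a x y; apply: totP => d; rewrite totD totZ /tot_sq totD totZ linearP.
Qed.
HB.instance Definition _ (M : sqmod) k := GRing.isLinear.Build 'F_2 (Tot M) (Tot M) *:%R
  (@tot_sq M k) (@tot_sq_linear M k).

Fact tot_sq_lt0 (M : sqmod) i (x : Tot M) : i < 0 -> tot_sq i x = 0.
Proof. by move=> i0; apply: totP => d; apply: Sq_neg; lia. Qed.

Fact tot_sq_0 (M : amodule) (x : Tot M) : tot_sq 0 x = x.
Proof.
apply: totP => d; rewrite /tot_sq.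
have E d' : d' = d -> Sq M d' d (x d') = x d.
  by move=> ->; apply: (proj1 (amoduleP M)).
by apply: E; rewrite subr0.
Qed.

Definition totsq (M : amodule) : sqspace :=
  @SqSpace (Tot M) (fun k => @tot_sq M k : {linear Tot M -> Tot M})
    (@tot_sq_lt0 M) (@tot_sq_0 M).

Lemma bm_totsq M : bullett_macdonald (totsq M).
Proof.
move=> n k c; apply: (@bm_of_adem _ n (fun i => sq (n%:Z - i%:Z) (sq i c) : totsq M)).
move=> i /andP[lin ni]; rewrite /adem_defect.
(* The Adem relations require a = n - i > 0; for a = 0 the defect is Sq^0 Sq^n + Sq^n Sq^0. *)
have [ni0|ni0] := eqVneq (n - i)%N 0%N.
  have -> : i = n by lia.
  rewrite subnn big_ord1 sub0n bin0 scale1r subrr subr0 !sq_0.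
  exact: addv2.
pose a := (n - i)%N; have aE : n%:Z - i%:Z = a by rewrite /a; lia.
apply/eqP; rewrite addv_eq0; apply/eqP; rewrite aE.
have sq2E (p q p' q' r : int) : p = p' -> q = q' ->
    Sq M q r (Sq M p q (c p)) = Sq M q' r (Sq M p' q' (c p')) by move=> -> ->.
have adem (m : int) : (sq a (sq i c) : Tot M) (m + i%:Z + a%:Z) =
    \sum_(j < (n - i)./2.+1) 'C(i - 1 - j, n - i - 2 * j)%:R *:
      (sq (n%:Z - j%:Z) (sq j c) : Tot M) (m + i%:Z + a%:Z).
  have ai : (0 < a < i.*2)%N by rewrite /a -muln2; lia.
  transitivity (Sq M (m + i%:Z) (m + i%:Z + a%:Z) (Sq M m (m + i%:Z) (c m))).
    by apply: sq2E; lia.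
  rewrite (proj2 (amoduleP M)) //; apply: eq_bigr => j _.
  rewrite scaler_nat mul2n; congr (_ *+ _).
  by apply: sq2E; rewrite -?aE; ring.
apply: totP => d; rewrite tot_sum.
have -> : d = d - i%:Z - a%:Z + i%:Z + a%:Z by ring.
by rewrite adem; apply: eq_bigr => j _; rewrite totZ.
Qed.
End TotalModule.

(* Cutting the operations off above degree [D] isolates, in a relation between
   elements of degree at least [D], those of degree [D]. *)
Section Truncation.
Variables (M : amodule) (D : int).

Definition trunc_fun (x : Tot M) : Tot M := fun d => if d <= D then x d else 0.
Fact trunc_linear : linear trunc_fun.
Proof.
move=> a x y; apply: totP => d; rewrite totD totZ /trunc_fun.
by case: ifP => _; rewrite ?totD ?totZ ?scaler0 ?addr0.
Qed.
HB.instance Definition _ := GRing.isLinear.Build 'F_2 (Tot M) (Tot M) *:%R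
  trunc_fun trunc_linear.
Definition trunc : {linear Tot M -> Tot M} := trunc_fun.

(** Sq^0 has to stay the identity on all of [Tot M] for this to be an [sqspace]; only the other
    operations are cut off. *)
Definition trunc_sq (k : int) : {linear Tot M -> Tot M} :=
  if k == 0 then (idfun : {linear Tot M -> Tot M})
  else (trunc \o @tot_sq M k : {linear Tot M -> Tot M}).

Fact trunc_sq_lt0 i (x : Tot M) : i < 0 -> trunc_sq i x = 0.
Proof.
move=> i0; rewrite /trunc_sq; case: eqP => [i0'|_]; first by move: i0; rewrite i0' ltxx.
by rewrite /= tot_sq_lt0 // linear0.
Qed.

Definition truncsq : sqspace :=
  @SqSpace (Tot M) trunc_sq trunc_sq_lt0 (fun=> erefl).

Lemma sq_trunc k (x : totsq M) :
  (trunc (sq k x) : truncsq) = sq k (trunc x : truncsq).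
Proof.
rewrite /= /trunc_sq; case: eqP => [->|_]; first by rewrite tot_sq_0.
apply: totP => d; rewrite /= /trunc_fun; case: ifP => // dD.
rewrite /tot_sq; case: ifP => // /negP dkD.
by rewrite linear0 Sq_neg //; lia.
Qed.

End Truncation.

(** Brings the Adem relations back to the graded setting: suspensions and the ambient spaces of R_s
    become modules over the Steenrod algebra through their embeddings into series. *)
Lemma steenrod_of_bm (A : sqmod) (Y : sqspace) (I : forall n, {linear A n -> Y}) :
  bullett_macdonald Y -> (forall n, injective (I n)) ->
  (forall m n (x : A m), I n (Sq A m n x) = sq (n - m) (I m x)) ->
  steenrod_relations A.
Proof.
move=> bm Iinj IS; split=> [m x|a b m x /andP[a0 ab]].
  by apply: (Iinj m); rewrite IS subrr sq_0.
apply: (Iinj (m + b%:Z + a%:Z)); rewrite linear_sum IS IS.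
have -> : m + b%:Z + a%:Z - (m + b%:Z) = a%:Z by ring.
have -> : m + b%:Z - m = b%:Z by ring.
pose e i := sq ((a + b)%N%:Z - i%:Z) (sq i%:Z (I m x)).
have H := @adem_of_bm _ (a + b)%N e.
have : adem_defect (a + b) e b = 0.
  apply: H; last by lia.
  by move=> k; apply: (bm (a + b)%N k (I m x)).
rewrite /adem_defect {1}/e.
have -> : (a + b)%N%:Z - b%:Z = a%:Z by lia.
move=> /eqP; rewrite addv_eq0 => /eqP ->; rewrite (_ : (a + b - b)%N = a); last by lia.
apply: eq_bigr => j _; rewrite raddfMn /= IS IS scaler_nat mul2n /e.
have -> : m + b%:Z + a%:Z - (m + j%:Z) = (a + b)%N%:Z - j%:Z by lia.
by have -> : m + j%:Z - m = j%:Z by ring.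
Qed.

Lemma transport_id (V : gvs) (m : int) (x : V m) : transport V m m x = x.
Proof.
by rewrite /transport /= /transport_fun; case: eqP => // e; rewrite (eq_irrelevance e erefl).
Qed.

Lemma transport_ne (V : gvs) (m n : int) (x : V m) : m != n -> transport V m n x = 0.
Proof. by move=> /eqP mn; rewrite /transport /= /transport_fun; case: eqP. Qed.

(** * Elements of R_s M as series *)

Section SeriesOfLarge.
Variables (N : sqmod) (Y : sqspace) (ph : forall n : int, {linear N n -> Y}).

(* The term [u^(n-j) (x) c_j] of a formal sum of degree [n] is found at the
   exponent [a = n - j]. *)
Definition emb1_fun (n : int) (c : large N n) : ser Y :=
  fun a => ph (n - a) (coef c (n - a)).
Fact emb1_linear n : linear (@emb1_fun n).
Proof.
move=> k c d; apply: serP => a; rewrite ser_atD ser_atZ /emb1_fun.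
exact: linearP.
Qed.
HB.instance Definition _ n := GRing.isLinear.Build 'F_2
  (large N n) (ser Y) *:%R (@emb1_fun n) (@emb1_linear n).
Definition emb1 n : {linear large N n -> ser Y} := @emb1_fun n.

Lemma emb1_at n c a : ser_at (emb1 n c) a = ph (n - a) (coef c (n - a)).
Proof. by []. Qed.

Lemma emb1_inj n : (forall m, injective (ph m)) -> injective (emb1 n).
Proof.
move=> ph_inj c d cd; apply: formal_sum_ext => j; apply: (ph_inj j).
have E (c' : large N n) : ser_at (emb1 n c') (n - j) = ph j (coef c' j).
  by rewrite emb1_at (_ : n - (n - j) = j) //; ring.
by rewrite -!E cd.
Qed.

Hypothesis ph_sq : forall m n x, ph n (Sq N m n x) = sq (n - m) (ph m x).

Lemma emb1_sq m n (c : large N m) :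
  emb1 n (Sq (large N) m n c) = sq (n - m) (emb1 m c).
Proof.
apply: serP => a; rewrite emb1_at [coef _ _]/(cartan_coef m n c (n - a)) /cartan_coef.
have [nm|] := ltP (n - m) 0.
  by rewrite sq_lt0 //; case: (n - m) nm => // k _; rewrite linear0.
case E : (n - m) => [k|] // _; rewrite (@sq_serE _ _ _ _ k.+1); last lia.
rewrite linear_sum (reindex_inj rev_ord_inj); apply: eq_bigr => i _ /=.
rewrite subSS raddfMz /= ph_sq emb1_at.
have ik : (i <= k)%N by rewrite -ltnS.
have -> : n - a - (k - i)%N%:Z = m - (a - i%:Z) by lia.
have -> : n - a - (m - (a - i%:Z)) = k%:Z - i%:Z by lia.
have -> : m - (m - (a - i%:Z)) = a - i%:Z by ring.
by rewrite (_ : k - (k - i) = i)%N; [rewrite /bz scaler_int | lia].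
Qed.

Lemma emb1_St1 d (x : N d) : emb1 (2 * d) (St1 x) = st1 d (ph d x).
Proof.
apply: serP => a; rewrite emb1_at st1E /= ph_sq.
by rewrite (_ : 2 * d - a - d = d - a) //; ring.
Qed.

End SeriesOfLarge.

Section SeriesOfLarges.
Variables (M : sqmod) (X : sqspace) (th : forall n : int, {linear M n -> X}).

Fixpoint emb s : forall n : int, {linear larges s M n -> L X s} :=
  match s with
  | 0 => th
  | s'.+1 => fun n => @emb1 (larges s' M) (L X s') (emb s') n
  end.

Lemma emb_at s n (c : larges s.+1 M n) a :
  ser_at (emb s.+1 n c) a = emb s (n - a) (coef c (n - a)).
Proof. by []. Qed.

Lemma emb_inj s n : (forall m, injective (th m)) -> injective (emb s n).
Proof. by move=> th_inj; elim: s n => [|s IH] n //; apply: emb1_inj. Qed.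

Lemma emb_mulmon s (a : nat -> nat) (m n : int) (c : larges s M m) :
  n = m + (\sum_(i < s) a i)%N%:Z ->
  emb s n (mulmon s M a m n c) = mon X s a (emb s m c).
Proof.
elim: s a m n c => [|s IH] a m n c nm.
  by rewrite big_ord0 addr0 in nm; rewrite {n}nm /= transport_id.
have {}nm : n = m + (a 0%N)%:Z + (\sum_(i < s) a i.+1)%N%:Z.
  by rewrite nm big_ord_recl PoszD addrA.
apply: serP => b; rewrite monS !emb_at /=.
rewrite IH; last by ring.
congr (mon _ _ _ _).
by rewrite (_ : n - b - (\sum_(i < s) a i.+1)%N%:Z = m - (b - (a 0%N)%:Z)) // nm; ring.
Qed.

Lemma emb_mulpoly s k (f : {mpoly 'F_2[s]}) (m n : int) (c : larges s M m) :
  f \is k.-homog -> n = m + k%:Z ->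
  emb s n (mulpoly f n c) = act f (emb s m c).
Proof.
move=> /dhomogP fk nmk; rewrite /mulpoly linear_sum; apply: eq_big_seq => a af.
rewrite linearZ /= emb_mulmon //.
rewrite nmk -(fk _ af).
rewrite [X in Posz X]mdegE; congr (_ + Posz _).
by apply: eq_bigr => i _; rewrite (mnm_nth 0%N).
Qed.

Hypothesis th_sq : forall m n x, th n (Sq M m n x) = sq (n - m) (th m x).

Lemma emb_sq s m n (c : larges s M m) :
  emb s n (Sq (larges s M) m n c) = sq (n - m) (emb s m c).
Proof. by elim: s m n c => [|s IH] m n c; [apply: th_sq | apply: emb1_sq]. Qed.

Lemma St_degE s d : St_deg s d = (2 ^ s)%N%:Z * d.
Proof.
elim: s => [|s IH]; first by rewrite mul1r.
by rewrite /St_deg /= -/(St_deg s d) IH expnS PoszM mulrA.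
Qed.

Lemma emb_St s d (x : M d) : emb s (St_deg s d) (St s x) = stn X s d (th d x).
Proof.
elim: s => [|s IH] //; rewrite stnS -IH -St_degE.
by apply: emb1_St1; apply: emb_sq.
Qed.

End SeriesOfLarges.

Lemma emb_map s (M N : sqmod) (X Y : sqspace) (th : forall n : int, {linear M n -> X})
    (th' : forall n : int, {linear N n -> Y}) (f : gmap M N) (T : {linear X -> Y}) :
  (forall n x, th' n (f n x) = T (th n x)) ->
  forall n c, emb th' s n (larges_map s f n c) = Lmap T s (emb th s n c).
Proof.
move=> fT; elim: s => [|s IH] n c //; apply: serP => a.
by rewrite LmapS !emb_at -IH.
Qed.

Lemma emb_diff s (M : sqmod) (X : sqspace) (th : forall n : int, {linear M n -> X}) n c :
  @emb (susp (-1) M) X (fun n => th (n - -1)) s n (@singer_diff s M n c) =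
  res X s (emb th s.+1 n c).
Proof.
elim: s n c => [|s IH] n c //; apply: serP => a.
by rewrite resS !emb_at -IH.
Qed.

(** A product f St_s(y) of degree n with f homogeneous in D(s). Since D(s) is a ring, the sums of
    such products make up R_s M ([singer_terms]). *)
Record term (s : nat) (M : sqmod) (n : int) := Term {
  tdeg : int;
  targ : M tdeg;
  tdim : nat;
  tpol : {mpoly 'F_2[s]};
  tpol_dickson : dickson tpol;
  tpol_homog : tpol \is tdim.-homog;
  term_deg : n = St_deg s tdeg + tdim%:Z
}.
Arguments tdeg {s M n}.
Arguments targ {s M n}.
Arguments tdim {s M n}.
Arguments tpol {s M n}.
Arguments term_deg {s M n}.

Section Singer.
Variables (M : sqmod) (X : sqspace) (th : forall n : int, {linear M n -> X}).
Hypothesis th_inj : forall m, injective (th m).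
Hypothesis th_sq : forall m n x, th n (Sq M m n x) = sq (n - m) (th m x).

(** The image of the degree n part of R_s M; n must be recorded, as series have lost their
    degree. *)
Definition sing s n (v : L X s) : Prop :=
  exists2 c : larges s M n, singer c & emb th s n c = v.

Lemma singP s n (c : larges s M n) : singer c <-> sing n (emb th s n c).
Proof.
split=> [cS|[c' c'S /(emb_inj th_inj) <-] //]; by exists c.
Qed.

Lemma sing0 s n : @sing s n 0.
Proof. by exists 0; [apply: singer_zero | rewrite linear0]. Qed.

Lemma singD s n v w : @sing s n v -> sing n w -> sing n (v + w).
Proof.
move=> [c cS <-] [d dS <-]; exists (c + d); first exact: singer_add.
by rewrite linearD.
Qed.

Lemma sing_sum s n (I : Type) (r : seq I) (P : pred I) (F : I -> L X s) :
  (forall i, P i -> sing n (F i)) -> sing n (\sum_(i <- r | P i) F i).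
Proof. by move=> FS; elim/big_rec: _ => [|i x Pi]; [apply: sing0 | apply/singD/FS]. Qed.

Lemma sing_stn s d (x : M d) n : n = St_deg s d -> sing n (stn X s d (th d x)).
Proof. by move=> ->; exists (St s x); [apply: singer_St | apply: emb_St]. Qed.

Lemma sing_act s (k : nat) (f : {mpoly 'F_2[s]}) (m n : int) v :
  dickson f -> f \is k.-homog -> n = m + k%:Z -> sing m v -> sing n (act f v).
Proof.
move=> fD fk nm [c cS <-]; exists (mulpoly f n c); first exact: (singer_mul nm).
by rewrite (@emb_mulpoly _ _ _ _ k).
Qed.

Lemma singer_terms s n (c : larges s M n) : singer c ->
  exists r : seq (term s M n),
    emb th s n c = \sum_(t <- r) act (tpol t) (stn X s (tdeg t) (th _ (targ t))).
Proof.
elim=> {n c} [d x|n|n c c' _ [r rE] _ [r' rE']|k f m n c nm fD fk _ [r rE]].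
- have one_homog : (1 : {mpoly 'F_2[s]}) \is 0.-homog by apply: dhomog1.
  have dE : St_deg s d = St_deg s d + 0%:Z by rewrite addr0.
  exists [:: Term x (@dickson1 s) one_homog dE].
  by rewrite big_seq1 /= act1 emb_St.
- by exists [::]; rewrite big_nil linear0.
- by exists (r ++ r'); rewrite big_cat linearD rE rE'.
- have mulP (t : term s M m) : n = St_deg s (tdeg t) + (k + tdim t)%N%:Z.
    by rewrite nm {1}(term_deg t); lia.
  exists [seq Term (targ t) (dicksonM fD (tpol_dickson t))
            (dhomogM fk (tpol_homog t)) (mulP t) | t <- r].
  rewrite big_map (@emb_mulpoly _ _ _ _ k) // rE linear_sum.
  by apply: eq_bigr => t _; rewrite actM.
Qed.

Hypothesis bm : bullett_macdonald X.

Lemma sing_sq_stn s d (x : M d) n :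
  sing n (sq (n - St_deg s d) (stn X s d (th d x))).
Proof.
have [nd|] := ltP (n - St_deg s d) 0; first by rewrite sq_lt0 //; apply: sing0.
case E : (n - St_deg s d) => [k|] // _.
have kq : (k < 2 ^ k)%N by apply: ltn_expl.
(* With r = k one has k < 2^r, and this q makes D = d + q 2^k at least k, as [sq_stn] requires. *)
pose q := (`|d|%N + k)%N.
have qk : (q <= q * 2 ^ k)%N by rewrite leq_pmulr ?expn_gt0.
have [D dD] : exists D : nat, d + (q * 2 ^ k)%N%:Z = D%:Z.
  by exists `|(d + (q * 2 ^ k)%N%:Z)%R|%N; rewrite /q in qk *; lia.
have kD : (k <= D)%N by rewrite /q in qk dD *; lia.
rewrite (sq_stn s (th d x) bm kq dD kD); apply: sing_sum => i _.
rewrite (_ : sq i (th d x) = th (d + i%:Z) (Sq M d (d + i%:Z) x)); last first.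
  by rewrite th_sq (_ : d + i%:Z - d = i%:Z) //; ring.
have vD := @vt_dickson s (2 ^ s * i) (D - i) k.
rewrite coefXnM in vD *; case: ltnP => [_|ik] in vD *.
  by rewrite act0l; apply: sing0.
apply: sing_act vD _ _ (sing_stn _ erefl).
  by have := graded_exp (D - i) (graded_vt s); apply.
rewrite !St_degE in E *; lia.
Qed.

Lemma sing_sq s m n (c : larges s M m) : singer c -> sing n (sq (n - m) (emb th s m c)).
Proof.
move=> cS; elim: cS n => {m c} [d x|m|m c c' _ IH _ IH'|k f m m' c mm fD fk _ IH] n.
- by rewrite emb_St //; apply: sing_sq_stn.
- by rewrite !linear0; apply: sing0.
- by rewrite !linearD; apply: singD.
- rewrite (@emb_mulpoly _ _ _ _ k) // (@cartan _ _ _ _ `|n - m'|.+1); last by lia.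
  apply: sing_sum => i _.
  have := IH (n - (k + i)%N%:Z).
  rewrite (_ : n - (k + i)%N%:Z - m = n - m' - i%:Z); last by lia.
  apply: (@sing_act _ (k + i)); last by ring.
    exact: sqpoly_dickson.
  exact: graded_sqpoly.
Qed.

Lemma singer_Sq s m n (c : larges s M m) : singer c -> singer (Sq (larges s M) m n c).
Proof. by move=> cS; apply/singP; rewrite emb_sq //; apply: sing_sq. Qed.

End Singer.

Lemma Lmap_id (X : sqspace) s c : Lmap (idfun : {linear X -> X}) s c = c.
Proof. by elim: s c => [|s IH] c //; apply: serP => a; rewrite LmapS IH. Qed.

Section SingerMap.
Variables (M N : sqmod) (X Y : sqspace) (th : forall n : int, {linear M n -> X})
  (th' : forall n : int, {linear N n -> Y}) (f : gmap M N) (T : {linear X -> Y}).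
Hypothesis th_sq : forall m n x, th n (Sq M m n x) = sq (n - m) (th m x).
Hypothesis th'_sq : forall m n x, th' n (Sq N m n x) = sq (n - m) (th' m x).
Hypothesis th_f : forall n x, th' n (f n x) = T (th n x).
Hypothesis T_sq : forall k x, T (sq k x) = sq k (T x).

Lemma sing_map s n (v : L X s) : sing th n v -> sing th' n (Lmap T s v).
Proof.
case=> c cS <-; elim: cS => {n v c} [d x|n|n c c' _ IH _ IH'|k g m n c nm gD gk _ IH].
- rewrite emb_St // Lmap_stn // -th_f; exact: sing_stn.
- by rewrite !linear0; apply: sing0.
- by rewrite !linearD; apply: singD.
- by rewrite (@emb_mulpoly _ _ _ _ k) // Lmap_act //; apply: (sing_act gD gk nm IH).
Qed.

Lemma sing_map_surj s n (w : L Y s) : (forall n y, exists x, f n x = y) ->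
  sing th' n w -> exists2 v, sing th n v & Lmap T s v = w.
Proof.
move=> f_surj [c cS <-]; elim: cS => {n w c} [d y|n|n c c' _ [v vS vE] _ [v' v'S vE']|
  k g m n c nm gD gk _ [v vS vE]].
- have [x <-] := f_surj d y; exists (stn X s d (th d x)); first exact: sing_stn.
  by rewrite Lmap_stn // -th_f emb_St.
- by exists 0; rewrite ?linear0 //; apply: sing0.
- by exists (v + v'); [apply: singD | rewrite !linearD vE vE'].
- exists (act g v); first exact: (sing_act gD gk nm vS).
  by rewrite (@emb_mulpoly _ _ _ _ k) // Lmap_act // vE.
Qed.

End SingerMap.

Section SingerDiff.
Variables (M : sqmod) (X : sqspace) (th : forall n : int, {linear M n -> X}).
Hypothesis th_sq : forall m n x, th n (Sq M m n x) = sq (n - m) (th m x).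

Definition desusp (n : int) : {linear susp (-1) M n -> X} := th (n - -1).

Lemma desusp_sq m n x : desusp n (Sq (susp (-1) M) m n x) = sq (n - m) (desusp m x).
Proof. by rewrite /desusp /= th_sq (_ : n - -1 - (m - -1) = n - m) //; ring. Qed.

(** By [res_act_stn] the residue of f St_(s+1)(x) is a D(s)-combination of elements St_s(Sq^(d+j+1)
    x), and Sq^(d+j+1) x has degree 2d + j in Sigma^(-1) M. *)
Lemma sing_res s n (c : larges s.+1 M n) : singer c ->
  sing desusp n (res X s (emb th s.+1 n c)).
Proof.
move=> /(singer_terms th_sq)[r ->]; rewrite linear_sum; apply: sing_sum => -[d x k f fD fk nE] _ /=.
have [q [qD qh q0 ->]] := res_act_stn X fD fk; apply: sing_sum => j _.
have [jk|kj] := leqP (2 ^ s * j) k; last by rewrite q0 // act0l; apply: sing0.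
rewrite (_ : sq _ _ = desusp (2 * d + j%:Z) (Sq M d (2 * d + j%:Z - -1) x)); last first.
  by rewrite /desusp th_sq; congr (sq _ _); ring.
apply: (@sing_act _ _ _ _ (k - 2 ^ s * j)%N _ (St_deg s (2 * d + j%:Z))) => //.
- exact: qh.
- by rewrite nE !St_degE expnS; lia.
- by apply: sing_stn => //; apply: desusp_sq.
Qed.

Lemma res_res_singer s n (c : larges s.+2 M n) : bullett_macdonald X -> singer c ->
  res X s (res X s.+1 (emb th s.+2 n c)) = 0.
Proof.
move=> bm /(singer_terms th_sq)[r ->]; rewrite (linear_sum (res X s.+1)) (linear_sum (res X s)).
apply: big1 => t _; apply: res_annihilated_stn => //; exact: tpol_dickson.
Qed.

End SingerDiff.

Section TotalEmbedding.

Definition tdelta_fun (V : gvs) n (x : V n) : Tot V := fun d => transport V n d x.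
Fact tdelta_linear V n : linear (@tdelta_fun V n).
Proof. by move=> a x y; apply: totP => d; rewrite totD totZ /tdelta_fun linearP. Qed.
HB.instance Definition _ (V : gvs) n := GRing.isLinear.Build 'F_2 (V n) (Tot V) *:%R
  (@tdelta_fun V n) (@tdelta_linear V n).
Definition tdelta (V : gvs) n : {linear V n -> Tot V} := @tdelta_fun V n.

Lemma tdelta_at (V : gvs) n (x : V n) : tdelta V n x n = x.
Proof. exact: transport_id. Qed.

Lemma tdelta_inj (V : gvs) n : injective (tdelta V n).
Proof. by move=> x y xy; rewrite -(tdelta_at x) xy tdelta_at. Qed.

Lemma tdelta_transport (V : gvs) m n (x : V m) : m = n ->
  tdelta V n (transport V m n x) = tdelta V m x.
Proof. by move=> mn; case: n / mn; rewrite transport_id. Qed.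

Lemma tdelta_sq (M : amodule) m n (x : M m) :
  (tdelta M n (Sq M m n x) : totsq M) = sq (n - m) (tdelta M m x : totsq M).
Proof.
apply: totP => d; rewrite /= /tot_sq /= /tdelta_fun.
have [nd|nd] := eqVneq n d.
  case: d / nd; rewrite transport_id (_ : n - (n - m) = m) ?transport_id //; ring.
rewrite transport_ne // transport_ne ?linear0 //; apply: contra nd => /eqP ?; apply/eqP; lia.
Qed.

Definition totmap_fun (V W : gvs) (f : gmap V W) (x : Tot V) : Tot W := fun d => f d (x d).
Fact totmap_linear V W f : linear (@totmap_fun V W f).
Proof. by move=> a x y; apply: totP => d; rewrite totD totZ /totmap_fun totD totZ linearP. Qed.
HB.instance Definition _ (V W : gvs) (f : gmap V W) :=
  GRing.isLinear.Build 'F_2 (Tot V) (Tot W) *:%R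
    (@totmap_fun V W f) (@totmap_linear V W f).
Definition totmap (V W : gvs) (f : gmap V W) : {linear Tot V -> Tot W} := @totmap_fun V W f.

Lemma totmap_sq (M N : amodule) (f : amod_hom M N) k (x : totsq M) :
  (totmap f (sq k x) : totsq N) = sq k (totmap f x : totsq N).
Proof. by apply: totP => d; rewrite /= /totmap_fun /tot_sq amod_homP. Qed.

Lemma totmap_tdelta (V W : gvs) (f : gmap V W) n (x : V n) :
  tdelta W n (f n x) = totmap f (tdelta V n x).
Proof.
apply: totP => d; rewrite /= /totmap_fun /tdelta_fun.
have [nd|nd] := eqVneq n d; first by case: d / nd; rewrite !transport_id.
by rewrite !transport_ne ?linear0.
Qed.

Lemma trunc_tdelta (M : amodule) D n (x : M n) :
  trunc M D (tdelta M n x) = if n <= D then tdelta M n x else 0.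
Proof.
apply: totP => d; rewrite /= /trunc_fun /= /tdelta_fun.
have [nd|nd] := eqVneq n d; first by case: d / nd; case: ifP.
rewrite transport_ne //; do 2 case: ifP => // _; by rewrite ?tdelta_at /= /tdelta_fun ?transport_ne.
Qed.

End TotalEmbedding.

HB.instance Definition _ s M n := gen_eqMixin (term s M n).

Lemma seq_min (T : eqType) (d : T -> int) (x : T) (r : seq T) :
  exists2 y, y \in x :: r & {in x :: r, forall z, d y <= d z}.
Proof.
elim: r => [|z r [y yr yP]]; first by exists x => [|z]; rewrite ?mem_head // inE => /eqP ->.
have [yz|zy] := leP (d y) (d z).
  exists y => [|t]; first by move: yr; rewrite !inE => /orP[->|->]; rewrite ?orbT.
  rewrite !inE => /or3P[tx|/eqP -> //|tr]; apply: yP; rewrite inE ?tx ?tr ?orbT //.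
exists z => [|t]; first by rewrite !inE eqxx orbT.
rewrite !inE => /or3P[tx|/eqP -> //|tr]; apply: (le_trans (ltW zy)); apply: yP;
  by rewrite inE ?tx ?tr ?orbT.
Qed.

(** * Exactness in the middle *)

Section MiddleExactness.
Variables (M N P : amodule) (f : amod_hom M N) (g : amod_hom N P).
Hypothesis fg : short_exact f g.
Variables (s : nat) (n : int).

Let tval (t : term s N n) : L (totsq N) s :=
  act (tpol t) (stn (totsq N) s (tdeg t) (tdelta N _ (targ t))).
Let G : {linear totsq N -> totsq P} := totmap g.
Let F : {linear totsq M -> totsq N} := totmap f.

Let Gsq k x : G (sq k x) = sq k (G x). Proof. exact: totmap_sq. Qed.
Let Fsq k x : F (sq k x) = sq k (F x). Proof. exact: totmap_sq. Qed.

Let Lmap_tval (t : term s N n) : Lmap G s (tval t) =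
  act (tpol t) (stn (totsq P) s (tdeg t) (tdelta P _ (g _ (targ t)))).
Proof. by rewrite /tval Lmap_act // Lmap_stn // -totmap_tdelta. Qed.

Let fam_N lo (h : {mpoly 'F_2[s]}) (y : N lo) : L (totsq N) s :=
  act h (stn (totsq N) s lo (tdelta N lo y)).
Let fam_trunc lo (h : {mpoly 'F_2[s]}) (y : P lo) : L (truncsq P lo) s :=
  act h (stn (truncsq P lo) s lo (tdelta P lo y)).

(** [stn_leading] gives sum_i h_i (x) g(y_i) = 0. By [tensor_kernel] the y_i may be replaced by
    elements of ker g without changing sum_i h_i (x) y_i, and these lift to M. *)
Lemma lowest_family lo k (h : 'I_k -> {mpoly 'F_2[s]}) (y : 'I_k -> N lo) :
  (forall i, exists d : nat,
     [/\ dickson (h i), h i \is d.-homog & n = St_deg s lo + d%:Z]) ->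
  \sum_i fam_trunc (h i) (g lo (y i)) = 0 ->
  exists2 v, @sing M (totsq M) (tdelta M) s n v &
    Lmap F s v = \sum_i fam_N (h i) (y i).
Proof.
move=> hP hy.
have lead m : \sum_i (h i)@_m *: g lo (y i) = 0.
  apply: (@tdelta_inj P lo); rewrite linear0 linear_sum.
  have := stn_leading hy (fun a b => mcoeffD m a b).
  by move=> /= {2}<-; apply: eq_bigr => i _; rewrite linearZ.
have [z [gz yz]] := tensor_kernel lead.
have /boolp.choice[w wz] : forall i, exists x, f lo x = z i.
  by move=> i; have [_ fgk _] := fg lo; apply/fgk.
exists (\sum_i act (h i) (stn (totsq M) s lo (tdelta M lo (w i)))).
  apply: sing_sum => i _; have [d [hD hd nE]] := hP i.
  apply: (sing_act hD hd nE); apply: sing_stn => //; exact: tdelta_sq.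
rewrite linear_sum; transitivity (\sum_i fam_N (h i) (z i)).
  apply: eq_bigr => i _; rewrite Lmap_act // Lmap_stn //.
  by rewrite -wz /fam_N totmap_tdelta.
symmetry; apply: (act_coef_eq (stn (totsq N) s lo \o tdelta N lo)) => m.
exact: yz.
Qed.


Let fam_NE (lo : int) (t : term s N n) : tdeg t = lo ->
  tval t = fam_N (tpol t) (transport N (tdeg t) lo (targ t)).
Proof. by move=> tlo; case: lo / tlo; rewrite /fam_N transport_id. Qed.

Let fam_truncE (lo : int) (t : term s N n) : tdeg t = lo ->
  act (tpol t) (stn (truncsq P lo) s (tdeg t) (tdelta P _ (g _ (targ t)))) =
  fam_trunc (tpol t) (g lo (transport N (tdeg t) lo (targ t))).
Proof. by move=> tlo; case: lo / tlo; rewrite /fam_trunc transport_id. Qed.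

(** St_s commutes with the truncation above degree [lo], which kills the terms of larger degree.
    Those of degree [lo] then satisfy a relation of their own, with a common parameter d as
    [stn_leading] demands. *)
Lemma lowest_terms (lo : int) (r : seq (term s N n)) :
  {in r, forall t, lo <= tdeg t} -> Lmap G s (\sum_(t <- r) tval t) = 0 ->
  exists2 v, @sing M (totsq M) (tdelta M) s n v &
    Lmap F s v = \sum_(t <- r | tdeg t == lo) tval t.
Proof.
pose H : {linear totsq P -> truncsq P lo} := trunc P lo.
have Hsq k x : H (sq k x) = sq k (H x) by apply: sq_trunc.
pose W t := Lmap H s (Lmap G s (tval t)).
have WE t : W t = act (tpol t)
    (stn (truncsq P lo) s (tdeg t) (H (tdelta P _ (g _ (targ t))))).
  by rewrite /W Lmap_tval Lmap_act // Lmap_stn.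
move=> rlo /(congr1 (Lmap H s)).
rewrite linear0 (linear_sum (Lmap G s)) (linear_sum (Lmap H s)) -/W.
have -> : \sum_(t <- r) Lmap H s (Lmap G s (tval t)) = \sum_(t <- r | tdeg t == lo) W t.
  rewrite (bigID (fun t => tdeg t == lo)) /= [X in _ + X]big1_seq ?addr0 // => t.
  move=> /andP[tlo /rlo lot]; rewrite -/(W t) WE [H _]trunc_tdelta.
  by rewrite leNgt lt_neqAle eq_sym tlo lot !linear0.
rewrite -big_filter -[X in _ -> exists2 v, _ & _ = X]big_filter.
set r0 := filter _ r => W0.
have [r0E|r0N] := eqVneq r0 [::].
  by exists 0; [apply: sing0 | rewrite linear0 r0E big_nil].
have [t0 t0r] : exists t0, t0 \in r0.
  by case: (r0) r0N => // t0 ? _; exists t0; rewrite mem_head.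
have r0P i : tdeg (nth t0 r0 i) = lo.
  have : nth t0 r0 i \in r0.
    by have [ir|ir] := ltnP i (size r0); [apply: mem_nth | rewrite nth_default].
  by rewrite mem_filter => /andP[/eqP].
pose h (i : 'I_(size r0)) := tpol (nth t0 r0 i).
pose y (i : 'I_(size r0)) : N lo := transport N (tdeg (nth t0 r0 i)) lo (targ (nth t0 r0 i)).
have -> : \sum_(t <- r0) tval t = \sum_i fam_N (h i) (y i).
  by rewrite (big_nth t0) big_mkord; apply: eq_bigr => i _; apply: fam_NE.
apply: lowest_family => [i|].
  have tP := tpol_dickson (nth t0 r0 i); have tH := tpol_homog (nth t0 r0 i).
  by exists (tdim (nth t0 r0 i)); split=> //; rewrite {1}(term_deg (nth t0 r0 i)) r0P.
rewrite -[RHS]W0 (big_nth t0) big_mkord; apply: eq_bigr => i _.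
have lei : tdeg (nth t0 r0 i) <= lo by rewrite r0P.
by rewrite -fam_truncE ?r0P // WE [H _]trunc_tdelta lei.
Qed.

(** The terms of lowest degree lift to M, so G kills their sum; the remaining terms, fewer in
    number, still add up to an element of the kernel. *)
Lemma terms_kernel (r : seq (term s N n)) : Lmap G s (\sum_(t <- r) tval t) = 0 ->
  exists2 v, @sing M (totsq M) (tdelta M) s n v & Lmap F s v = \sum_(t <- r) tval t.
Proof.
have [a] := ubnP (size r); elim: a r => // a IH [|t0 r] ra r0.
  by exists 0; [apply: sing0 | rewrite big_nil linear0].
have [t1 t1r lo] := seq_min tdeg t0 r.
set r' := t0 :: r in ra r0 t1r lo *.
have [v vS vE] := lowest_terms lo r0.
have GF x : G (F x) = 0.
  apply: totP => d; have [_ fgk _] := fg d; apply/fgk; by exists (x d).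
have GFL w : Lmap G s (Lmap F s w) = 0.
  elim: (s) w => [|s' IHs] w; [exact: GF | apply: serP => b; rewrite !LmapS; exact: IHs].
have r1 : Lmap G s (\sum_(t <- filter (fun t => tdeg t != tdeg t1) r') tval t) = 0.
  rewrite big_filter; move: r0; rewrite (bigID (fun t => tdeg t == tdeg t1)) /=.
  by rewrite linearD /= -vE GFL add0r.
have [|v' v'S v'E] := IH _ _ r1.
  apply: (@leq_trans (size r')); last by rewrite -ltnS.
  rewrite size_filter -(count_predC (fun t => tdeg t != tdeg t1)).
  rewrite -[X in (X < _)%N]addn0 ltn_add2l -has_count; apply/hasP.
  by exists t1; rewrite //= negbK eqxx.
exists (v + v'); first exact: singD.
by rewrite linearD vE v'E big_filter [RHS](bigID (fun t => tdeg t == tdeg t1)).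
Qed.

End MiddleExactness.

Section Exactness.
Variables (M N P : amodule) (f : amod_hom M N) (g : amod_hom N P).
Hypothesis fg : short_exact f g.

Lemma larges_map_inj s n : injective (larges_map s f n).
Proof.
elim: s n => [|s IH] n; first by have [] := fg n.
move=> c d cd; apply: formal_sum_ext => j; apply: IH.
exact: (congr1 (fun e : formal_sum _ => e j) cd).
Qed.

Lemma larges_map_comp0 s n c : larges_map s g n (larges_map s f n c) = 0.
Proof.
elim: s n c => [|s IH] n c; last by apply: formal_sum_ext => j; apply: IH.
by have [_ fgk _] := fg n; apply/fgk; exists c.
Qed.

Let emb_tdelta_inj (Q : amodule) s n :
  injective (emb (tdelta Q : forall n, {linear Q n -> totsq Q}) s n).
Proof. by apply: emb_inj => m; apply: tdelta_inj. Qed.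

Let emb_totmap (Q Q' : amodule) (h : amod_hom Q Q') s n c :
  emb (tdelta Q' : forall n, {linear Q' n -> totsq Q'}) s n (larges_map s h n c) =
  Lmap (totmap h : {linear totsq Q -> totsq Q'}) s
    (emb (tdelta Q : forall n, {linear Q n -> totsq Q}) s n c).
Proof. by apply: emb_map => m x; apply: totmap_tdelta. Qed.

Lemma singer_kernel s n (c : larges s N n) : singer c -> larges_map s g n c = 0 ->
  exists2 c' : larges s M n, singer c' & larges_map s f n c' = c.
Proof.
move=> /(singer_terms (@tdelta_sq N))[r cE] gc.
have [|v [c' c'S c'E] vE] := @terms_kernel M N P f g fg s n r.
  by rewrite -cE -emb_totmap gc linear0.
exists c' => //; apply: (@emb_tdelta_inj N s n); rewrite emb_totmap.
by rewrite cE -vE -c'E.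
Qed.

Lemma singer_surj s n (c : larges s P n) : singer c ->
  exists2 c' : larges s N n, singer c' & larges_map s g n c' = c.
Proof.
move=> cS; have gsurj m y : exists x, g m x = y by have [_ _] := fg m; apply.
have [|||||v [c' c'S c'E] vE] := @sing_map_surj N P (totsq N) (totsq P) (tdelta N)
  (tdelta P) g (totmap g) _ _ _ _ s n
  (emb (tdelta P : forall n, {linear P n -> totsq P}) s n c) gsurj.
- exact: tdelta_sq.
- exact: tdelta_sq.
- by move=> m x; apply: totmap_tdelta.
- exact: totmap_sq.
- by exists c.
exists c' => //; apply: (@emb_tdelta_inj P s n).
by rewrite emb_totmap -vE -c'E.
Qed.

End Exactness.

Lemma larges_map_id s (V : sqmod) n c : larges_map s (@id_gmap V) n c = c.
Proof. by elim: s n c => [|s IH] n c //; apply: formal_sum_ext => j; apply: IH. Qed.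

Lemma larges_map_comp s (U V W : sqmod) (g : gmap V W) (f : gmap U V) n c :
  larges_map s (comp_gmap g f) n c = larges_map s g n (larges_map s f n c).
Proof. by elim: s n c => [|s IH] n c //; apply: formal_sum_ext => j; apply: IH. Qed.

Lemma larges_mapD s (V W : sqmod) (f g h : gmap V W) :
  (forall n x, h n x = f n x + g n x) ->
  forall n c, larges_map s h n c = larges_map s f n c + larges_map s g n c.
Proof.
by move=> hfg; elim: s => [|s IH] n c //; apply: formal_sum_ext => j; apply: IH.
Qed.

Lemma res_Lmap (X Y : sqspace) (T : {linear X -> Y}) s c :
  res Y s (Lmap T s.+1 c) = Lmap T s (res X s c).
Proof. by elim: s c => [|s IH] c //; apply: serP => a; apply: IH. Qed.

(** * Submodules *)

(** Over F_2, closure under addition already gives closure under scalars and opposites. *)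
Record subspace (V : lmodType 'F_2) := Subspace {
  in_subspace :> V -> Prop;
  subspace0 : in_subspace 0;
  subspaceD : forall x y, in_subspace x -> in_subspace y -> in_subspace (x + y)
}.

Section Subspace.
Variables (V : lmodType 'F_2) (S : subspace V).

Record subelt := Subelt { subval :> V; subeltP : S subval }.

Lemma subval_inj : injective subval.
Proof.
case=> x xS [y yS] /= xy; case: y / xy yS => yS.
by congr Subelt; apply: Prop_irrelevance.
Qed.

HB.instance Definition _ := gen_eqMixin subelt.
HB.instance Definition _ := gen_choiceMixin subelt.

Lemma subspaceZ (a : 'F_2) x : S x -> S (a *: x).
Proof.
by case: (F2_cases a) => -> xS; rewrite ?scale0r ?scale1r //; apply: subspace0.
Qed.

Lemma subspaceN x : S x -> S (- x).
Proof. by rewrite oppv. Qed.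

Definition sub_zero := Subelt (subspace0 S).
Definition sub_opp (x : subelt) := Subelt (subspaceN (subeltP x)).
Definition sub_add (x y : subelt) := Subelt (subspaceD (subeltP x) (subeltP y)).
Definition sub_scale a (x : subelt) := Subelt (subspaceZ a (subeltP x)).

Fact sub_addA : associative sub_add.
Proof. by move=> x y z; apply: subval_inj; rewrite /= addrA. Qed.
Fact sub_addC : commutative sub_add.
Proof. by move=> x y; apply: subval_inj; rewrite /= addrC. Qed.
Fact sub_add0 : left_id sub_zero sub_add.
Proof. by move=> x; apply: subval_inj; rewrite /= add0r. Qed.
Fact sub_addN : left_inverse sub_zero sub_opp sub_add.
Proof. by move=> x; apply: subval_inj; rewrite /= addNr. Qed.
HB.instance Definition _ :=
  GRing.isZmodule.Build subelt sub_addA sub_addC sub_add0 sub_addN.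

Fact sub_scaleA a b x : sub_scale a (sub_scale b x) = sub_scale (a * b) x.
Proof. by apply: subval_inj; rewrite /= scalerA. Qed.
Fact sub_scale1 : left_id 1 sub_scale.
Proof. by move=> x; apply: subval_inj; rewrite /= scale1r. Qed.
Fact sub_scaleDr : right_distributive sub_scale +%R.
Proof. by move=> a x y; apply: subval_inj; rewrite /= scalerDr. Qed.
Fact sub_scaleDl x : {morph sub_scale^~ x : a b / a + b}.
Proof. by move=> a b; apply: subval_inj; rewrite /= scalerDl. Qed.
HB.instance Definition _ := GRing.Zmodule_isLmodule.Build 'F_2 subelt
  sub_scaleA sub_scale1 sub_scaleDr sub_scaleDl.

Fact subval_linear : linear subval.
Proof. by []. Qed.
HB.instance Definition _ :=
  GRing.isLinear.Build 'F_2 subelt V *:%R subval subval_linear.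
End Subspace.

Section Restriction.
Variables (V W : lmodType 'F_2) (S : subspace V) (S' : subspace W) (f : {linear V -> W}).
Hypothesis fS : forall x, S x -> S' (f x).

Definition restr_fun (x : subelt S) : subelt S' := Subelt (fS (subeltP x)).
Fact restr_linear : linear restr_fun.
Proof. by move=> a x y; apply: subval_inj; rewrite /= linearP. Qed.
HB.instance Definition _ :=
  GRing.isLinear.Build 'F_2 (subelt S) (subelt S') *:%R restr_fun restr_linear.
Definition restr : {linear subelt S -> subelt S'} := restr_fun.
End Restriction.

Section Submodule.
Variables (A : amodule) (S : forall n, subspace (A n)).
Hypothesis S_Sq : forall m n x, S m x -> S n (Sq A m n x).

Definition sub_gvs : gvs := fun n => subelt (S n).

Fact sub_Sq_neg (m n : int) (x : sub_gvs m) :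
  n < m -> restr (@S_Sq m n) x = 0.
Proof. by move=> nm; apply: subval_inj; rewrite /= Sq_neg. Qed.

Definition sub_sqmod : sqmod := @SqMod sub_gvs (fun m n => restr (@S_Sq m n)) sub_Sq_neg.

Fact sub_steenrod : steenrod_relations sub_sqmod.
Proof.
have [A0 Aadem] := amoduleP A; split=> [m x|a b m x ab]; apply: subval_inj.
  exact: A0.
rewrite linear_sum /= Aadem //; apply: eq_bigr => j _.
by rewrite raddfMn.
Qed.

Definition submodule : amodule := AModule sub_steenrod.

Definition submodule_incl : gmap submodule A :=
  fun n => (@subval _ (S n) : {linear subelt (S n) -> A n}).

End Submodule.

Section SubmoduleMap.
Variables (A B : amodule) (S : forall n, subspace (A n)) (S' : forall n, subspace (B n)).
Hypothesis S_Sq : forall m n x, S m x -> S n (Sq A m n x).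
Hypothesis S'_Sq : forall m n x, S' m x -> S' n (Sq B m n x).
Variable f : gmap A B.
Hypothesis f_sq : sq_equivariant f.
Hypothesis fS : forall n x, S n x -> S' n (f n x).

Definition submodule_gmap : gmap (submodule S_Sq) (submodule S'_Sq) :=
  fun n => restr (@fS n).

Fact submodule_gmapP : sq_equivariant submodule_gmap.
Proof. by move=> m n x; apply: subval_inj; apply: f_sq. Qed.

Definition submodule_hom : amod_hom (submodule S_Sq) (submodule S'_Sq) :=
  AmodHom submodule_gmapP.
End SubmoduleMap.

(** * The functor *)

Section Suspension.
Variables (k : int) (M : amodule).

Definition sdelta n : {linear susp k M n -> totsq M} := tdelta M (n - k).

Lemma sdelta_inj n : injective (sdelta n).
Proof. exact: tdelta_inj. Qed.

Lemma sdelta_sq m n x : sdelta n (Sq (susp k M) m n x) = sq (n - m) (sdelta m x).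
Proof.
rewrite /sdelta tdelta_sq.
by rewrite (_ : n - k - (m - k) = n - m) //; ring.
Qed.

Fact susp_steenrod : steenrod_relations (susp k M).
Proof. exact: steenrod_of_bm (@bm_totsq M) sdelta_inj sdelta_sq. Qed.

Definition susp_amod : amodule := AModule susp_steenrod.
End Suspension.

Fact susp_homP (k : int) (M N : amodule) (f : amod_hom M N) :
  @sq_equivariant (susp_amod k M) (susp_amod k N) (susp_gmap k f).
Proof. by move=> m n x; apply: (@amod_homP M N f (m - k) (n - k) x). Qed.

Definition susp_hom (k : int) (M N : amodule) (f : amod_hom M N) :
  amod_hom (susp_amod k M) (susp_amod k N) := AmodHom (@susp_homP k M N f).

Section DModule.
Variables (s : nat) (M : amodule).

Definition emb_D n : {linear D_ambient s M n -> L (totsq M) s} :=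
  emb (@sdelta (s%:Z - 1) M) s (n - 1).

Lemma emb_D_inj n : injective (emb_D n).
Proof. by apply: emb_inj; apply: sdelta_inj. Qed.

Lemma emb_D_sq m n c : emb_D n (Sq (D_ambient s M) m n c) = sq (n - m) (emb_D m c).
Proof.
rewrite /emb_D emb_sq; last exact: sdelta_sq.
by rewrite (_ : n - 1 - (m - 1) = n - m) //; ring.
Qed.

Fact D_ambient_steenrod : steenrod_relations (D_ambient s M).
Proof. exact: steenrod_of_bm (bm_L (@bm_totsq M)) emb_D_inj emb_D_sq. Qed.

Definition D_large : amodule := AModule D_ambient_steenrod.

Definition D_subspace n : subspace (D_large n) :=
  Subspace (@singer_zero s (susp (s%:Z - 1) M) (n - 1))
    (@singer_add s (susp (s%:Z - 1) M) (n - 1)).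

Lemma D_sub_Sq m n c : D_subspace m c -> D_subspace n (Sq D_large m n c).
Proof. exact: singer_Sq (@sdelta_inj _ M) (@sdelta_sq _ M) (@bm_totsq M) _ _ _ _. Qed.

Definition D_module : amodule := submodule D_sub_Sq.

End DModule.

Section DDifferential.
Variables (s : nat) (M : amodule).

Let regroup := @susp_susp (-1) (s.+1%:Z - 1) (s%:Z - 1) M.

(** With degrees forgotten, the canonical isomorphism of Sigma^(-1) Sigma^s M with Sigma^(s-1) M
    becomes the identity, and the differential becomes the bare residue. *)
Let sdelta_regroup n x :
  @sdelta (s%:Z - 1) M n (regroup n x) =
  (idfun : {linear totsq M -> totsq M}) (desusp (@sdelta (s.+1%:Z - 1) M) n x).
Proof. by apply: tdelta_transport; rewrite intS; ring. Qed.

Lemma emb_D_diff n c : emb_D s M n (D_diff s M n c) = res (totsq M) s (emb_D s.+1 M n c).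
Proof.
rewrite /emb_D -(emb_diff (@sdelta (s.+1%:Z - 1) M)) -[RHS]Lmap_id.
by apply: emb_map; apply: sdelta_regroup.
Qed.

Fact D_diffP : @sq_equivariant (D_large s.+1 M) (D_large s M) (D_diff s M).
Proof.
move=> m n c; apply: (@emb_D_inj s M n).
by rewrite emb_D_diff !emb_D_sq sq_res emb_D_diff.
Qed.

Lemma D_diff_sub n c : D_subspace s.+1 M n c -> D_subspace s M n (D_diff s M n c).
Proof.
move=> /(sing_res (@sdelta_sq _ M)) cS.
apply/(singP (@sdelta_inj _ M)); rewrite -/(emb_D s M n _) emb_D_diff -[res _ _ _]Lmap_id.
exact: (sing_map (desusp_sq (@sdelta_sq _ M)) (@sdelta_sq _ M) sdelta_regroup
  (fun _ _ => erefl) cS).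
Qed.

Definition D_diff_hom : amod_hom (D_module s.+1 M) (D_module s M) :=
  submodule_hom (@D_sub_Sq s.+1 M) (@D_sub_Sq s M) D_diffP D_diff_sub.

End DDifferential.

Fact D_diff_diff (M : amodule) s n (x : D_module s.+2 M n) :
  D_diff_hom s M n (D_diff_hom s.+1 M n x) = 0.
Proof.
apply: subval_inj; apply: (@emb_D_inj s M n); rewrite linear0.
rewrite -[LHS]/(emb_D s M n (D_diff s M n (D_diff s.+1 M n (subval x)))) !emb_D_diff.
exact: res_res_singer (@sdelta_sq _ M) _ _ _ (@bm_totsq M) (subeltP x).
Qed.

Definition D_complex (M : amodule) : complex :=
  @Complex (fun s => D_module s M) (fun s => D_diff_hom s M) (@D_diff_diff M).

Section DMap.
Variables (M N : amodule) (f : amod_hom M N).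

Let sdelta_map k n x : @sdelta k N n (susp_gmap k f n x) =
  (totmap f : {linear totsq M -> totsq N}) (@sdelta k M n x).
Proof. exact: totmap_tdelta. Qed.

Lemma emb_D_map s n c : emb_D s N n (@D_map s M N f n c) =
  Lmap (totmap f : {linear totsq M -> totsq N}) s (emb_D s M n c).
Proof. by apply: emb_map; apply: sdelta_map. Qed.

Fact D_mapP s : @sq_equivariant (D_large s M) (D_large s N) (@D_map s M N f).
Proof.
move=> m n c; apply: (@emb_D_inj s N n).
by rewrite emb_D_map !emb_D_sq sq_Lmap ?emb_D_map //; apply: totmap_sq.
Qed.

Lemma D_map_sub s n c : D_subspace s M n c -> D_subspace s N n (@D_map s M N f n c).
Proof.
move=> cS; apply/(singP (@sdelta_inj _ N)); rewrite -/(emb_D s N n _) emb_D_map.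
apply: (sing_map (@sdelta_sq _ M) (@sdelta_sq _ N)); last by exists c.
  exact: sdelta_map.
exact: totmap_sq.
Qed.

Definition D_hom s : amod_hom (D_module s M) (D_module s N) :=
  submodule_hom (@D_sub_Sq s M) (@D_sub_Sq s N) (@D_mapP s) (@D_map_sub s).

Fact D_homP s n (x : D_module s.+1 M n) :
  D_hom s n (D_diff_hom s M n x) = D_diff_hom s N n (D_hom s.+1 n x).
Proof.
apply: subval_inj; apply: (@emb_D_inj s N n).
rewrite -[LHS]/(emb_D s N n (@D_map s M N f n (D_diff s M n (subval x)))).
rewrite -[RHS]/(emb_D s N n (D_diff s N n (@D_map s.+1 M N f n (subval x)))).
by rewrite emb_D_map !emb_D_diff emb_D_map res_Lmap.
Qed.

Definition D_chain_map : chain_map (D_complex M) (D_complex N) :=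
  @ChainMap (D_complex M) (D_complex N) D_hom D_homP.

End DMap.

Fact D_map_id (M : amodule) s n (x : D_complex M s n) :
  D_chain_map (amod_hom_id M) s n x = x.
Proof. by apply: subval_inj; apply: larges_map_id. Qed.

Fact D_map_comp (M N P : amodule) (g : amod_hom N P) (f : amod_hom M N) s n
    (x : D_complex M s n) :
  D_chain_map (amod_hom_comp g f) s n x = D_chain_map g s n (D_chain_map f s n x).
Proof.
pose k := s%:Z - 1; apply: subval_inj.
exact: (@larges_map_comp s (susp k M) (susp k N) (susp k P) (susp_gmap k g)
  (susp_gmap k f) (n - 1) (subval x)).
Qed.

Definition D_functor : functor := Functor D_map_id D_map_comp.

Lemma D_functor_exact : exact_functor D_functor.
Proof.
split=> [M N f g h hfg s n x|M N P f g fg s n].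
  by apply: subval_inj; apply: larges_mapD => m y; apply: hfg.
pose k := s%:Z - 1.
have sfg : short_exact (susp_hom k f) (susp_hom k g) by move=> m; apply: fg.
split=> [x y xy|y|z].
- apply: subval_inj; apply: (larges_map_inj sfg).
  exact: (congr1 (@subval _ (D_subspace s N n)) xy).
- split=> [gy|[x <-]]; last by apply: subval_inj; apply: (larges_map_comp0 sfg).
  have [|c cS cE] := singer_kernel sfg (subeltP y).
    exact: (congr1 (@subval _ (D_subspace s P n)) gy).
  by exists (@Subelt _ (D_subspace s M n) c cS); apply: subval_inj.
- have [c cS cE] := singer_surj sfg (subeltP z).
  by exists (@Subelt _ (D_subspace s N n) c cS); apply: subval_inj.
Qed.

Theorem corollary5p1p3 :
  exists D : functor, exact_functor D /\
  exists i : forall (M : amodule) (s : nat), gmap (D M s) (D_ambient s M),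
    [/\ forall (M : amodule) (s : nat), identifies_with (i M s) (@D_sub s M),
        forall (M : amodule) (s : nat) (n : int) (x : D M s.+1 n),
          i M s n (diff (D M) s n x) = D_diff s M n (i M s.+1 n x)
      & forall (M N : amodule) (f : amod_hom M N) (s : nat) (n : int) (x : D M s n),
          i N s n (fmap D f s n x) = @D_map s M N f n (i M s n x)].
Proof.
exists D_functor; split; first exact: D_functor_exact.
exists (fun M s => submodule_incl (@D_sub_Sq s M)); split=> // M s.
split=> // [n|n c]; first exact: subval_inj.
by split=> [cS|[x <-]]; [exists (@Subelt _ (D_subspace s M n) c cS) | exact: (subeltP x)].
Qed.
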